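(* Let $M\in\mathbb N$. Let $\mu>0$ and let $\psi_1,\dots,\psi_M$ be primary front solutions (as described in the context, for this $\mu$) of $$-\psi''+\mu V(x)\psi+\omega\psi+\psi^3=0\qquad(\ast)$$ with end states $v_{j,\pm}(\mu)$, and assume $v_{j,+}(\mu)=v_{j+1,-}(\mu)$ for $j=1,\dots,M-1$. Then there exists $N\in\mathbb N$ such that for any $n\in\mathbb N$ with $n\ge N$ there exists a nondegenerate real-valued solution $\tilde\psi_n$ of $(\ast)$ of the form $$\tilde\psi_n=a_n+\sum_{j=1}^M\chi_{j,n}\,\psi_j(\cdot-jnT),$$ where $\{a_n\}_n$ is a sequence in $H^2(\mathbb R)$ converging to $0$ as $n\to\infty$.
   Context: Let $\omega<0$, $T>0$, and let $V\in C^1(\mathbb R)$ be even, $T$-periodic and real-valued. Equation $(\ast)$ describes real-valued stationary solutions of the defocusing Gross–Pitaevskii equation. A real-valued bounded solution $\psi$ of $(\ast)$ is nondegenerate if the operator $\varphi\mapsto-\varphi''+\mu V\varphi+\omega\varphi+3\psi^2\varphi$ on $L^2(\mathbb R)$ with domain $H^2(\mathbb R)$ is invertible. $H^2_{\rm per}(0,T)$: $T$-periodic, locally $H^2$ functions. $\chi_\pm:\mathbb R\to[0,1]$ is a smooth partition of unity with $\chi_+$ supported on $(-1,\infty)$, $\chi_-$ on $(-\infty,1)$, $\chi_+(x)=\chi_-(-x)$. Primary fronts. Let $\psi_0(x)=\sqrt{-\omega}\tanh(\sqrt{-\omega/2}\,x)$ (not to be confused with the fronts $\psi_j$, $j\ge1$)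 and assume $\int_{\mathbb R}V'\psi_0\psi_0'\,dx\ne0$. Then there are $C,\mu_0>0$ such that for $\mu\in(0,\mu_0)$ there is a nondegenerate odd solution $\psi(\mu)$ of $(\ast)$ with $\|\psi(\mu)-\psi_0\|_{L^\infty}\le C\mu$ and $\chi_\pm(\psi(\mu)-v_\pm(\mu))\in H^2(\mathbb R)$, where $v_\pm(\mu)\in H^2_{\rm per}(0,T)$, $v_-(\mu)=-v_+(\mu)$, are even solutions of $(\ast)$ with $\|v_\pm(\mu)\mp\sqrt{-\omega}\|_{H^2_{\rm per}(0,T)}\le C\mu$. By reflection symmetry $-\psi(\mu)$ is also a nondegenerate solution, connecting $v_+(\mu)$ (at $-\infty$) to $v_-(\mu)$ (at $+\infty$). The primary fronts are $\psi(\mu)$ and $-\psi(\mu)$; $v_{j,\pm}(\mu)$ denotes the end state of $\psi_j$ at $\pm\infty$. For $M\ge2$ and (sufficiently large) $n$, $\chi_{j,n}:\mathbb R\to[0,1]$, $j=1,\dots,M$, is a smooth partition of unity with $\|\chi_{j,n}\|_{W^{2,\infty}}$ bounded by an $n$-independent constant, $\chi_{1,n}$ supported on $(-\infty,\frac32nT+1)$, $\chi_{M,n}$ on $((M-\frac12)nT-1,\infty)$, and $\chi_{j,n}$ on $((j-\frac12)nT-1,(j+\frac12)nT+1)$ for $2\le j\le M-1$; for $M=1$, $\chi_{1,n}\equiv1$. *)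

(* Defs.v *)
From mathcomp Require Import all_boot all_order all_algebra.
From mathcomp Require Import all_classical all_reals all_analysis.

Set Implicit Arguments.
Unset Strict Implicit.
Unset Printing Implicit Defensive.

Import Order.TTheory GRing.Theory Num.Theory.
Import numFieldNormedType.Exports.

Local Open Scope ring_scope.
Local Open Scope classical_set_scope.

Section FunctionSpaces.
Context {R : realType}.
Implicit Types (A : set R) (f g phi : R -> R).

Notation leb := (@lebesgue_measure R).

Definition smooth f := forall (k : nat) (x : R), derivable (derive1n k f) x 1.

Definition fsupport f : set R := closure [set x | f x != 0].

Definition test_function phi := smooth phi /\ compact (fsupport phi).

Definition weak_derivative f g :=
  [/\ locally_integrable setT f, locally_integrable setT g &
      forall phi, test_function phi ->
        \int[leb]_x (f x * derive1 phi x) = - \int[leb]_x (g x * phi x)].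

(* A representative: weak derivatives are unique almost everywhere.
   It is 0 when f has no weak derivative. *)
Definition wderiv f : R -> R := xget (cst 0) [set g | weak_derivative f g].

Definition L2 f := f \in Lfun leb 2%:E.

Definition L2loc f := forall a b : R, L2 (f \_ `[a, b]).

Definition H2 f := exists f1 f2,
  [/\ weak_derivative f f1, weak_derivative f1 f2, L2 f, L2 f1 & L2 f2].

Definition H2loc f := exists f1 f2,
  [/\ weak_derivative f f1, weak_derivative f1 f2,
      L2loc f, L2loc f1 & L2loc f2].

Definition H2per (T : R) f := periodic f T /\ H2loc f.

Definition L2norm f : \bar R := ('N[leb]_2%:E[EFin \o f])%E.

Definition Loonorm f : \bar R := ('N[leb]_+oo[EFin \o f])%E.

Definition H2norm_on A f : \bar R :=
  ((\int[leb]_(x in A)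
      ((f x) ^+ 2 + (wderiv f x) ^+ 2 + (wderiv (wderiv f) x) ^+ 2)%:E)
   `^ 2^-1)%E.

Definition H2norm f := H2norm_on setT f.

Definition H2per_norm (T : R) f := H2norm_on `]0, T[ f.

(* For smooth f, where classical and weak derivatives agree. *)
Definition W2oonorm f : \bar R :=
  (Loonorm f + Loonorm (derive1 f) + Loonorm (derive1n 2 f))%E.

(* Invertibility of an operator on L^2(R) with domain dom, both up to
   almost everywhere equality: bijective from dom onto L^2(R), with bounded
   inverse. *)
Definition invertible_on_L2 (dom : (R -> R) -> Prop)
    (A : (R -> R) -> (R -> R)) :=
  [/\ forall f, L2 f -> exists2 phi, dom phi & A phi = f %[ae leb],
      forall phi, dom phi -> A phi = cst 0 %[ae leb] ->
        phi = cst 0 %[ae leb] &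
      exists C : R, forall phi, dom phi ->
        (L2norm phi <= C%:E * L2norm (A phi))%E].

End FunctionSpaces.

Section GrossPitaevskii.
Context {R : realType}.
Implicit Types (omega T mu C : R) (V psi vm vp : R -> R) (M n : nat).

Definition GP_solution omega V mu psi := forall x : R,
  [/\ derivable psi x 1, derivable (derive1 psi) x 1 &
      - derive1n 2 psi x + mu * V x * psi x + omega * psi x + psi x ^+ 3 = 0].

Definition GP_linearization omega V mu psi (phi : R -> R) : R -> R :=
  fun x => - wderiv (wderiv phi) x + mu * V x * phi x + omega * phi x
           + 3 * psi x ^+ 2 * phi x.

Definition nondegenerate_solution omega V mu psi :=
  [/\ GP_solution omega V mu psi,
      exists K : R, forall x, `|psi x| <= K &
      invertible_on_L2 H2 (GP_linearization omega V mu psi)].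

Definition tanh (x : R) : R := (expR x - expR (- x)) / (expR x + expR (- x)).

Definition black_soliton omega (x : R) : R :=
  Num.sqrt (- omega) * tanh (Num.sqrt (- omega / 2) * x).

Record cutoff_pair (chip chim : R -> R) : Prop := CutoffPair {
  cutoff_pair_smooth : smooth chip /\ smooth chim ;
  cutoff_pair_range : forall x, 0 <= chip x <= 1 /\ 0 <= chim x <= 1 ;
  cutoff_pair_sum : forall x, chip x + chim x = 1 ;
  cutoff_pair_supp : fsupport chip `<=` `]-1, +oo[ /\
                     fsupport chim `<=` `]-oo, 1[ ;
  cutoff_pair_sym : forall x, chip x = chim (- x) }.

(* psi mu, vp mu, vm mu stand for psi(mu), v_+(mu), v_-(mu), 0 < mu < mu0. *)
Definition primary_front_family omega T V (chip chim : R -> R) C (mu0 : R)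
    (psi vp vm : R -> R -> R) :=
  forall mu, 0 < mu < mu0 ->
  [/\ [/\ nondegenerate_solution omega V mu (psi mu),
          forall x, psi mu (- x) = - psi mu x &
          (Loonorm (fun x => psi mu x - black_soliton omega x)%R
             <= (C * mu)%:E)%E],
      H2 (fun x => chip x * (psi mu x - vp mu x)) /\
      H2 (fun x => chim x * (psi mu x - vm mu x)),
      forall x, vm mu x = - vp mu x,
      [/\ H2per T (vp mu),
          forall x, vp mu (- x) = vp mu x,
          GP_solution omega V mu (vp mu) &
          (H2per_norm T (fun x => vp mu x - Num.sqrt (- omega))%R
             <= (C * mu)%:E)%E] &
      [/\ H2per T (vm mu),
          forall x, vm mu (- x) = vm mu x,
          GP_solution omega V mu (vm mu) &
          (H2per_norm T (fun x => vm mu x + Num.sqrt (- omega))%R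
             <= (C * mu)%:E)%E]].

(* f is psi or - psi; fm and fp are its end states at -oo and +oo. *)
Definition primary_front psi vp vm (f fm fp : R -> R) :=
  [/\ f = psi, fm = vm & fp = vp] \/
  [/\ f = (fun x => - psi x), fm = vp & fp = vm].

(* The open set allowed for the support of chi_{j,n}, 1 <= j <= M, 2 <= M. *)
Definition cutoff_window T M n (j : nat) : set R :=
  if j == 1%N then `]-oo, (3 / 2 * n%:R * T + 1)[
  else if j == M then `]((M%:R - 1 / 2) * n%:R * T - 1), +oo[
  else `]((j%:R - 1 / 2) * n%:R * T - 1), ((j%:R + 1 / 2) * n%:R * T + 1)[.

(* chi j n stands for chi_{j,n}; only 1 <= j <= M and n0 <= n matter. *)
Definition cutoff_family T M (n0 : nat) (chi : nat -> nat -> R -> R) :=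
  if M == 1%N then forall n, (n0 <= n)%N -> forall x, chi 1%N n x = 1
  else
  [/\ forall n j, (n0 <= n)%N -> (1 <= j <= M)%N ->
        [/\ smooth (chi j n), forall x, 0 <= chi j n x <= 1 &
            fsupport (chi j n) `<=` cutoff_window T M n j],
      forall n, (n0 <= n)%N -> forall x, \sum_(1 <= j < M.+1) chi j n x = 1 &
      exists K : R, forall n j, (n0 <= n)%N -> (1 <= j <= M)%N ->
        (W2oonorm (chi j n) <= K%:E)%E].

End GrossPitaevskii.

(* Main.v *)
(* Let Phi be the glued profile sum_j chi_j psi_j(. - jnT). Consecutive fronts share an
   end state, up to which they and their derivatives decay, so the residual of Phi lives
   on boundedly many unit bands and tends to 0. Since V is T-periodic and psi_j = +-psi,
   the linearization at each translated front has the potential of psi, translated, and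
   hence an inverse bounded uniformly in n and j. Slowly varying plateaus th_j glue these
   inverses to a parametrix for every operator - w'' + q w with q close to the j-th
   potential where th_j <> 0. A quasi-Newton iteration with this parametrix, controlled in
   the sup norm by the Sobolev inequality, yields the correction a_n; the same iteration
   applied to the linearization at Phi + a_n gives its surjectivity, and localizing with
   th_j gives the lower bound. *)
Require Import Defs.
From mathcomp Require Import all_boot all_order all_algebra.
From mathcomp Require Import all_classical all_reals all_analysis.
From mathcomp Require Import measurable_realfun.
From mathcomp Require Import ring lra.

Set Implicit Arguments.
Unset Strict Implicit.
Unset Printing Implicit Defensive.

Import Order.TTheory GRing.Theory Num.Theory.
Import numFieldNormedType.Exports.

Local Open Scope ring_scope.
Local Open Scope classical_set_scope.

(** * Derivatives, smooth functions and test functions *)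

Section Derivatives.
Context {R : realType}.
Implicit Types f g df dg : R -> R.

(** Two partitions are used at once. The data are cut by sharp cells, since nothing differentiates
    them; the local solutions are cut by wider plateaus that equal 1 on the cells. Only the plateaus
    are differentiated, and their slopes are O(1/L), where L = nT is the spacing. The prescribed
    chi_{j,n} could not serve here, because their transition layers have bounded width. Those thin
    layers are instead what makes the residual small in L2: on a band of fixed length a sup bound
    suffices, so the decay of the fronts towards their end states needs no rate. Invertibility at
    one front gives only an L2 bound; the equation and an interpolation inequality upgrade it to H2.
    Halving residuals, rather than contracting a map, requires only difference quotients of the
    nonlinearity, so the linear problem is a special case and neither a Neumann series nor
    completeness of L2 is called on. For each tolerance a correction exists beyond some threshold in
    n, with no rate relating the two; hence the diagonal choice of a_n at the end. *)

Definition has_deriv f df := forall x : R, is_derive x (1 : R) f (df x).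

Lemma has_derivE f df : has_deriv f df -> derive1 f = df.
Proof. by move=> fd; apply/funext => x; rewrite derive1E; exact: derive_val. Qed.

Lemma has_deriv_derivable f df : has_deriv f df -> forall x, derivable f x 1.
Proof. by move=> fd x; have := fd x; case. Qed.

Lemma derivable_has_deriv f :
  (forall x, derivable f x 1) -> has_deriv f (derive1 f).
Proof. by move=> fd x; rewrite derive1E; exact: derivableP. Qed.

Lemma has_deriv_continuous f df : has_deriv f df -> continuous f.
Proof.
move=> fd x; apply: differentiable_continuous.
exact/derivable1_diffP/(has_deriv_derivable fd).
Qed.

Lemma has_deriv_cst c : has_deriv (fun=> c) (fun=> 0).
Proof. by move=> x; exact: is_derive_cst. Qed.

Lemma has_derivD f df g dg : has_deriv f df -> has_deriv g dg ->
  has_deriv (fun x => f x + g x) (fun x => df x + dg x).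
Proof. by move=> fd gd x; exact: is_deriveD. Qed.

Lemma has_derivN f df : has_deriv f df ->
  has_deriv (fun x => - f x) (fun x => - df x).
Proof. by move=> fd x; exact: is_deriveN. Qed.

Lemma has_derivB f df g dg : has_deriv f df -> has_deriv g dg ->
  has_deriv (fun x => f x - g x) (fun x => df x - dg x).
Proof. by move=> fd gd; apply: has_derivD => //; exact: has_derivN. Qed.

Lemma has_derivM f df g dg : has_deriv f df -> has_deriv g dg ->
  has_deriv (fun x => f x * g x) (fun x => df x * g x + f x * dg x).
Proof.
move=> fd gd x; apply: (is_derive_eq (is_deriveM (fd x) (gd x)));
rewrite addrC; congr (_ + _); exact: mulrC.
Qed.

Lemma has_derivZ c f df : has_deriv f df ->
  has_deriv (fun x => c * f x) (fun x => c * df x).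
Proof.
move=> fd x; have := has_derivM (has_deriv_cst c) fd x.
by rewrite mul0r add0r.
Qed.

Lemma has_deriv_affine f df a b : has_deriv f df ->
  has_deriv (fun x => f (a * x + b)) (fun x => a * df (a * x + b)).
Proof.
move=> fd x; rewrite mulrC; apply: (@is_derive1_comp R f (fun x => a * x + b)); first exact: fd.
have h : has_deriv (fun x => a * x + b) (fun x => a * 1 + 0).
  by apply: has_derivD; [apply: has_derivZ => y; exact: is_derive_id|exact: has_deriv_cst].
by have := h x; rewrite mulr1 addr0.
Qed.

Lemma has_deriv_shift f df c : has_deriv f df ->
  has_deriv (fun x => f (x - c)) (fun x => df (x - c)).
Proof.
move=> /(@has_deriv_affine _ _ 1 (- c)) h x; have := h x.
under [X in is_derive _ _ X _]eq_fun do rewrite mul1r.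
by rewrite !mul1r.
Qed.

Lemma has_deriv_sum (I : Type) (r : seq I) (F dF : I -> R -> R) :
  (forall i, has_deriv (F i) (dF i)) ->
  has_deriv (fun x => \sum_(i <- r) F i x) (fun x => \sum_(i <- r) dF i x).
Proof.
move=> Fd; elim: r => [|i r ih].
  rewrite (_ : (fun x => _) = fun=> 0); last by apply/funext => x; rewrite big_nil.
  rewrite (_ : (fun x => \sum_(i <- [::]) dF i x) = fun=> 0); last first.
    by apply/funext => x; rewrite big_nil.
  exact: has_deriv_cst.
rewrite (_ : (fun x => _) = fun x => F i x + \sum_(j <- r) F j x); last first.
  by apply/funext => x; rewrite big_cons.
rewrite (_ : (fun x => \sum_(j <- i :: r) dF j x) =
    fun x => dF i x + \sum_(j <- r) dF j x); last first.
  by apply/funext => x; rewrite big_cons.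
exact: has_derivD.
Qed.

Lemma has_deriv_unique f df dg : has_deriv f df -> has_deriv f dg -> df = dg.
Proof. by move=> /has_derivE <- /has_derivE <-. Qed.

Lemma near_has_deriv_eq0 f df x :
  (\forall y \near x, f y = 0) -> has_deriv f df -> df x = 0.
Proof.
move=> f0 /has_derivE <-; rewrite derive1E.
rewrite (@near_eq_derive _ _ _ f (cst 0)) ?oner_neq0 ?derive_cst//.
Qed.

(** [smooth] puts the new derivative outermost. Here it is innermost, so that closure under sums,
    products and affine changes of variable goes by induction on [k]. *)
Fixpoint diffn (k : nat) f : Prop :=
  if k is k'.+1 then (forall x, derivable f x 1) /\ diffn k' (derive1 f)
  else True.

Lemma smoothP f : smooth f <-> forall k, diffn k f.
Proof.
split=> [fs k|fd k].
  elim: k f fs => [//|k ih] f fs; split; first exact: (fs 0%N).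
  by apply: ih => n x; rewrite -derive1Sn; exact: fs.
elim: k f fd => [|k ih] f fd x; first by have [] := fd 1%N.
by rewrite derive1Sn; apply: ih => n; have [] := fd n.+1.
Qed.

Lemma diffnS k f : diffn k.+1 f -> diffn k f.
Proof.
elim: k f => [//|k ih] f [fd [fd' h]]; split => //; exact: ih.
Qed.

Lemma diffnD k f g : diffn k f -> diffn k g -> diffn k (fun x => f x + g x).
Proof.
elim: k f g => [//|k ih] f g [fd fk] [gd gk].
have h := has_derivD (derivable_has_deriv fd) (derivable_has_deriv gd).
split; first exact: has_deriv_derivable h.
by rewrite (has_derivE h); exact: ih.
Qed.

Lemma diffnM k f g : diffn k f -> diffn k g -> diffn k (fun x => f x * g x).
Proof.
elim: k f g => [//|k ih] f g fk1 gk1.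
have [fd fk] := fk1; have [gd gk] := gk1.
have h := has_derivM (derivable_has_deriv fd) (derivable_has_deriv gd).
split; first exact: has_deriv_derivable h.
by rewrite (has_derivE h); apply: diffnD; apply: ih => //; exact: diffnS.
Qed.

Lemma diffn_cst k c : diffn k (fun=> c).
Proof.
elim: k c => [//|k ih] c; split; first exact: has_deriv_derivable (has_deriv_cst c).
by rewrite (has_derivE (has_deriv_cst c)).
Qed.

Lemma smooth_cst c : smooth (fun=> c : R).
Proof. by apply/smoothP => k; exact: diffn_cst. Qed.

Lemma smoothD f g : smooth f -> smooth g -> smooth (fun x => f x + g x).
Proof. by move=> /smoothP fs /smoothP gs; apply/smoothP => k; exact: diffnD. Qed.

Lemma smoothM f g : smooth f -> smooth g -> smooth (fun x => f x * g x).
Proof. by move=> /smoothP fs /smoothP gs; apply/smoothP => k; exact: diffnM. Qed.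

Lemma smoothB f g : smooth f -> smooth g -> smooth (fun x => f x - g x).
Proof.
move=> fs gs; have := smoothD fs (smoothM (@smooth_cst (-1)) gs).
by rewrite (_ : (fun x => _) = fun x => f x - g x)//; apply/funext => x; rewrite mulN1r.
Qed.

Lemma smooth_affine f a b : smooth f -> smooth (fun x => f (a * x + b)).
Proof.
move=> /smoothP fs; apply/smoothP => k; elim: k f fs => [//|k ih] f fs.
have fd x : derivable f x 1 by have [] := fs 1%N.
have h := has_deriv_affine a b (derivable_has_deriv fd).
split; first exact: has_deriv_derivable h.
rewrite (has_derivE h); apply: diffnM; first exact: diffn_cst.
by apply: (ih (derive1 f)) => n; have [] := fs n.+1.
Qed.

Lemma smooth_shift f c : smooth f -> smooth (fun x => f (x - c)).
Proof.
move=> /(@smooth_affine _ 1 (- c)); rewrite (_ : (fun x => _) = fun x => f (x - c))//.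
by apply/funext => x; rewrite mul1r.
Qed.

Lemma smooth_has_deriv f : smooth f -> has_deriv f (derive1 f).
Proof. by move=> fs; apply: derivable_has_deriv => x; exact: (fs 0%N). Qed.

Lemma smooth_derive1 f : smooth f -> smooth (derive1 f).
Proof. by move=> fs k x; rewrite -derive1Sn; exact: fs. Qed.

Lemma smooth_continuous f : smooth f -> continuous f.
Proof. by move=> /smooth_has_deriv /has_deriv_continuous. Qed.

Lemma fsupport_eq0 f x : ~ fsupport f x -> f x = 0.
Proof.
move=> fx; apply/eqP; apply: contra_notT fx => fx0; exact: subset_closure.
Qed.

Lemma near_fsupport f x : ~ fsupport f x -> \forall y \near x, f y = 0.
Proof.
move=> fx.
have : nbhs x (~` fsupport f).
  by apply: open_nbhs_nbhs; split => //; apply: closed_openC; exact: closed_closure.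
by apply: filterS => y; exact: fsupport_eq0.
Qed.

Lemma near_derive1_eq0 f (x : R) : (\forall y \near x, f y = 0) ->
  \forall y \near x, derive1 f y = 0.
Proof.
move=> /nbhs_interior; apply: filterS => y fy.
rewrite derive1E (@near_eq_derive _ _ _ f (cst 0)) ?oner_neq0 ?derive_cst//.
Qed.

(** Compact support through a radius: it passes to derivatives, products and translates without
    handling closures. *)
Definition vanishes_off (A : R) f := forall x, A < `|x| -> f x = 0.

Lemma vanishes_off_derive1 A f : vanishes_off A f -> vanishes_off A (derive1 f).
Proof.
move=> fA x Ax; apply: (@nbhs_singleton _ _ [set y | derive1 f y = 0]).
apply: near_derive1_eq0.
have : \forall y \near x, A < `|y|.
  by have /cvgr_gt := @norm_continuous _ _ x; apply.
by apply: filterS => y; exact: fA.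
Qed.

Lemma test_functionP f :
  test_function f <-> smooth f /\ exists A, vanishes_off A f.
Proof.
split=> [[fs /compact_bounded[A [_ fA]]]|[fs [A fA]]]; split=> //.
  exists (A + 1) => x Ax; apply: fsupport_eq0 => fx.
  by have := fA (A + 1); rewrite ltrDl ltr01 => /(_ isT x fx) /=; rewrite leNgt Ax.
apply: (@subclosed_compact _ _ `[- A, A]).
- exact: closed_closure.
- exact: segment_compact.
- rewrite /fsupport [X in _ `<=` X](closure_id _).1; last exact: itv_closed.
  apply: closure_subset => x /= fx; rewrite in_itv/= -ler_norml leNgt.
  by apply/negP => /fA /eqP; exact/negP.
Qed.

Lemma test_function_derive1 f : test_function f -> test_function (derive1 f).
Proof.
move=> /test_functionP[fs [A fA]]; apply/test_functionP; split.
  exact: smooth_derive1.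
by exists A; exact: vanishes_off_derive1.
Qed.

Lemma test_functionMl f g : smooth f -> test_function g ->
  test_function (fun x => f x * g x).
Proof.
move=> fs /test_functionP[gs [A gA]]; apply/test_functionP; split.
  exact: smoothM.
by exists A => x /gA ->; rewrite mulr0.
Qed.

Lemma test_function_shift f c : test_function f ->
  test_function (fun x => f (x - c)).
Proof.
move=> /test_functionP[fs [A fA]]; apply/test_functionP; split.
  exact: smooth_shift.
exists (A + `|c|) => x Ax; apply: fA.
by have := ler_normD (x - c) c; rewrite subrK; lra.
Qed.

End Derivatives.

(** * Local integrability, translation invariance, almost everywhere arguments *)

Section Integration.
Context {R : realType}.
Implicit Types f g h m : R -> R.
Notation leb := (@lebesgue_measure R).
Notation locint := (@locally_integrable R setT).

Lemma continuous_measurable f : continuous f -> measurable_fun setT f.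
Proof. exact: continuous_measurable_fun. Qed.

Lemma continuous_bounded_itv f (a b : R) : continuous f ->
  exists K, forall x, a <= x <= b -> `|f x| <= K.
Proof.
move=> fc.
have : compact (f @` `[a, b]).
  by apply: continuous_compact; [exact: continuous_subspaceT|exact: segment_compact].
move=> /compact_bounded[K [_ fK]]; exists (K + 1) => x xab.
by apply: (fK (K + 1)); [rewrite ltrDl|exists x => //=; rewrite in_itv].
Qed.

Lemma locint_itv f a b : locint f -> leb.-integrable `[a, b] (EFin \o f).
Proof.
move=> [mf _ fK]; apply/integrableP; split.
  by apply/measurable_EFinP; exact: measurable_funTS.
by apply: fK => //; exact: segment_compact.
Qed.

Lemma itv_locint f : measurable_fun setT f ->
  (forall A, leb.-integrable `[- A, A] (EFin \o f)) -> locint f.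
Proof.
move=> mf fi; split => //; first exact: openT.
move=> K _ Kc; have [A [_ KA]] := compact_bounded Kc.
have [mf' fA] := integrableP _ _ _ (fi (A + 1)).
apply: le_lt_trans fA; apply: ge0_subset_integral => //=.
- exact: compact_measurable.
- by apply/measurable_EFinP; apply: measurableT_comp => //; exact/measurable_EFinP.
- move=> x Kx /=; rewrite in_itv/= -ler_norml; apply: (KA (A + 1)) => //.
  by rewrite ltrDl.
Qed.

Lemma integrable_itvMl f m a b : continuous m ->
  leb.-integrable `[a, b] (EFin \o f) ->
  leb.-integrable `[a, b] (EFin \o (fun x => m x * f x)).
Proof.
move=> mc fi; have [K mK] := continuous_bounded_itv a b mc.
apply: (@integrableMr _ _ _ leb `[a, b]%classic _ m (EFin \o f)) => //.
  by apply: measurable_funTS; exact: continuous_measurable.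
exists K; split; first exact: num_real.
move=> L KL x /=; rewrite in_itv/= => /mK /le_trans; apply; exact: ltW.
Qed.

Lemma locintMl f m : continuous m -> locint f -> locint (fun x => m x * f x).
Proof.
move=> mc fi; apply: itv_locint.
  apply: measurable_funM; last by case: fi.
  exact: continuous_measurable.
by move=> A; apply: integrable_itvMl => //; exact: locint_itv.
Qed.

Lemma locintD f g : locint f -> locint g -> locint (fun x => f x + g x).
Proof. exact: locally_integrableD. Qed.

Lemma locint_cst c : locint (fun=> c).
Proof.
apply: itv_locint => // A; apply: measurable_bounded_integrable => //.
  by apply: compact_finite_measure; exact: segment_compact.
exists `|c|; split; first exact: num_real.
by move=> L cL x _ /=; exact: ltW.
Qed.

Lemma continuous_locint f : continuous f -> locint f.
Proof.
move=> fc; rewrite (_ : f = fun x => f x * 1); last by apply/funext => x; rewrite mulr1.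
by apply: locintMl => //; exact: locint_cst.
Qed.

Lemma integrable_vanishes f A : locint f -> vanishes_off A f ->
  leb.-integrable setT (EFin \o f).
Proof.
move=> fi fA; have := locint_itv (- A) A fi.
move=> /(@integrable_mkcond _ _ _ leb `[- A, A]%classic (EFin \o f)).
move=> /(_ (measurable_itv _)) h; apply: eq_integrable h => // x _ /=.
rewrite patchE; case: ifPn => // /negP; rewrite inE /= in_itv/= -ler_norml => /negP.
by rewrite -ltNge => /fA ->.
Qed.

Lemma integrable_test f g : locint f -> test_function g ->
  leb.-integrable setT (EFin \o (fun x => f x * g x)).
Proof.
move=> fi /test_functionP[/smooth_continuous gc [A gA]].
apply: (@integrable_vanishes _ A) => [|x /gA ->]; last by rewrite mulr0.
rewrite (_ : (fun x => _) = fun x => g x * f x); last by apply/funext => x; rewrite mulrC.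
exact: locintMl.
Qed.

Lemma Rintegral_vanishes f A : vanishes_off A f ->
  \int[leb]_x f x = \int[leb]_(x in `[- A, A]) f x.
Proof.
move=> fA; rewrite [RHS]Rintegral_mkcond; apply: eq_Rintegral => x _.
rewrite patchE; case: ifPn => // /negP; rewrite inE /= in_itv/= -ler_norml => /negP.
by rewrite -ltNge => /fA ->.
Qed.

(** By uniqueness of Lebesgue measure it is enough that the pushforward gives half-open intervals
    their length. *)
Lemma lebesgue_measure_shift (c : R) (A : set R) : measurable A ->
  pushforward leb ((fun x => x + c) : _ -> measurableTypeR R) A = leb A.
Proof.
have mc : measurable_fun setT ((fun x => x + c) : R -> measurableTypeR R).
  exact: measurable_funD.
move=> mA; apply/esym; apply: (@lebesgue_measure_unique R (pushforward leb ((fun x => x + c) : _ -> measurableTypeR R))) => //= _ [[a b]] _ <-.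
rewrite /pushforward/= (_ : _ @^-1` _ = `](a - c), (b - c)]%classic); last first.
  by apply/seteqP; split=> x/=; rewrite !in_itv/=; lra.
rewrite !lebesgue_measure_itv/= !lte_fin ltrD2r.
by case: ifP => // _; rewrite -!EFinD; congr EFin; lra.
Qed.

Lemma ge0_integral_shift (f : R -> \bar R) c : measurable_fun setT f ->
  (forall x, (0 <= f x)%E) ->
  (\int[leb]_x f (x + c)%R = \int[leb]_x f x)%E.
Proof.
move=> mf f0.
have mc : measurable_fun setT ((fun x => x + c) : measurableTypeR R -> measurableTypeR R).
  exact: measurable_funD.
have := ge0_integral_pushforward mc leb (@measurableT _ (measurableTypeR R)) mf (fun y _ => f0 y).
rewrite preimage_setT => <-.
by apply: eq_measure_integral => A mA _; exact: lebesgue_measure_shift.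
Qed.

Lemma integral_shift f c : leb.-integrable setT (EFin \o f) ->
  \int[leb]_x f (x + c) = \int[leb]_x f x.
Proof.
move=> fi.
have mf : measurable_fun setT f by apply/measurable_EFinP; case/integrableP: fi.
have mc : measurable_fun setT ((fun x : R => x + c)) by exact: measurable_funD.
rewrite /Rintegral; congr fine.
rewrite [LHS]integralE [RHS]integralE; congr (_ - _)%E.
  transitivity (\int[leb]_x ((EFin \o f)^\+ (x + c)%R))%E.
    by apply: eq_integral => x _; rewrite !funeposE.
  apply: (@ge0_integral_shift (EFin \o f)^\+%E c) => //.
  by apply: measurable_funepos; exact/measurable_EFinP.
transitivity (\int[leb]_x ((EFin \o f)^\- (x + c)%R))%E.
  by apply: eq_integral => x _; rewrite !funenegE.
apply: (@ge0_integral_shift (EFin \o f)^\-%E c) => //.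
by apply: measurable_funeneg; exact/measurable_EFinP.
Qed.

Lemma locint_shift f c : locint f -> locint (fun x => f (x + c)).
Proof.
move=> fi; have mf : measurable_fun setT f by case: fi.
have mfc : measurable_fun setT (fun x : R => f (x + c)).
  by apply: (@measurableT_comp _ _ _ _ _ _ f) => //; exact: measurable_funD.
apply: itv_locint => // A; apply/integrableP; split.
  by apply/measurable_EFinP; exact: measurable_funTS.
have /integrableP[_] := locint_itv (- A + c) (A + c) fi.
rewrite integral_mkcond [X in _ -> (X < _)%E]integral_mkcond.
rewrite -(@ge0_integral_shift _ c).
- apply: le_lt_trans; rewrite le_eqVlt; apply/orP; left; apply/eqP.
  apply: eq_integral => x _; rewrite !patchE; congr (if _ then _ else _).
  by apply/idP/idP; rewrite !inE /= !in_itv/= !lerD2r.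
- by apply/(measurable_restrictT _ _).1 => //; apply: measurable_funTS; do 2 apply: measurableT_comp => //.
- by move=> x; rewrite patchE; case: ifP.
Qed.

Lemma leb_aeS (P Q : R -> Prop) : (forall x, P x -> Q x) ->
  (\forall x \ae leb, P x) -> \forall x \ae leb, Q x.
Proof.
by move=> PQ; apply: (@filterS _ _ (ae_filter_ringOfSetsType leb)).
Qed.

Lemma leb_aeS2 (P Q S : R -> Prop) : (forall x, P x -> Q x -> S x) ->
  (\forall x \ae leb, P x) -> (\forall x \ae leb, Q x) -> \forall x \ae leb, S x.
Proof.
by move=> PQ; apply: (@filterS2 _ _ (ae_filter_ringOfSetsType leb)).
Qed.

(** An open interval has positive measure, so no null set contains it. This is how points with an
    almost sure property are picked. *)
Lemma leb_ae_itv (P : R -> Prop) (a b : R) : (\forall x \ae leb, P x) -> a < b ->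
  exists x, a < x < b /\ P x.
Proof.
move=> [N [mN N0 PN]] ab; apply: contrapT => nP.
have abN : `]a, b[ `<=` N.
  move=> x /=; rewrite in_itv/= => xab; apply: PN => /= Px.
  by apply: nP; exists x.
have : (leb `]a, b[ <= leb N)%E by apply: le_measure => //; rewrite inE.
rewrite [X in (_ <= X)%E]N0 lebesgue_measure_itv/= lte_fin ab -EFinB lee_fin.
by rewrite leNgt subr_gt0 ab.
Qed.

Lemma leb_aeW (P : R -> Prop) : (forall x, P x) -> \forall x \ae leb, P x.
Proof. by move=> Px; apply: aeW. Qed.

Lemma leb_ae_neq (c : R) : \forall x \ae leb, x != c.
Proof.
exists [set c]; split; [exact: measurable_set1|exact: lebesgue_measure_set1|].
by move=> x /= /negP /negPn /eqP.
Qed.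

End Integration.

(** * Functions of bounded L2 norm *)

Section L2bounds.
Context {R : realType}.
Implicit Types f g h m : R -> R.
Notation leb := (@lebesgue_measure R).
Notation locint := (@locally_integrable R setT).

(** A bound for the L2 norm instead of the norm itself: bounds combine in the real numbers, without
    extended arithmetic. Only [a ^+ 2] enters, so signs matter just where bounds are added or
    compared. *)
Definition L2le f (a : R) :=
  measurable_fun setT f /\ (\int[leb]_x ((f x) ^+ 2)%:E <= (a ^+ 2)%:E)%E.

Lemma measurable_sqr f : measurable_fun setT f ->
  measurable_fun setT (fun x => ((f x) ^+ 2)%:E).
Proof. by move=> mf; apply/measurable_EFinP; exact: measurable_funX. Qed.

Lemma L2le_meas f a : L2le f a -> measurable_fun setT f.
Proof. by case. Qed.

Lemma L2le_weaken f a b : a ^+ 2 <= b ^+ 2 -> L2le f a -> L2le f b.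
Proof. by move=> ab [mf fa]; split=> //; apply: le_trans fa _; rewrite lee_fin. Qed.

Lemma L2leW f a b : 0 <= a -> a <= b -> L2le f a -> L2le f b.
Proof.
move=> a0 ab; apply: L2le_weaken; rewrite lerXn2r// nnegrE; exact: le_trans ab.
Qed.

Lemma L2le_le f g a : measurable_fun setT f ->
  (forall x, `|f x| <= `|g x|) -> L2le g a -> L2le f a.
Proof.
move=> mf fg [mg ga]; split => //; apply: le_trans ga.
apply: ge0_le_integral => //.
- by move=> x _; rewrite lee_fin sqr_ge0.
- exact: measurable_sqr.
- exact: measurable_sqr.
- by move=> x _; rewrite lee_fin -(real_normK (num_real (f x))) -(real_normK (num_real (g x))) lerXn2r ?nnegrE//.
Qed.

Lemma L2le_ae f g a : measurable_fun setT g -> f = g %[ae leb] ->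
  L2le f a -> L2le g a.
Proof.
move=> mg fg [mf fa]; split => //; apply: le_trans fa.
rewrite (@ae_eq_integral _ _ _ leb setT (fun x => (f x ^+ 2)%:E) (fun x => (g x ^+ 2)%:E)) //.
- exact: measurable_sqr.
- exact: measurable_sqr.
- by apply: leb_aeS fg => x /= fgx xT; rewrite fgx.
Qed.

Lemma L2leZ f a c : L2le f a -> L2le (fun x => c * f x) (c * a).
Proof.
move=> [mf fa]; split; first exact: measurable_funM.
under eq_integral do rewrite exprMn EFinM.
rewrite ge0_integralZl_EFin//.
- by rewrite (exprMn _ c a) (EFinM (c ^+ 2)); apply: lee_wpmul2l => //; rewrite lee_fin sqr_ge0.
- by move=> x _; rewrite lee_fin sqr_ge0.
- exact: measurable_sqr.
- exact: sqr_ge0.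
Qed.

Lemma L2leN f a : L2le f a -> L2le (fun x => - f x) a.
Proof.
move=> fa; apply: (@L2le_le _ f) => //; last by move=> x; rewrite normrN.
by apply: measurable_funN; case: fa.
Qed.

Lemma L2leM f m a K : measurable_fun setT m -> 0 <= K ->
  (forall x, `|m x| <= K) -> L2le f a -> L2le (fun x => m x * f x) (K * a).
Proof.
move=> mm K0 mK fa; apply: (@L2le_le _ (fun x => K * f x)).
- by apply: measurable_funM => //; case: fa.
- by move=> x; rewrite !normrM ler_wpM2r// (ger0_norm K0).
- exact: L2leZ.
Qed.

(** Minkowski from the pointwise bound (f + g)^2 <= (1 + b/a) f^2 + (1 + a/b) g^2, whose defect is
    (b f - a g)^2 / (a b). The weights are those for which the right side integrates to at most (a +
    b)^2. *)
Lemma L2leD_gt0 f g a b : 0 < a -> 0 < b -> L2le f a -> L2le g b ->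
  L2le (fun x => f x + g x) (a + b).
Proof.
move=> a0 b0 [mf fa] [mg gb]; split; first exact: measurable_funD.
pose c := 1 + b / a; pose d := 1 + a / b.
have c0 : 0 <= c by rewrite addr_ge0// divr_ge0// ltW.
have d0 : 0 <= d by rewrite addr_ge0// divr_ge0// ltW.
apply: (@le_trans _ _ (\int[leb]_x (c%:E * (f x ^+ 2)%:E + d%:E * (g x ^+ 2)%:E))%E).
  apply: ge0_le_integral => //.
  - by move=> x _; rewrite lee_fin sqr_ge0.
  - by apply: measurable_sqr; exact: measurable_funD.
  - by apply: emeasurable_funD; apply: measurable_funeM; exact: measurable_sqr.
  - move=> x _; rewrite -!EFinM -EFinD lee_fin -subr_ge0.
    rewrite (_ : _ - _ = (b * f x - a * g x) ^+ 2 / (a * b)).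
      by rewrite divr_ge0 ?sqr_ge0// mulr_ge0// ltW.
    by rewrite /c /d; field; rewrite !gt_eqF.
rewrite ge0_integralD//.
- rewrite !ge0_integralZl_EFin//.
  + apply: (@le_trans _ _ (c%:E * (a ^+ 2)%:E + d%:E * (b ^+ 2)%:E)%E).
      by apply: leeD; apply: lee_wpmul2l.
    rewrite -!EFinM -EFinD lee_fin le_eqVlt; apply/orP; left; apply/eqP.
    by rewrite /c /d; field; rewrite !gt_eqF.
  + by move=> x _; rewrite lee_fin sqr_ge0.
  + exact: measurable_sqr.
  + by move=> x _; rewrite lee_fin sqr_ge0.
  + exact: measurable_sqr.
- by move=> x _; rewrite mule_ge0// lee_fin sqr_ge0.
- by apply: measurable_funeM; exact: measurable_sqr.
- by move=> x _; rewrite mule_ge0// lee_fin sqr_ge0.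
- by apply: measurable_funeM; exact: measurable_sqr.
Qed.

Lemma L2le_gt f a : 0 <= a -> (forall e, 0 < e -> L2le f (a + e)) -> L2le f a.
Proof.
move=> a0 fa; have [mf fa1] := fa 1 ltr01; split=> //.
apply/lee_addgt0Pr => e e0.
(* With d <= 1, (a + d)^2 <= a^2 + d (2 a + 1) <= a^2 + e. *)
pose d := Num.min 1 (e / (2 * a + 1)).
have a1 : 0 < 2 * a + 1 by lra.
have d0 : 0 < d by rewrite lt_min ltr01 divr_gt0.
have [_ /le_trans] := fa d d0; apply; rewrite -EFinD lee_fin.
have d1 : d <= 1 by rewrite ge_min lexx.
have de : d * (2 * a + 1) <= e by rewrite -ler_pdivlMr// ge_min lexx orbT.
have : d * d <= d * 1 by rewrite ler_wpM2l// ltW.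
by rewrite expr2; nra.
Qed.

Lemma L2leD f g a b : 0 <= a -> 0 <= b -> L2le f a -> L2le g b ->
  L2le (fun x => f x + g x) (a + b).
Proof.
move=> a0 b0 fa gb; apply: L2le_gt => [|e e0]; first exact: addr_ge0.
rewrite (_ : a + b + e = (a + e / 2) + (b + e / 2)); last by field.
by apply: L2leD_gt0; rewrite ?ltr_wpDl ?divr_gt0//; [apply: L2leW fa|apply: L2leW gb];
  rewrite // lerDl divr_ge0// ltW.
Qed.

Lemma L2leB f g a b : 0 <= a -> 0 <= b -> L2le f a -> L2le g b ->
  L2le (fun x => f x - g x) (a + b).
Proof. by move=> a0 b0 fa gb; apply: L2leD => //; exact: L2leN. Qed.

Lemma L2le0 a : L2le (fun=> 0) a.
Proof.
split; first exact: measurable_cst.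
under eq_integral do rewrite expr0n/=.
by rewrite integral0 lee_fin sqr_ge0.
Qed.

Lemma L2le_sum (I : Type) (r : seq I) (F : I -> R -> R) (a : I -> R) :
  (forall i, 0 <= a i) -> (forall i, L2le (F i) (a i)) ->
  L2le (fun x => \sum_(i <- r) F i x) (\sum_(i <- r) a i).
Proof.
move=> a0 Fa; elim: r => [|i r ih].
  rewrite big_nil (_ : (fun x => _) = fun=> 0); first exact: L2le0.
  by apply/funext => x; rewrite big_nil.
rewrite big_cons (_ : (fun x => _) = fun x => F i x + \sum_(j <- r) F j x).
  by apply: L2leD => //; exact: sumr_ge0.
by apply/funext => x; rewrite big_cons.
Qed.

Lemma L2le_shift f a c : L2le f a -> L2le (fun x => f (x + c)) a.
Proof.
move=> [mf fa]; split.
  by apply: (@measurableT_comp _ _ _ _ _ _ f) => //; exact: measurable_funD.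
rewrite (@ge0_integral_shift _ (fun x => (f x ^+ 2)%:E))//.
  exact: measurable_sqr.
by move=> x; rewrite lee_fin sqr_ge0.
Qed.

(** Fatou's lemma; it carries L2 bounds over to the pointwise limit of the iteration. *)
Lemma L2le_lim (f_ : nat -> R -> R) f a : (forall n, L2le (f_ n) a) ->
  (forall x, f_ n x @[n --> \oo] --> f x) -> L2le f a.
Proof.
move=> fa ff.
have mf : measurable_fun setT f.
  by apply: (@measurable_fun_cvg _ _ _ setT f_) => // n; case: (fa n).
split=> //.
have mf2 n : measurable_fun setT (fun x => (f_ n x ^+ 2)%:E).
  by apply: measurable_sqr; case: (fa n).
have := @fatou _ _ _ leb setT measurableT (fun n x => (f_ n x ^+ 2)%:E) mf2.
have f20 : forall n x, setT x -> (0 <= (f_ n x ^+ 2)%:E)%E.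
  by move=> n x _; rewrite lee_fin sqr_ge0.
move=> /(_ f20); rewrite (_ : (fun x => limn_einf _) = fun x => (f x ^+ 2)%:E).
  move=> /le_trans; apply; rewrite limn_einf_lim; apply: lime_le.
    exact: is_cvg_einfs.
  apply: nearW => n; apply: (@le_trans _ _ (\int[leb]_x (f_ n x ^+ 2)%:E)%E).
    by apply: ereal_inf_lbound; exists n => /=.
  by case: (fa n).
apply/funext => x; apply: (cvg_limn_einf_sup _).1.
apply: cvg_EFin; first exact: nearW.
exact: (cvgM (ff x) (ff x)).
Qed.

(** Young's inequality |f g| <= (b / 2a) f^2 + (a / 2b) g^2, each term of which integrates to at
    most a b / 2. *)
Lemma L2le_Holder f g a b : 0 < a -> 0 < b -> L2le f a -> L2le g b ->
  leb.-integrable setT (EFin \o (fun x => f x * g x)) /\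
  `|\int[leb]_x (f x * g x)| <= a * b.
Proof.
move=> a0 b0 [mf fa] [mg gb].
have mfg : measurable_fun setT (fun x => f x * g x) by exact: measurable_funM.
pose c := b / (2 * a); pose d := a / (2 * b).
have c0 : 0 <= c by rewrite divr_ge0// ?mulr_ge0// ltW.
have d0 : 0 <= d by rewrite divr_ge0// ?mulr_ge0// ltW.
have h : (\int[leb]_x `|(f x * g x)%:E| <= (a * b)%:E)%E.
  apply: (@le_trans _ _ (\int[leb]_x (c%:E * (f x ^+ 2)%:E + d%:E * (g x ^+ 2)%:E))%E).
    apply: ge0_le_integral => //.
    - by apply: measurableT_comp => //; exact/measurable_EFinP.
    - by apply: emeasurable_funD; apply: measurable_funeM; exact: measurable_sqr.
    - move=> x _; rewrite -!EFinM -EFinD lee_fin -subr_ge0.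
      rewrite -(real_normK (num_real (f x))) -(real_normK (num_real (g x))) normrM.
      rewrite (_ : _ - _ = (b * `|f x| - a * `|g x|) ^+ 2 / (2 * a * b)).
        by rewrite divr_ge0 ?sqr_ge0// !mulr_ge0// ltW.
      by rewrite /c /d; field; rewrite !gt_eqF.
  rewrite ge0_integralD//.
  - rewrite !ge0_integralZl_EFin//.
    + apply: (@le_trans _ _ (c%:E * (a ^+ 2)%:E + d%:E * (b ^+ 2)%:E)%E).
        by apply: leeD; apply: lee_wpmul2l.
      rewrite -!EFinM -EFinD lee_fin le_eqVlt; apply/orP; left; apply/eqP.
      by rewrite /c /d; field; rewrite !gt_eqF.
    + by move=> x _; rewrite lee_fin sqr_ge0.
    + exact: measurable_sqr.
    + by move=> x _; rewrite lee_fin sqr_ge0.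
    + exact: measurable_sqr.
  - by move=> x _; rewrite mule_ge0// lee_fin sqr_ge0.
  - by apply: measurable_funeM; exact: measurable_sqr.
  - by move=> x _; rewrite mule_ge0// lee_fin sqr_ge0.
  - by apply: measurable_funeM; exact: measurable_sqr.
have fgi : leb.-integrable setT (EFin \o (fun x => f x * g x)).
  apply/integrableP; split; first exact/measurable_EFinP.
  by apply: le_lt_trans h _; rewrite ltry.
split=> //.
rewrite -lee_fin EFin_normr_Rintegral//; apply: le_trans h.
by apply: le_abse_integral => //; exact/measurable_EFinP.
Qed.

Lemma L2le_locint f a : L2le f a -> locint f.
Proof.
move=> [mf fa]; apply: itv_locint => // A; apply/integrableP; split.
  by apply/measurable_EFinP; exact: measurable_funTS.
apply: (@le_lt_trans _ _ (\int[leb]_(x in `[(- A)%R, A]) (1%:E + (f x ^+ 2)%:E))%E).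
  apply: ge0_le_integral => //.
  - by apply: measurableT_comp => //; apply/measurable_EFinP; exact: measurable_funTS.
  - by apply: emeasurable_funD => //; apply: measurable_funTS; exact: measurable_sqr.
  - move=> x _; rewrite -EFinD lee_fin -(real_normK (num_real (f x))).
    by have := sqr_ge0 (`|f x| - 1); nra.
rewrite ge0_integralD//.
- apply: lte_add_pinfty.
    by rewrite integral_cst// mul1e; apply: compact_finite_measure; exact: segment_compact.
  apply: (@le_lt_trans _ _ (a ^+ 2)%:E); last exact: ltry.
  apply: le_trans fa; apply: ge0_subset_integral => //; first exact: measurable_sqr.
  by move=> x _; rewrite lee_fin sqr_ge0.
- by move=> x _; rewrite lee_fin sqr_ge0.
- by apply: measurable_funTS; exact: measurable_sqr.
Qed.

Lemma L2le_patch f (A : set R) a : measurable A -> L2le f a -> L2le (f \_ A) a.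
Proof.
move=> mA fa; apply: (@L2le_le _ f) => //.
  by apply/(measurable_restrictT _ _).1 => //; apply: measurable_funTS; case: fa.
by move=> x; rewrite patchE; case: ifP => // _; rewrite normr0.
Qed.

End L2bounds.

(** * Weak derivatives *)

Section LebesguePoints.
Context {R : realType}.
Implicit Types f g h m s : R -> R.
Notation leb := (@lebesgue_measure R).
Notation locint := (@locally_integrable R setT).

Lemma Rintegral_itvD f (a b c : R) : locint f -> a <= b -> b <= c ->
  \int[leb]_(x in `[a, c]) f x =
  \int[leb]_(x in `[a, b]) f x + \int[leb]_(x in `[b, c]) f x.
Proof.
move=> fi ab bc.
have := @Rintegral_itvB R f (BLeft a) (BRight c) b (locint_itv a c fi).
rewrite !bnd_simp => /(_ ab bc).
rewrite Rintegral_itv_obnd_cbnd; last first.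
  apply: integrableS (locint_itv b c fi) => //.
  by apply: subset_itvr; rewrite bnd_simp.
by move=> <-; rewrite addrC subrK.
Qed.

(** The oriented integral from 0 to x: whatever the sign of x, one of the two integrals is over a
    point or the empty set. *)
Definition primitive f (x : R) : R :=
  \int[leb]_(t in `[0, x]) f t - \int[leb]_(t in `[x, 0]) f t.

Lemma primitiveB f a b : locint f -> a <= b ->
  primitive f b - primitive f a = \int[leb]_(t in `[a, b]) f t.
Proof.
move=> fi ab; rewrite /primitive.
have z (x y : R) : y <= x -> \int[leb]_(t in `[x, y]) f t = 0.
  rewrite le_eqVlt => /predU1P[->|yx]; first by rewrite set_itv1 Rintegral_set1.
  by rewrite set_itv_ge ?Rintegral_set0// bnd_simp -ltNge.
have [a0|a0] := leP 0 a.
  rewrite (z b 0) ?(le_trans a0)// (z a 0)// !subr0.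
  by rewrite (Rintegral_itvD fi a0 ab) addrAC subrr add0r.
have [b0|b0] := leP 0 b.
  rewrite (z b 0)// (z 0 a) ?(ltW a0)// subr0 sub0r opprK.
  by rewrite (Rintegral_itvD fi (ltW a0) b0) addrC.
rewrite (z 0 b) ?(ltW b0)// (z 0 a) ?(ltW a0)// !sub0r opprK.
by rewrite (Rintegral_itvD fi ab (ltW b0)) addrC addrK.
Qed.

Lemma primitive_locE f A x : locint f -> - A <= x ->
  primitive f x = parameterized_integral leb (- A) x f + primitive f (- A).
Proof. by move=> fi Ax; rewrite /parameterized_integral -primitiveB// subrK. Qed.

Lemma primitive_continuous f : locint f -> continuous (primitive f).
Proof.
move=> fi x; pose A := `|x| + 1.
have xA : - A < x < A by have := ler_norm x; have := ler_norm (- x); rewrite normrN /A; lra.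
have AA : - A < A by lra.
have := parameterized_integral_continuous (ltW AA) (locint_itv (- A) A fi).
move=> /(continuous_within_itvP _ AA)[/(_ x)]; rewrite in_itv/= => /(_ xA) h _ _.
have : {for x, continuous (fun y => parameterized_integral leb (- A) y f + primitive f (- A))}.
  by apply: cvgD => //; exact: cvg_cst.
move=> hc; rewrite /continuous_at (@primitive_locE f A x) //; last by case/andP: xA => /ltW.
apply: cvg_trans hc; apply: near_eq_cvg.
have : \forall y \near x, - A < y by apply: lt_nbhsr; case/andP: xA.
by apply: filterS => y /ltW Ay; rewrite (primitive_locE fi Ay).
Qed.

Lemma primitive_has_deriv f : continuous f -> has_deriv (primitive f) f.
Proof.
move=> fc x; have fi := continuous_locint fc; pose A := `|x| + 1.
have xA : - A < x < A by have := ler_norm x; have := ler_norm (- x); rewrite normrN /A; lra.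
have [/andP[Ax xA'] _] := (xA, xA).
have [dF F'] := continuous_FTC1_closed xA' (locint_itv (- A) A fi) Ax (fc x).
have h : is_derive x (1 : R) (fun y => \int[leb]_(t in `[- A, y]) f t + primitive f (- A)) (f x).
  rewrite -[f x]addr0 -F' derive1E.
  by apply: is_deriveD; first exact: derivableP.
apply: near_eq_is_derive h.
have : \forall y \near x, - A < y by apply: lt_nbhsr.
by apply: filterS => y /ltW Ay; rewrite (primitive_locE fi Ay).
Qed.

(** The given [chip] is such a function. Mollifiers, approximate indicators and plateaus are all
    obtained from it by rescaling, so no smooth cutoff has to be constructed. *)
Definition smooth_step s := [/\ smooth s, forall x, 0 <= s x <= 1,
  forall x, x <= -1 -> s x = 0 & forall x, 1 <= x -> s x = 1].

Lemma cutoff_pair_step chip chim : cutoff_pair chip chim -> smooth_step chip.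
Proof.
move=> [[ps _] r sm [sp sq] _]; split=> //.
- by move=> x; have [] := r x.
- move=> x x1; apply: fsupport_eq0 => /sp /=; rewrite in_itv/=; lra.
- move=> x x1; have := sm x; rewrite (@fsupport_eq0 _ chim x) ?addr0//.
  by move=> /sq /=; rewrite in_itv/=; lra.
Qed.

Lemma smooth_step_derive1_bounded s : smooth_step s ->
  exists2 B, 0 <= B & forall x, `|derive1 s x| <= B.
Proof.
move=> [ss _ s0 s1].
have [B hB] := continuous_bounded_itv (-1) 1 (smooth_continuous (smooth_derive1 ss)).
exists B; first by apply: le_trans (hB 0 _); rewrite ?normr_ge0//; lra.
move=> x; have [/hB//|x1] := boolP (-1 <= x <= 1).
rewrite (_ : derive1 s x = 0) ?normr0; first by apply: le_trans (hB 0 _); rewrite ?normr_ge0//; lra.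
have [x0|x0] : x < -1 \/ 1 < x by move: x1; rewrite negb_and -!ltNge => /orP[]; auto.
- apply: (@near_has_deriv_eq0 _ s) (smooth_has_deriv ss).
  have : \forall y \near x, y < -1 by exact: lt_nbhsl.
  by apply: filterS => y /ltW; exact: s0.
- have h : has_deriv (fun x => s x - 1) (fun x => derive1 s x - 0).
    by apply: has_derivB; [exact: smooth_has_deriv|exact: has_deriv_cst].
  rewrite -[LHS]subr0; apply: (near_has_deriv_eq0 _ h).
  have : \forall y \near x, 1 < y by exact: lt_nbhsr.
  by apply: filterS => y /ltW /s1 ->; rewrite subrr.
Qed.

Lemma step_scale_vanishes s k a x : smooth_step s -> 1 < k * (a - x) ->
  derive1 s (k * (x - a)) = 0.
Proof.
move=> [ss _ s0 s1] h; apply: (near_has_deriv_eq0 _ (smooth_has_deriv ss)).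
have : \forall y \near (k * (x - a)), y < -1 by apply: lt_nbhsl; lra.
by apply: filterS => y /ltW; exact: s0.
Qed.

Lemma step_scale_vanishes_r s k a x : smooth_step s -> 1 < k * (x - a) ->
  derive1 s (k * (x - a)) = 0.
Proof.
move=> [ss _ s0 s1] h.
have hd : has_deriv (fun x => s x - 1) (fun x => derive1 s x - 0).
  by apply: has_derivB; [exact: smooth_has_deriv|exact: has_deriv_cst].
rewrite -[LHS]subr0; apply: (near_has_deriv_eq0 _ hd).
have : \forall y \near (k * (x - a)), 1 < y by exact: lt_nbhsr.
by apply: filterS => y /ltW /s1 ->; rewrite subrr.
Qed.

Lemma has_deriv_step_scale s k a : smooth s ->
  has_deriv (fun x => s (k * (x - a))) (fun x => k * derive1 s (k * (x - a))).
Proof.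
move=> /smooth_has_deriv /(@has_deriv_affine _ _ _ k (- (k * a))) h.
by move=> x; rewrite !(mulrBr k); under eq_fun do rewrite mulrBr; exact: h.
Qed.

Lemma smooth_step_scale s k a : smooth s -> smooth (fun x => s (k * (x - a))).
Proof.
move=> /(@smooth_affine _ _ k (- (k * a))) h.
by under eq_fun do rewrite mulrBr.
Qed.

Lemma FTC2_continuous f df a b : has_deriv f df -> continuous df -> a <= b ->
  \int[leb]_(x in `[a, b]) df x = f b - f a.
Proof.
move=> fd dfc; rewrite le_eqVlt => /predU1P[->|ab].
  by rewrite set_itv1 Rintegral_set1 subrr.
have fc := has_deriv_continuous fd.
rewrite /Rintegral (@continuous_FTC2 _ _ f)//.
- exact: continuous_subspaceT.
- split; first by move=> x _; exact: has_deriv_derivable fd x.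
  + by apply: cvg_at_right_filter; exact: fc.
  + by apply: cvg_at_left_filter; exact: fc.
- by move=> x _; rewrite (has_derivE fd).
Qed.

(* The mollifier k s'(k(x - a)) has mass 1 and is concentrated near a. *)
Lemma cvg_mollified f s a : smooth_step s -> locint f -> lebesgue_pt f a ->
  \int[leb]_x (f x * (n.+1%:R * derive1 s (n.+1%:R * (x - a)))) @[n --> \oo]
    --> f a.
Proof.
move=> hs fi fa; have [B B0 sB] := smooth_step_derive1_bounded hs.
have [ss s01 s0 s1] := hs.
have mf : measurable_fun setT f by case: fi.
pose m n x : R := n.+1%:R * derive1 s (n.+1%:R * (x - a)).
have mc n : continuous (m n).
  apply: (@has_deriv_continuous _ _ (derive1 (m n))); apply: smooth_has_deriv.
  apply: smoothM; first exact: smooth_cst.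
  exact/smooth_step_scale/smooth_derive1.
have n0 n : 0 < n.+1%:R :> R by rewrite ltr0n.
have n1 n : 1 <= n.+1%:R :> R by rewrite ler1n.
have mA n x : n.+1%:R^-1 < `|x - a| -> m n x = 0.
  rewrite -(@ltr_pM2l _ n.+1%:R)// mulfV ?gt_eqF// /m.
  have [xa|xa] := leP 0 (x - a).
    by rewrite ger0_norm// => /(step_scale_vanishes_r hs) ->; rewrite mulr0.
  by rewrite ltr0_norm// opprB => /(step_scale_vanishes hs) ->; rewrite mulr0.
pose A := `|a| + 1.
have mvan n : vanishes_off A (m n).
  move=> x Ax; apply: mA; apply: (@le_lt_trans _ _ 1).
    by rewrite invf_le1.
  by have := ler_normD (x - a) a; rewrite subrK; move: Ax; rewrite /A; lra.
have mtest n : test_function (m n).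
  apply/test_functionP; split; last by exists A.
  apply: smoothM; first exact: smooth_cst.
  exact/smooth_step_scale/smooth_derive1.
have a1 : a <= `|a| := ler_norm a.
have a2 : - a <= `|a| by rewrite -normrN ler_norm.
have m1 n : \int[leb]_x m n x = 1.
  rewrite (Rintegral_vanishes (@mvan n)).
  rewrite (FTC2_continuous (@has_deriv_step_scale s n.+1%:R a ss) (@mc n)); last by rewrite /A; lra.
  rewrite s1 ?s0 ?subr0// /A; have := n1 n; nra.
(* The mollifier lives within distance 1/(n+1) of [a]; the radius is doubled so that the open ball
   contains that closed interval. *)
pose r n : R := 2 / n.+1%:R.
have r0 n : 0 < r n by rewrite divr_gt0.
have fai : locint (fun x => f x - f a) by apply: locintD => //; exact: locint_cst.
(* The kernel is at most (n+1) B and the ball has length 4/(n+1), hence the factor 4 B in front of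
   the mean deviation, which tends to 0 at a Lebesgue point. *)
have key n : ((`|\int[leb]_x ((f x - f a) * m n x)|)%:E <= (4 * B)%:E * davg f a (r n))%E.
  have hi := integrable_test fai (mtest n).
  have mi : measurable_fun setT (fun x => (f x - f a) * m n x).
    by apply/measurable_EFinP; case/integrableP: hi.
  have mfa : measurable_fun setT (fun y => (`|f y - f a|)%:E).
    apply/measurable_EFinP; apply: measurableT_comp => //.
    by apply: measurable_funB => //.
  rewrite EFin_normr_Rintegral//.
  apply: (@le_trans _ _ (\int[leb]_x `|((f x - f a) * m n x)%:E|)%E).
    by apply: le_abse_integral => //; exact/measurable_EFinP.
  apply: (@le_trans _ _ (\int[leb]_(y in ball a (r n)) ((n.+1%:R * B)%:E * (`|f y - f a|)%:E))%E).
    rewrite [leRHS]integral_mkcond; apply: ge0_le_integral => //.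
    - by apply: measurableT_comp => //; exact/measurable_EFinP.
    - apply/(measurable_restrictT _ _).1; first exact: measurable_ball.
      by apply: measurable_funTS; apply: measurable_funeM.
    - move=> x _; rewrite patchE; case: ifPn => xB.
        rewrite -EFinM lee_fin normrM mulrC ler_wpM2r// /m normrM (ger0_norm (ltW (n0 n))).
        by rewrite ler_wpM2l ?sB// ltW.
      rewrite mA ?mulr0 ?abse0//.
      move: xB; apply: contraNT; rewrite -leNgt inE /ball/= distrC => /le_lt_trans; apply.
      by rewrite /r ltr_pdivlMr// mulVf ?gt_eqF// ltr1n.
  rewrite ge0_integralZl_EFin//; [|exact: measurable_ball|exact: measurable_funTS|
    by rewrite mulr_ge0// ltW].
  rewrite /davg /iavg lebesgue_measure_ball; last exact: ltW.
  have r2 : 0 < r n *+ 2 by rewrite pmulrn_rgt0.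
  have -> : ((r n *+ 2)%:E^-1 = ((r n *+ 2)^-1)%:E)%E by rewrite inver gt_eqF.
  rewrite muleA -EFinM; apply: lee_wpmul2r; first exact: integral_ge0.
  rewrite lee_fin /r le_eqVlt; apply/orP; left; apply/eqP.
  by rewrite -mulr_natr; field; rewrite gt_eqF.
have r_cvg0 : r n @[n --> \oo] --> (0 : R).
  rewrite -(mulr0 2); apply: cvgM; first exact: cvg_cst.
  exact: cvg_harmonic.
have rcvg : r n @[n --> \oo] --> (0 : R)^'+.
  move=> P [d d0 dP].
  have : \forall n \near \oo, `|r n| < d by apply: cvgr0_norm_lt.
  by apply: filterS => n rd; apply: dP => //=; rewrite sub0r normrN.
have /fine_cvgP[dfin dcvg] := cvg_comp _ _ rcvg fa.
apply/cvgrPdist_le => e e0.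
have e1 : 0 < e / (4 * B + 1) by rewrite divr_gt0//; lra.
have h1 : \forall n \near \oo, `|fine (davg f a (r n))| < e / (4 * B + 1).
  by move/cvgr0Pnorm_lt: dcvg; apply.
near=> n.
have -> : \int[leb]_x (f x * m n x) = \int[leb]_x ((f x - f a) * m n x) + f a.
  transitivity (\int[leb]_x ((f x - f a) * m n x + f a * m n x)).
    by apply: eq_Rintegral => x _; rewrite -mulrDl subrK.
  rewrite RintegralD//.
  - rewrite RintegralZl ?m1 ?mulr1//.
    by apply: (@integrable_vanishes _ _ A) => //; exact/continuous_locint.
  - exact: integrable_test.
  - by apply: integrable_test => //; exact: locint_cst.
rewrite opprD addrCA subrr addr0 normrN.
have dfn : davg f a (r n) \is a fin_num by near: n.
have := key n; rewrite -(fineK dfn) -EFinM lee_fin => /le_trans; apply.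
have d0 : 0 <= fine (davg f a (r n)) by apply: fine_ge0; exact: davg_ge0.
have : fine (davg f a (r n)) < e / (4 * B + 1).
  by rewrite -(ger0_norm d0); near: n.
rewrite ltr_pdivlMr; last lra.
nra.
Unshelve. all: by end_near. Qed.

(** The test functions [eta n] approximate the indicator of [a, b]. Their derivatives are a
    mollifier at a minus one at b, so the left side of the weak formulation tends to f a - f b,
    while the right side tends to minus the integral of g by dominated convergence. *)
Lemma weak_derivative_lebesgue_pt s f g a b : smooth_step s ->
  weak_derivative f g -> lebesgue_pt f a -> lebesgue_pt f b -> a < b ->
  f b - f a = \int[leb]_(x in `[a, b]) g x.
Proof.
move=> hs [fi gi fg] fa fb ab; have [ss s01 s0 s1] := hs.
pose eta n x : R := s (n.+1%:R * (x - a)) - s (n.+1%:R * (x - b)).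
have n0 n : 0 < n.+1%:R :> R by rewrite ltr0n.
have n1 n : 1 <= n.+1%:R :> R by rewrite ler1n.
pose A := `|a| + `|b| + 1.
have a1 : a <= `|a| := ler_norm a.
have a2 : - a <= `|a| by rewrite -normrN ler_norm.
have b1 : b <= `|b| := ler_norm b.
have b2 : - b <= `|b| by rewrite -normrN ler_norm.
have a0 : 0 <= `|a| by [].
have b0 : 0 <= `|b| by [].
have etavan n : vanishes_off A (eta n).
  move=> x; have [x0|x0] := leP 0 x.
    rewrite ger0_norm// /A => Ax; rewrite /eta !s1 ?subrr//; have := n1 n; nra.
  rewrite ltr0_norm// /A => Ax; rewrite /eta !s0 ?subrr//; have := n1 n; nra.
have etas n : smooth (eta n) by apply: smoothB; exact: smooth_step_scale.
have etat n : test_function (eta n) by apply/test_functionP; split => //; exists A.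
have eta1 n x : `|eta n x| <= 1.
  by rewrite ler_norml /eta; have := s01 (n.+1%:R * (x - a)); have := s01 (n.+1%:R * (x - b)); lra.
have etad n : derive1 (eta n) = fun x => n.+1%:R * derive1 s (n.+1%:R * (x - a)) - n.+1%:R * derive1 s (n.+1%:R * (x - b)).
  by apply: has_derivE; apply: has_derivB; exact: has_deriv_step_scale.
have mtest c n : test_function (fun x => n.+1%:R * derive1 s (n.+1%:R * (x - c))).
  apply/test_functionP; split.
    apply: smoothM; first exact: smooth_cst.
    exact/smooth_step_scale/smooth_derive1.
  exists (`|c| + 1) => x cx.
  have cx1 : 1 < `|x - c| by have := ler_normD (x - c) c; rewrite subrK; lra.
  have := n1 n; move: cx1; have [xa|xa] := leP 0 (x - c).
    by rewrite ger0_norm// => *; rewrite (step_scale_vanishes_r hs) ?mulr0//; nra.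
  by rewrite ltr0_norm// opprB => *; rewrite (step_scale_vanishes hs) ?mulr0//; nra.
have l1 : \int[leb]_x (f x * derive1 (eta n) x) @[n --> \oo] --> f a - f b.
  have := cvgB (cvg_mollified hs fi fa) (cvg_mollified hs fi fb).
  rewrite (_ : (fun n => \int[leb]_x (f x * derive1 (eta n) x)) = (fun n =>
    \int[leb]_x (f x * (n.+1%:R * derive1 s (n.+1%:R * (x - a)))) -
    \int[leb]_x (f x * (n.+1%:R * derive1 s (n.+1%:R * (x - b)))))); first by apply.
  apply/funext => n; rewrite etad -RintegralB//; [|exact: integrable_test|exact: integrable_test].
  by apply: eq_Rintegral => x _; rewrite mulrBr.
have l2 : \int[leb]_x (g x * eta n x) @[n --> \oo] --> \int[leb]_(x in `[a, b]) g x.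
  have gAi := locint_itv (- A) A gi.
  have mg : measurable_fun setT g by case: gi.
  have meta n : measurable_fun setT (eta n) by exact: continuous_measurable (smooth_continuous (etas n)).
  have gr : leb.-integrable `[a, b] (EFin \o g) := locint_itv a b gi.
  pose G x : \bar R := (`|(g \_ `[- A, A]) x|)%:E.
  have Gi : leb.-integrable setT G.
    have := (@integrable_mkcond _ _ _ leb `[- A, A]%classic (EFin \o g) (measurable_itv _)).1 gAi.
    move=> /integrable_abse; apply: eq_integrable => // x _.
    by rewrite /G /= !patchE; case: ifP.
  have mgr : measurable_fun setT (EFin \o (g \_ `[a, b])).
    by apply/measurable_EFinP/(measurable_restrictT _ _).1 => //; exact: measurable_funTS.
  have meas n : measurable_fun setT (fun x => (g x * eta n x)%:E).
    by apply/measurable_EFinP; exact: measurable_funM.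
  have big (x c : R) : x != c -> \forall n \near \oo, 1 <= n.+1%:R * `|x - c|.
    move=> xc; have xc0 : 0 < `|x - c| by rewrite normr_gt0 subr_eq0.
    have : \forall n \near \oo, 1 / `|x - c| <= n%:R by exact: nbhs_infty_ger.
    apply: filterS => n; rewrite ler_pdivrMr// => /le_trans; apply.
    by rewrite ler_wpM2r ?ltW// ltr_nat.
  (* The endpoints are left out: there [eta n] tends to s(0) or 1 - s(0), which need not be the
     value of the indicator. *)
  have ptw : \forall x \ae leb, setT x ->
      (g x * eta n x)%:E @[n --> \oo] --> (EFin \o (g \_ `[a, b])) x.
    apply: leb_aeS2 (leb_ae_neq a) (leb_ae_neq b) => x xa xb _.
    apply: cvg_near_cst; apply: filterS2 (big _ _ xa) (big _ _ xb) => n na nb.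
    rewrite /= patchE; congr EFin; rewrite /eta.
    have [xa'|xa'|xa'] := ltgtP x a; last by rewrite xa' eqxx in xa.
      rewrite memNset; last by rewrite /= in_itv/= leNgt xa'.
      have xb' : x < b by exact: lt_trans ab.
      move: na nb; rewrite !ltr0_norm ?subr_lt0// => na nb.
      by rewrite !s0 ?subrr ?mulr0//; lra.
    have [xb'|xb'|xb'] := ltgtP x b; last by rewrite xb' eqxx in xb.
      rewrite mem_set; last by rewrite /= in_itv/= !ltW.
      move: na nb; rewrite gtr0_norm ?subr_gt0// ltr0_norm ?subr_lt0// => na nb.
      by rewrite s1 ?s0 ?subr0 ?mulr1//; lra.
    rewrite memNset; last by rewrite /= in_itv/= [x <= b]leNgt xb' andbF.
    move: na nb; rewrite !gtr0_norm ?subr_gt0// => na nb.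
    by rewrite !s1 ?subrr ?mulr0.
  have dom : \forall x \ae leb, forall n, setT x -> (`|(g x * eta n x)%:E| <= G x)%E.
    apply: leb_aeW => x n _; rewrite /G patchE lee_fin normrM; case: ifPn => xA.
      by rewrite -[leRHS]mulr1 ler_wpM2l.
    rewrite (etavan n) ?normr0 ?mulr0//.
    by move: xA => /negP; rewrite inE /= in_itv/= -ler_norml => /negP; rewrite -ltNge.
  have [ri _ rc] := @dominated_convergence _ _ _ leb setT measurableT
    (fun n x => (g x * eta n x)%:E) (EFin \o (g \_ `[a, b])) G meas mgr ptw Gi dom.
  rewrite Rintegral_mkcond; apply: fine_cvg.
  rewrite fineK; first exact: rc.
  exact: integrable_fin_num.
have l3 : (- \int[leb]_x (g x * eta n x)) @[n --> \oo] --> f a - f b.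
  move: l1; rewrite (_ : (fun n => \int[leb]_x (f x * derive1 (eta n) x)) =
    (fun n => - \int[leb]_x (g x * eta n x)))//.
  by apply/funext => n; exact: fg.
have h := cvg_unique (@Rhausdorff R) l3 (cvgN l2).
by rewrite -[RHS]opprK -h opprB.
Qed.

(** Almost every point is a Lebesgue point, so the integral formula may be anchored at a single one,
    [a0]. The representative so obtained is continuous, which gives access to pointwise
    arguments. *)
Lemma weak_derivative_rep s f g : smooth_step s -> weak_derivative f g ->
  exists c, f = (fun x => c + primitive g x) %[ae leb].
Proof.
move=> hs fg; have [fi gi _] := fg.
have Lf := lebesgue_differentiation fi.
have [a0 [_ La0]] := leb_ae_itv Lf (@ltr01 R).
exists (f a0 - primitive g a0); apply: leb_aeS Lf => x Lx _.
have [xa|xa|->] := ltgtP x a0; last by rewrite subrK.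
  have := weak_derivative_lebesgue_pt hs fg Lx La0 xa.
  by rewrite -(primitiveB gi (ltW xa)); lra.
have := weak_derivative_lebesgue_pt hs fg La0 Lx xa.
by rewrite -(primitiveB gi (ltW xa)); lra.
Qed.

Lemma ae_eq_continuous (u v : R -> R) : continuous u -> continuous v ->
  u = v %[ae leb] -> u = v.
Proof.
move=> uc vc uv; apply/funext => x; apply: contrapT => /eqP uvx.
have d0 : 0 < `|u x - v x| by rewrite normr_gt0 subr_eq0.
have : \forall y \near x, 0 < `|u y - v y|.
  have : `|u y - v y| @[y --> x] --> `|u x - v x|.
    by apply: cvg_norm; apply: cvgB; [exact: uc|exact: vc].
  by move=> /cvgr_gt; apply.
move=> [d /= dpos hd].
have [y [/andP[xy yd] uvy]] : exists y, x < y < x + d /\ (setT y -> u y = v y).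
  by apply: leb_ae_itv uv _; rewrite ltrDl.
have := hd y; rewrite /ball_/= distrC gtr0_norm ?subr_gt0// ltrBlDl => /(_ yd).
by rewrite uvy// subrr normr0 ltxx.
Qed.

(** At a Lebesgue point g is the derivative of its integral, here the zero function. *)
Lemma locint_eq0 g : locint g -> (forall a b, a <= b -> \int[leb]_(x in `[a, b]) g x = 0) ->
  g = (fun=> 0) %[ae leb].
Proof.
move=> gi g0; apply: leb_aeS (lebesgue_differentiation gi) => x Lx _.
have x1 : x < x + 1 by rewrite ltrDl.
have x2 : x - 1 < x by rewrite ltrBlDr ltrDl.
have [dF F'] := FTC1_lebesgue_pt x1 (locint_itv (x - 1) (x + 1) gi) x2 Lx.
rewrite -F' derive1E.
rewrite (@near_eq_derive _ _ _ _ (cst 0)) ?derive_cst//.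
have : \forall y \near x, x - 1 < y by exact: lt_nbhsr.
by apply: filterS => y /ltW; exact: g0.
Qed.

(** The two primitives represent the same f up to constants; being continuous they then agree
    everywhere, so g - h has zero integral over every interval. *)
Lemma weak_derivative_unique s f g h : smooth_step s -> weak_derivative f g ->
  weak_derivative f h -> g = h %[ae leb].
Proof.
move=> hs fg fh; have [c fc] := weak_derivative_rep hs fg.
have [d fd] := weak_derivative_rep hs fh.
have [fi gi _] := fg; have [_ hi _] := fh.
have E : (fun x => c + primitive g x) = (fun x => d + primitive h x).
  apply: ae_eq_continuous.
  - by move=> x; apply: cvgD; [exact: cvg_cst|exact: primitive_continuous].
  - by move=> x; apply: cvgD; [exact: cvg_cst|exact: primitive_continuous].
  - by apply: leb_aeS2 fc fd => x <-// <-.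
have ghi : locint (fun x => g x - h x) by exact: locally_integrableB.
have : (fun x => g x - h x) = (fun=> 0) %[ae leb].
  apply: locint_eq0 => // a b ab.
  rewrite RintegralB//; [|exact: locint_itv|exact: locint_itv].
  rewrite -!primitiveB//.
  by have := congr1 (fun F => F a) E; have := congr1 (fun F => F b) E => /=; lra.
by apply: leb_aeS => x /(_ I) /eqP; rewrite subr_eq0 => /eqP.
Qed.

Lemma has_deriv_weak f df : has_deriv f df -> continuous df ->
  weak_derivative f df.
Proof.
move=> fd dfc; have fc := has_deriv_continuous fd; split.
- exact: continuous_locint.
- exact: continuous_locint.
move=> phi /[dup] pt /test_functionP[ps [A pA]].
have pd := smooth_has_deriv ps.
have fpd := has_derivM fd pd.
have fpc : continuous (fun x => df x * phi x + f x * derive1 phi x).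
  move=> x; apply: cvgD; apply: cvgM.
  - exact: dfc.
  - exact: smooth_continuous.
  - exact: fc.
  - exact/smooth_continuous/smooth_derive1.
pose B := `|A| + 1.
have B0 : 0 <= `|A| by [].
have AB : A < B by rewrite /B; have := ler_norm A; lra.
have := @FTC2_continuous _ _ (- B) B fpd fpc.
rewrite (pA B) ?(pA (- B)) ?mulr0 ?subrr; last 2 first.
- by rewrite normrN ger0_norm// /B; lra.
- by rewrite ger0_norm// /B; lra.
have vB : vanishes_off B (fun x => df x * phi x + f x * derive1 phi x).
  move=> x Bx; have Ax : A < `|x| by exact: lt_trans Bx.
  by rewrite (pA x)// (vanishes_off_derive1 pA)// !mulr0 addr0.
rewrite -(Rintegral_vanishes vB) RintegralD//; last 2 first.
- by apply: integrable_test => //; exact: continuous_locint.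
- by apply: integrable_test; [exact: continuous_locint|exact: test_function_derive1].
by move=> h; apply/eqP; rewrite -addr_eq0 addrC; apply/eqP/h; rewrite /B; lra.
Qed.

End LebesguePoints.

(** * Weak derivatives: algebra, limits and regular representatives *)

Section WeakCalculus.
Context {R : realType}.
Implicit Types f g h m s u v : R -> R.
Notation leb := (@lebesgue_measure R).
Notation locint := (@locally_integrable R setT).

Lemma weak_derivativeD f f1 g g1 : weak_derivative f f1 -> weak_derivative g g1 ->
  weak_derivative (fun x => f x + g x) (fun x => f1 x + g1 x).
Proof.
move=> [fi f1i fE] [gi g1i gE]; split; [exact: locintD|exact: locintD|].
move=> p pt; have p't := test_function_derive1 pt.
transitivity (\int[leb]_x (f x * derive1 p x) + \int[leb]_x (g x * derive1 p x)).
  rewrite -RintegralD//; [|exact: integrable_test|exact: integrable_test].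
  by apply: eq_Rintegral => x _; rewrite mulrDl.
rewrite fE// gE// -opprD -RintegralD//; [|exact: integrable_test|exact: integrable_test].
by congr (- _); apply: eq_Rintegral => x _; rewrite mulrDl.
Qed.

(** The weak formulation for f is tested with th * phi, again a test function. *)
Lemma weak_derivativeM th f f1 : smooth th -> weak_derivative f f1 ->
  weak_derivative (fun x => th x * f x) (fun x => derive1 th x * f x + th x * f1 x).
Proof.
move=> ths [fi f1i fE]; have thc := smooth_continuous ths.
have th'c := smooth_continuous (smooth_derive1 ths).
split; [exact: locintMl|by apply: locintD; exact: locintMl|].
move=> p pt; have p't := test_function_derive1 pt.
have tpt := test_functionMl ths pt.
have tpd := has_derivM (smooth_has_deriv ths) (smooth_has_deriv pt.1).
have := fE _ tpt; rewrite (has_derivE tpd).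
have i1 : leb.-integrable setT (EFin \o (fun x => f x * (derive1 th x * p x))).
  exact: (integrable_test fi (test_functionMl (smooth_derive1 ths) pt)).
have i2 : leb.-integrable setT (EFin \o (fun x => f x * (th x * derive1 p x))).
  exact: (integrable_test fi (test_functionMl ths p't)).
have i3 : leb.-integrable setT (EFin \o (fun x => f1 x * (th x * p x))).
  exact: integrable_test.
have -> : \int[leb]_x (f x * (derive1 th x * p x + th x * derive1 p x)) =
   \int[leb]_x (f x * (derive1 th x * p x)) + \int[leb]_x (f x * (th x * derive1 p x)).
  by rewrite -RintegralD//; apply: eq_Rintegral => x _; rewrite mulrDr.
have -> : \int[leb]_x ((derive1 th x * f x + th x * f1 x) * p x) =
   \int[leb]_x (f x * (derive1 th x * p x)) + \int[leb]_x (f1 x * (th x * p x)).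
  rewrite -RintegralD//; apply: eq_Rintegral => x _.
  by rewrite mulrDl (mulrC _ (f x)) (mulrC _ (f1 x)) !mulrA.
have -> : \int[leb]_x (th x * f x * derive1 p x) = \int[leb]_x (f x * (th x * derive1 p x)).
  by apply: eq_Rintegral => x _; rewrite (mulrC (th x)) mulrA.
by move=> h; rewrite opprD -h addKr.
Qed.

Lemma weak_derivative_shift c f f1 : weak_derivative f f1 ->
  weak_derivative (fun x => f (x - c)) (fun x => f1 (x - c)).
Proof.
move=> [fi f1i fE]; split; [exact: locint_shift|exact: locint_shift|].
move=> p pt; have := test_function_shift (- c) pt; rewrite opprK => qt.
have qd : has_deriv (fun x => p (x + c)) (fun x => derive1 p (x + c)).
  by have := has_deriv_shift (- c) (smooth_has_deriv pt.1); rewrite opprK.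
have p't := test_function_derive1 pt.
have := fE _ qt; rewrite (has_derivE qd).
have fic : locint (fun x => f (x - c)) by exact: locint_shift.
have f1ic : locint (fun x => f1 (x - c)) by exact: locint_shift.
rewrite -(@integral_shift _ (fun x => f (x - c) * derive1 p x) c); last exact: integrable_test.
rewrite -(@integral_shift _ (fun x => f1 (x - c) * p x) c); last exact: integrable_test.
have -> : \int[leb]_x (f (x + c - c) * derive1 p (x + c)) = \int[leb]_x (f x * derive1 p (x + c)).
  by apply: eq_Rintegral => x _; rewrite addrK.
have -> // : \int[leb]_x (f1 (x + c - c) * p (x + c)) = \int[leb]_x (f1 x * p (x + c)).
by apply: eq_Rintegral => x _; rewrite addrK.
Qed.

Lemma locint_ae f g : measurable_fun setT g -> f = g %[ae leb] -> locint f -> locint g.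
Proof.
move=> mg fg [mf _ fK]; split=> //; first exact: openT.
move=> K KT Kc; apply: le_lt_trans (fK K KT Kc).
have mK : measurable K by exact: compact_measurable.
rewrite le_eqVlt; apply/orP; left; apply/eqP.
apply: ae_eq_integral => //.
- by apply/measurable_EFinP; apply: measurable_funTS; exact: measurableT_comp.
- by apply/measurable_EFinP; apply: measurable_funTS; exact: measurableT_comp.
- by apply: leb_aeS fg => x fgx _; rewrite fgx.
Qed.

Lemma Rintegral_ae f g (A : set R) : measurable A -> measurable_fun setT f -> measurable_fun setT g ->
  f = g %[ae leb] -> \int[leb]_(x in A) f x = \int[leb]_(x in A) g x.
Proof.
move=> mA mf mg fg; congr fine; apply: ae_eq_integral => //.
- by apply/measurable_EFinP; exact: measurable_funTS.
- by apply/measurable_EFinP; exact: measurable_funTS.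
- by apply: leb_aeS fg => x fgx _; rewrite fgx.
Qed.

Lemma weak_derivative_ae f g f1 g1 : measurable_fun setT g -> measurable_fun setT g1 ->
  f = g %[ae leb] -> f1 = g1 %[ae leb] -> weak_derivative f f1 -> weak_derivative g g1.
Proof.
move=> mg mg1 fg fg1 [fi f1i fE]; split; [exact: locint_ae fg _|exact: locint_ae fg1 _|].
have [mf _ _] := fi; have [mf1 _ _] := f1i.
move=> p pt; have := fE _ pt.
have mp : measurable_fun setT p by exact: continuous_measurable (smooth_continuous pt.1).
have mp' : measurable_fun setT (derive1 p).
  exact: continuous_measurable (smooth_continuous (smooth_derive1 pt.1)).
rewrite (@Rintegral_ae (fun x => f x * derive1 p x) (fun x => g x * derive1 p x))//.
- rewrite (@Rintegral_ae (fun x => f1 x * p x) (fun x => g1 x * p x))//.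
  + exact: measurable_funM.
  + exact: measurable_funM.
  + by apply: leb_aeS fg1 => x fgx _; rewrite fgx.
- exact: measurable_funM.
- exact: measurable_funM.
- by apply: leb_aeS fg => x fgx _; rewrite fgx.
Qed.

Lemma test_function_L2le (p : R -> R) : test_function p -> exists2 a, 0 < a & L2le p a.
Proof.
move=> /[dup] pt /test_functionP[ps [A pA]].
have pi : leb.-integrable setT (EFin \o (fun x => p x * p x)).
  by apply: integrable_test => //; exact/continuous_locint/smooth_continuous.
have /integrable_lty := pi; rewrite /= => /(_ measurableT) h.
have p0 : (0 <= \int[leb]_x (p x * p x)%:E)%E by apply: integral_ge0 => x _; rewrite lee_fin -expr2 sqr_ge0.
pose J := fine (\int[leb]_x (p x * p x)%:E).
have J0 : 0 <= J by exact: fine_ge0.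
exists (J + 1); first by lra.
split; first exact: continuous_measurable (smooth_continuous ps).
under eq_integral do rewrite expr2.
rewrite -(@fineK _ (\int[leb]_x (p x * p x)%:E)%E) ?ge0_fin_numE// lee_fin -/J.
by rewrite expr2; nra.
Qed.

Lemma cvg_Rintegral_test (f_ : nat -> R -> R) f (e : nat -> R) p :
  test_function p -> (forall n, locint (f_ n)) -> locint f ->
  (forall n, 0 < e n) -> e n @[n --> \oo] --> 0 ->
  (forall n, L2le (fun x => f_ n x - f x) (e n)) ->
  \int[leb]_x (f_ n x * p x) @[n --> \oo] --> \int[leb]_x (f x * p x).
Proof.
move=> pt f_i fi e0 ecvg fe; have [a a0 pa] := test_function_L2le pt.
have key n : `|\int[leb]_x (f x * p x) - \int[leb]_x (f_ n x * p x)| <= e n * a.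
  rewrite distrC -RintegralB//; [|exact: integrable_test|exact: integrable_test].
  have -> : \int[leb]_x (f_ n x * p x - f x * p x) = \int[leb]_x ((f_ n x - f x) * p x).
    by apply: eq_Rintegral => x _; rewrite mulrBl.
  by have [] := L2le_Holder (e0 n) a0 (fe n) pa.
apply/cvgrPdist_le => d d0.
have : \forall n \near \oo, `|e n| < d / a.
  by move/cvgr0Pnorm_lt: ecvg; apply; rewrite divr_gt0.
apply: filterS => n; rewrite gtr0_norm// ltr_pdivlMr// => /ltW; exact: le_trans.
Qed.

(** Closedness of weak differentiation under L2 convergence: both sides of the weak formulation pass
    to the limit by Hoelder. It identifies the derivatives of the limit of the iteration. *)
Lemma weak_derivative_lim (f_ g_ : nat -> R -> R) f g (e : nat -> R) :
  (forall n, weak_derivative (f_ n) (g_ n)) -> locint f -> locint g ->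
  (forall n, 0 < e n) -> e n @[n --> \oo] --> 0 ->
  (forall n, L2le (fun x => f_ n x - f x) (e n)) ->
  (forall n, L2le (fun x => g_ n x - g x) (e n)) -> weak_derivative f g.
Proof.
move=> wd fi gi e0 ecvg fe ge; split=> // p pt.
have f_i n : locint (f_ n) by case: (wd n).
have g_i n : locint (g_ n) by case: (wd n).
have h1 := cvg_Rintegral_test (test_function_derive1 pt) f_i fi e0 ecvg fe.
have h2 := cvg_Rintegral_test pt g_i gi e0 ecvg ge.
have E : (fun n => \int[leb]_x (f_ n x * derive1 p x)) = (fun n => - \int[leb]_x (g_ n x * p x)).
  by apply/funext => n; have [_ _] := wd n; apply.
rewrite E in h1; exact: (cvg_unique (@Rhausdorff R) h1 (cvgN h2)).
Qed.

(** The derivatives are carried explicitly, since [wderiv] is merely some representative; one number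
    bounds all three L2 norms. *)
Definition H2le f f1 f2 (a : R) :=
  [/\ weak_derivative f f1, weak_derivative f1 f2, L2le f a, L2le f1 a & L2le f2 a].

Lemma H2leW f f1 f2 a b : 0 <= a -> a <= b -> H2le f f1 f2 a -> H2le f f1 f2 b.
Proof. by move=> a0 ab [? ? ? ? ?]; split=> //; exact: (L2leW a0 ab). Qed.

Lemma H2leD f f1 f2 g g1 g2 a b : 0 <= a -> 0 <= b ->
  H2le f f1 f2 a -> H2le g g1 g2 b ->
  H2le (fun x => f x + g x) (fun x => f1 x + g1 x) (fun x => f2 x + g2 x) (a + b).
Proof.
move=> a0 b0 [ff1 ff2 fa f1a f2a] [gg1 gg2 gb g1b g2b].
by split; [exact: weak_derivativeD|exact: weak_derivativeD|exact: L2leD..].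
Qed.

Lemma weak_derivative0 : weak_derivative (fun=> 0 : R) (fun=> 0).
Proof.
by apply: has_deriv_weak; [exact: has_deriv_cst|exact: cst_continuous].
Qed.

Lemma H2le0 a : H2le (fun=> 0) (fun=> 0) (fun=> 0) a.
Proof. by split; [exact: weak_derivative0|exact: weak_derivative0|exact: L2le0..]. Qed.

Lemma H2le_sum (I : Type) (r : seq I) (F F1 F2 : I -> R -> R) (a : I -> R) :
  (forall i, 0 <= a i) -> (forall i, H2le (F i) (F1 i) (F2 i) (a i)) ->
  H2le (fun x => \sum_(i <- r) F i x) (fun x => \sum_(i <- r) F1 i x)
    (fun x => \sum_(i <- r) F2 i x) (\sum_(i <- r) a i).
Proof.
move=> a0 Fa; elim: r => [|i r ih].
  have E (G : I -> R -> R) : (fun x => \sum_(i <- [::]) G i x) = (fun=> 0).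
    by apply/funext => x; rewrite big_nil.
  by rewrite big_nil !E; exact: H2le0.
have E (G : I -> R -> R) : (fun x => \sum_(j <- i :: r) G j x) =
    (fun x => G i x + \sum_(j <- r) G j x).
  by apply/funext => x; rewrite big_cons.
by rewrite big_cons !E; apply: H2leD => //; exact: sumr_ge0.
Qed.

Lemma H2le_shift f f1 f2 a c : H2le f f1 f2 a ->
  H2le (fun x => f (x - c)) (fun x => f1 (x - c)) (fun x => f2 (x - c)) a.
Proof.
move=> [ff1 ff2 fa f1a f2a].
by split; [exact: weak_derivative_shift|exact: weak_derivative_shift|exact: L2le_shift..].
Qed.

(** In (th f)'' the terms other than th f'' are kept apart with their own bound 3 d a: this
    commutator is the error made by cutting off, and it is small with the slope d. *)
Lemma H2leM th f f1 f2 a d : smooth th -> 0 <= a -> 0 <= d ->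
  (forall x, `|th x| <= 1) -> (forall x, `|derive1 th x| <= d) ->
  (forall x, `|derive1 (derive1 th) x| <= d) -> H2le f f1 f2 a ->
  H2le (fun x => th x * f x) (fun x => derive1 th x * f x + th x * f1 x)
    (fun x => th x * f2 x + (2 * derive1 th x * f1 x + derive1 (derive1 th) x * f x))
    ((1 + 3 * d) * a) /\
  L2le (fun x => 2 * derive1 th x * f1 x + derive1 (derive1 th) x * f x) (3 * d * a).
Proof.
move=> ths a0 d0 th1 th'd th''d [ff1 ff2 fa f1a f2a].
have th's := smooth_derive1 ths; have th''s := smooth_derive1 th's.
have mth := continuous_measurable (smooth_continuous ths).
have mth' := continuous_measurable (smooth_continuous th's).
have mth'' := continuous_measurable (smooth_continuous th''s).
have da0 : 0 <= d * a by exact: mulr_ge0.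
have E1 : L2le (fun x => 2 * derive1 th x * f1 x + derive1 (derive1 th) x * f x) (3 * d * a).
  rewrite (_ : 3 * d * a = 2 * d * a + d * a); last by ring.
  apply: L2leD; rewrite ?mulr_ge0//.
    apply: L2leM => //; rewrite ?mulr_ge0//; first exact: measurable_funM.
    by move=> x; rewrite normrM ger0_norm// ler_wpM2l.
  by apply: L2leM.
split=> //; split.
- exact: weak_derivativeM.
- have := weak_derivativeD (weak_derivativeM th's ff1) (weak_derivativeM ths ff2).
  rewrite [X in weak_derivative _ X -> _](_ : _ = (fun x =>
    th x * f2 x + (2 * derive1 th x * f1 x + derive1 (derive1 th) x * f x)))//.
  by apply/funext => x; ring.
- apply: (@L2leW _ _ (1 * a)); [by rewrite mul1r|by nra|exact: L2leM].
- apply: (@L2leW _ _ (d * a + 1 * a)); [by rewrite mul1r addr_ge0|by nra|].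
  by apply: L2leD; rewrite ?mul1r//; [exact: L2leM|rewrite -[a]mul1r; exact: L2leM].
- apply: (@L2leW _ _ (1 * a + 3 * d * a)); [by nra|by nra|].
  by apply: L2leD; [lra|nra|exact: L2leM|exact: E1].
Qed.

Lemma H2le_ae f f1 f2 g g1 g2 a : measurable_fun setT g -> measurable_fun setT g1 ->
  measurable_fun setT g2 ->
  f = g %[ae leb] -> f1 = g1 %[ae leb] -> f2 = g2 %[ae leb] ->
  H2le f f1 f2 a -> H2le g g1 g2 a.
Proof.
move=> mg mg1 mg2 fg fg1 fg2 [ff1 ff2 fa f1a f2a]; split.
- exact: weak_derivative_ae fg fg1 ff1.
- exact: weak_derivative_ae fg1 fg2 ff2.
- exact: L2le_ae fg fa.
- exact: L2le_ae fg1 f1a.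
- exact: L2le_ae fg2 f2a.
Qed.

Lemma primitive_ae f g : measurable_fun setT f -> measurable_fun setT g ->
  f = g %[ae leb] -> primitive f = primitive g.
Proof.
by move=> mf mg fg; apply/funext => x; congr (_ - _); exact: Rintegral_ae.
Qed.

Lemma H2le_rep s f f1 f2 a : smooth_step s -> H2le f f1 f2 a ->
  exists u u1, [/\ f = u %[ae leb], f1 = u1 %[ae leb], continuous u1, has_deriv u u1 &
    (forall x y, x <= y -> u1 y - u1 x = \int[leb]_(t in `[x, y]) f2 t) /\
    H2le u u1 f2 a].
Proof.
move=> hs H; have [ff1 ff2 fa f1a f2a] := H.
have [c1 E1] := weak_derivative_rep hs ff2.
have [c0 E0] := weak_derivative_rep hs ff1.
have f2i := L2le_locint f2a.
pose u1 x := c1 + primitive f2 x; pose u x := c0 + primitive u1 x.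
have u1c : continuous u1.
  by move=> x; apply: cvgD; [exact: cvg_cst|exact: primitive_continuous].
have u1m := continuous_measurable u1c.
have uu1 : has_deriv u u1.
  have := has_derivD (has_deriv_cst c0) (primitive_has_deriv u1c).
  by move=> h x; have := h x; rewrite add0r.
have fu : f = u %[ae leb] by rewrite /u -(@primitive_ae f1 u1)//; exact: L2le_meas f1a.
exists u, u1; split=> //; split.
  by move=> x y xy; rewrite -primitiveB// /u1 opprD addrACA subrr add0r.
apply: H2le_ae H => //; last exact: leb_aeW.
- exact: continuous_measurable (has_deriv_continuous uu1).
- exact: L2le_meas f2a.
Qed.

End WeakCalculus.

(** * Sobolev and interpolation inequalities *)

Section Sobolev.
Context {R : realType}.
Implicit Types f g h m s u v : R -> R.
Notation leb := (@lebesgue_measure R).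
Notation locint := (@locally_integrable R setT).

Lemma L2le_locint_sqr g a : L2le g a -> locint (fun x => g x ^+ 2).
Proof.
move=> [mg ga]; apply: itv_locint; first exact: measurable_funX.
move=> A; apply/integrableP; split.
  by apply/measurable_EFinP; apply: measurable_funTS; exact: measurable_funX.
apply: (@le_lt_trans _ _ (a ^+ 2)%:E); last exact: ltry.
apply: le_trans ga; under eq_integral do rewrite gee0_abs ?lee_fin ?sqr_ge0//.
apply: ge0_subset_integral => //; first exact: measurable_sqr.
by move=> x _; rewrite lee_fin sqr_ge0.
Qed.

Lemma Rintegral_itv_cst (a b c : R) : a <= b ->
  \int[leb]_(x in `[a, b]) c = c * (b - a).
Proof.
move=> ab; rewrite Rintegral_cst//= lebesgue_measure_itv/= lte_fin.
have [ab'|ba] := ltP a b; first by rewrite -EFinD.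
by rewrite (le_anti (introT andP (conj ab ba))) subrr.
Qed.

(** With c the integral of g, expand the integral of (g - c)^2 >= 0; a length of at most 1 turns - 2
    c^2 + c^2 (t - x) into at most - c^2. *)
Lemma Jensen_unit_itv g x t : x <= t -> t <= x + 1 -> locint g ->
  locint (fun y => g y ^+ 2) ->
  (\int[leb]_(y in `[x, t]) g y) ^+ 2 <= \int[leb]_(y in `[x, t]) (g y ^+ 2).
Proof.
move=> xt tx gi g2i; set c := \int[leb]_(y in `[x, t]) g y.
have gI := locint_itv x t gi; have g2I := locint_itv x t g2i.
have cI d : leb.-integrable `[x, t] (EFin \o (fun=> d : R)) := locint_itv x t (locint_cst d).
have : 0 <= \int[leb]_(y in `[x, t]) ((g y - c) ^+ 2).
  by apply: Rintegral_ge0 => y _; exact: sqr_ge0.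
rewrite (_ : \int[leb]_(y in `[x, t]) ((g y - c) ^+ 2) =
    \int[leb]_(y in `[x, t]) (g y ^+ 2) - 2 * c * c + c ^+ 2 * (t - x)); last first.
  have i1 : leb.-integrable `[x, t] (EFin \o (fun y => - (2 * c) * g y)).
    by apply: integrable_itvMl => //; exact: cst_continuous.
  have i2 : leb.-integrable `[x, t] (EFin \o (fun y => - (2 * c) * g y + c ^+ 2)).
    apply: (@locint_itv _ (fun y => - (2 * c) * g y + c ^+ 2)).
    apply: locintD; last exact: locint_cst.
    by apply: locintMl => //; exact: cst_continuous.
  transitivity (\int[leb]_(y in `[x, t]) (g y ^+ 2 + (- (2 * c) * g y + c ^+ 2))).
    by apply: eq_Rintegral => y _; ring.
  rewrite RintegralD// RintegralD// RintegralZl// Rintegral_itv_cst// -/c.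
  by rewrite mulNr addrA.
by have := sqr_ge0 c; rewrite !expr2; nra.
Qed.

Definition unit_energy g x : R := \int[leb]_(y in `[x, x + 1]) (g y ^+ 2).

Lemma unit_energyE g x : locint (fun y => g y ^+ 2) ->
  unit_energy g x = primitive (fun y => g y ^+ 2) (x + 1) - primitive (fun y => g y ^+ 2) x.
Proof. by move=> g2i; rewrite primitiveB// lerDl. Qed.

Lemma unit_energy_ge0 g x : 0 <= unit_energy g x.
Proof. by apply: Rintegral_ge0 => y _; exact: sqr_ge0. Qed.

Lemma unit_energy_sub g x t : locint (fun y => g y ^+ 2) -> x <= t -> t <= x + 1 ->
  \int[leb]_(y in `[x, t]) (g y ^+ 2) <= unit_energy g x.
Proof.
move=> g2i xt tx; rewrite /unit_energy (Rintegral_itvD g2i xt tx) lerDl.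
by apply: Rintegral_ge0 => y _; exact: sqr_ge0.
Qed.

Lemma Rintegral_sqr_le g a (A : set R) : measurable A -> L2le g a ->
  \int[leb]_(y in A) (g y ^+ 2) <= a ^+ 2.
Proof.
move=> mA [mg ga]; have h : (\int[leb]_(y in A) (g y ^+ 2)%:E <= (a ^+ 2)%:E)%E.
  apply: le_trans ga; apply: ge0_subset_integral => //; first exact: measurable_sqr.
  by move=> x _; rewrite lee_fin sqr_ge0.
rewrite /Rintegral -lee_fin fineK// ge0_fin_numE.
  by apply: le_lt_trans h _; exact: ltry.
by apply: integral_ge0 => x _; rewrite lee_fin sqr_ge0.
Qed.

Lemma unit_energy_le g a x : L2le g a -> unit_energy g x <= a ^+ 2.
Proof. by apply: Rintegral_sqr_le. Qed.

(** Average over y in [x, x + 1] the bound v(x)^2 <= 2 v(y)^2 + 2 (v(y) - v(x))^2, the last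
    difference being an integral of g. The estimate is local, so it yields both the Sobolev bound
    and decay at infinity. *)
Lemma sup_le_unit_energy v g x : continuous v -> locint g ->
  locint (fun y => g y ^+ 2) ->
  (forall a b, a <= b -> v b - v a = \int[leb]_(t in `[a, b]) g t) ->
  v x ^+ 2 <= 2 * unit_energy v x + 2 * unit_energy g x.
Proof.
move=> vc gi g2i vg; have x1 : x <= x + 1 by rewrite lerDl.
have v2c : continuous (fun y => v y ^+ 2).
  by move=> y; apply: (cvgM (vc y) (vc y)).
have v2i := continuous_locint v2c.
have E : \int[leb]_(y in `[x, x + 1]) (v x ^+ 2) = v x ^+ 2.
  by rewrite Rintegral_itv_cst// addrAC subrr add0r mulr1.
rewrite -[leLHS]E.
have -> : 2 * unit_energy v x + 2 * unit_energy g x =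
  \int[leb]_(y in `[x, x + 1]) (2 * v y ^+ 2 + 2 * unit_energy g x).
  rewrite RintegralD//.
  - rewrite RintegralZl//; last exact: locint_itv.
    by rewrite Rintegral_itv_cst// addrAC subrr add0r mulr1.
  - by apply: integrable_itvMl; [exact: cst_continuous|exact: locint_itv].
  - exact/locint_itv/locint_cst.
apply: le_Rintegral => //.
- exact/locint_itv/locint_cst.
- apply: (@locint_itv _ (fun y => 2 * v y ^+ 2 + 2 * unit_energy g x)).
  by apply: locintD; [apply: locintMl => //; exact: cst_continuous|exact: locint_cst].
move=> y /=; rewrite in_itv/= => /andP[xy yx].
have h1 := vg _ _ xy.
have h2 := Jensen_unit_itv xy yx gi g2i.
have h3 := unit_energy_sub g2i xy yx.
rewrite -h1 in h2.
have := sqr_ge0 (v x - 2 * v y); rewrite !expr2 in h2 *; nra.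
Qed.

Lemma has_derivBE u u1 x y : continuous u1 -> has_deriv u u1 -> x <= y ->
  u y - u x = \int[leb]_(t in `[x, y]) u1 t.
Proof. by move=> u1c uu1 xy; rewrite (FTC2_continuous uu1). Qed.

Lemma sqr_le_norm (x b : R) : 0 <= b -> x ^+ 2 <= b ^+ 2 -> `|x| <= b.
Proof.
move=> b0; rewrite -(real_normK (num_real x)) => h.
by rewrite -(@ler_pXn2r _ 2)// nnegrE.
Qed.

Lemma H2le_sup u u1 f2 a : 0 <= a -> continuous u1 -> has_deriv u u1 ->
  (forall x y, x <= y -> u1 y - u1 x = \int[leb]_(t in `[x, y]) f2 t) ->
  H2le u u1 f2 a -> forall x, `|u x| <= 2 * a /\ `|u1 x| <= 2 * a.
Proof.
move=> a0 u1c uu1 u1f2 [_ _ ua u1a f2a] x.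
have uc := has_deriv_continuous uu1.
have e0 := unit_energy_le x ua; have e1 := unit_energy_le x u1a.
have e2 := unit_energy_le x f2a.
split; apply: sqr_le_norm; rewrite ?mulr_ge0//.
  have := @sup_le_unit_energy u u1 x uc (L2le_locint u1a) (L2le_locint_sqr u1a)
    (fun a b => has_derivBE u1c uu1).
  by rewrite exprMn; lra.
have := sup_le_unit_energy x u1c (L2le_locint f2a) (L2le_locint_sqr f2a) u1f2.
by rewrite exprMn; lra.
Qed.

Lemma sqrD3 (x y z : R) : (x + y + z) ^+ 2 <= 3 * (x ^+ 2 + y ^+ 2 + z ^+ 2).
Proof.
by have := sqr_ge0 (x - y); have := sqr_ge0 (y - z); have := sqr_ge0 (x - z); rewrite !expr2; nra.
Qed.

(** u'(x) differs from the difference quotient u(x+1) - u(x) by the mean of u' - u'(x), which u''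
    controls. No energy of u' appears on the right, and this is what makes the interpolation
    possible. *)
Lemma derivative_unit_energy u u1 f2 x : continuous u1 -> has_deriv u u1 ->
  locint f2 -> locint (fun y => f2 y ^+ 2) ->
  (forall x y, x <= y -> u1 y - u1 x = \int[leb]_(t in `[x, y]) f2 t) ->
  u1 x ^+ 2 <= 3 * (u (x + 1) ^+ 2 + u x ^+ 2 + unit_energy f2 x).
Proof.
move=> u1c uu1 fi f2i u1f2; have x1 : x <= x + 1 by rewrite lerDl.
pose w y := u1 y - u1 x.
have wc : continuous w by move=> y; apply: cvgB; [exact: u1c|exact: cvg_cst].
have w2c : continuous (fun y => w y ^+ 2) by move=> y; apply: (cvgM (wc y) (wc y)).
have wI := continuous_locint wc; have w2I := continuous_locint w2c.
pose c := \int[leb]_(y in `[x, x + 1]) w y.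
have cE : c = u (x + 1) - u x - u1 x.
  rewrite (has_derivBE u1c uu1 x1) /c RintegralB//; [|exact/locint_itv/continuous_locint|exact/locint_itv/locint_cst].
  by rewrite Rintegral_itv_cst// addrAC subrr add0r mulr1.
have h1 : c ^+ 2 <= \int[leb]_(y in `[x, x + 1]) (w y ^+ 2) by exact: Jensen_unit_itv.
have h2 : \int[leb]_(y in `[x, x + 1]) (w y ^+ 2) <= unit_energy f2 x.
  rewrite -[leRHS](_ : \int[leb]_(y in `[x, x + 1]) unit_energy f2 x = _); last first.
    by rewrite Rintegral_itv_cst// addrAC subrr add0r mulr1.
  apply: le_Rintegral => //; [exact: locint_itv|exact/locint_itv/locint_cst|].
  move=> y /=; rewrite in_itv/= => /andP[xy yx]; rewrite /w u1f2//.
  by apply: le_trans (Jensen_unit_itv xy yx fi f2i) _; exact: unit_energy_sub.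
have -> : u1 x = u (x + 1) + (- u x) + (- c) by rewrite cE; ring.
by apply: le_trans (sqrD3 _ _ _) _; rewrite !sqrrN; lra.
Qed.

(** Tonelli: the unit energy at x integrates g(x + y)^2 over y in [0, 1]; integrating in x first
    gives the full energy for every y. *)
Lemma integral_unit_energy g a : L2le g a ->
  (\int[leb]_x (unit_energy g x)%:E <= (a ^+ 2)%:E)%E.
Proof.
move=> [mg ga].
pose F (p : R * R) : \bar R := (g (p.1 + p.2) ^+ 2 * \1_(`[0, 1]%classic : set R) p.2)%:E.
have mF : measurable_fun setT F.
  apply/measurable_EFinP; apply: measurable_funM.
    apply: (@measurableT_comp _ _ _ _ _ _ (fun x => g x ^+ 2)).
      exact: measurable_funX.
    exact: measurable_funD.
  by apply: measurableT_comp => //; exact: measurable_indic.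
have F0 p : (0 <= F p)%E by rewrite lee_fin mulr_ge0// sqr_ge0.
have := @fubini_tonelli _ _ _ _ R leb leb F mF F0.
have L x : (\int[leb]_y F (x, y) = (unit_energy g x)%:E)%E.
  pose h z : \bar R := (g z ^+ 2 * \1_(`[x, x + 1]%classic : set R) z)%:E.
  have mh : measurable_fun setT h.
    by apply/measurable_EFinP; apply: measurable_funM => //; exact: measurable_funX.
  have h0 z : (0 <= h z)%E by rewrite lee_fin mulr_ge0// sqr_ge0.
  transitivity (\int[leb]_y h (y + x)%R)%E.
    apply: eq_integral => y _; rewrite /F /h /= addrC; congr (_ * _)%:E.
    by rewrite !indicE; congr (_%:R); congr nat_of_bool; apply/idP/idP; rewrite !inE/= !in_itv/=; lra.
  rewrite ge0_integral_shift// /unit_energy /Rintegral fineK.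
    rewrite [RHS]integral_mkcond; apply: eq_integral => y _; rewrite patchE /h indicE.
    by case: ifP; rewrite ?mulr1 ?mulr0.
  apply: (@integrable_fin_num _ _ _ leb _ (measurable_itv _) (EFin \o (fun y => g y ^+ 2))).
  by apply: locint_itv; exact: (@L2le_locint_sqr _ a).
under eq_integral do rewrite L.
move=> ->.
have In y : (\int[leb]_x F (x, y) =
    (\int[leb]_x (g x ^+ 2)%:E) * (\1_(`[0, 1]%classic : set R) y)%:E)%E.
  rewrite indicE; have [y01|y01] := boolP (y \in `[0, 1]%classic).
    rewrite mule1 -(@ge0_integral_shift _ (fun x => (g x ^+ 2)%:E) y).
    + by apply: eq_integral => x _; rewrite /F /= indicE y01 mulr1.
    + exact: measurable_sqr.
    + by move=> x; rewrite lee_fin sqr_ge0.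
  rewrite mule0 integral0_eq// => x _.
  by rewrite /F /= indicE (negbTE y01) mulr0.
under eq_integral do rewrite In.
rewrite ge0_integralZl//.
- have -> : (\int[leb]_x (\1_(`[0, 1]%classic : set R) x)%:E = leb `[0%R, 1%R])%E.
    by rewrite integral_indic// setIT.
  by rewrite lebesgue_measure_itv/= lte_fin ltr01 oppr0 adde0 mule1.
- by apply/measurable_EFinP.
- by apply: integral_ge0 => x _; rewrite lee_fin sqr_ge0.
Qed.

(* Gagliardo-Nirenberg type interpolation, from the pointwise bound on unit intervals. *)
Lemma L2le_interpolation u u1 f2 a b c : 0 <= a -> 0 <= b ->
  continuous u1 -> has_deriv u u1 ->
  (forall x y, x <= y -> u1 y - u1 x = \int[leb]_(t in `[x, y]) f2 t) ->
  L2le u a -> L2le u1 c -> L2le f2 b -> L2le u1 (3 * a + 2 * b).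
Proof.
move=> a0 b0 u1c uu1 u1f2 ua u1cc f2b.
have f2i := L2le_locint f2b; have f22i := L2le_locint_sqr f2b.
have uc := has_deriv_continuous uu1.
have mu := continuous_measurable uc.
split; first exact: continuous_measurable.
have mE : measurable_fun setT (unit_energy f2).
  rewrite (_ : unit_energy f2 = fun x => primitive (fun y => f2 y ^+ 2) (x + 1) - primitive (fun y => f2 y ^+ 2) x); last first.
    by apply/funext => x; exact: unit_energyE.
  have pm := continuous_measurable (primitive_continuous f22i).
  apply: measurable_funB => //; apply: (@measurableT_comp _ _ _ _ _ _ (primitive _)) => //.
  exact: measurable_funD.
have mus : measurable_fun setT (fun x : R => (u (x + 1) ^+ 2)%:E).
  by apply: measurable_sqr; apply: (@measurableT_comp _ _ _ _ _ _ u) => //; exact: measurable_funD.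
apply: (@le_trans _ _ (\int[leb]_x (3%:E * ((u (x + 1) ^+ 2)%:E + ((u x ^+ 2)%:E + (unit_energy f2 x)%:E))))%E).
  apply: ge0_le_integral => //.
  - by move=> x _; rewrite lee_fin sqr_ge0.
  - by apply: measurable_sqr; exact: continuous_measurable.
  - apply: measurable_funeM; apply: emeasurable_funD => //; apply: emeasurable_funD.
      exact: measurable_sqr.
    exact/measurable_EFinP.
  - move=> x _; rewrite -!EFinD -EFinM lee_fin addrA.
    exact: derivative_unit_energy.
have m2 : measurable_fun setT (fun x => ((u x ^+ 2)%:E + (unit_energy f2 x)%:E)%E).
  by apply: emeasurable_funD; [exact: measurable_sqr|exact/measurable_EFinP].
have p2 x : (0 <= (u x ^+ 2)%:E + (unit_energy f2 x)%:E)%E.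
  by rewrite -EFinD lee_fin addr_ge0 ?sqr_ge0 ?unit_energy_ge0.
rewrite ge0_integralZl_EFin//; last 2 first.
- by move=> x _; rewrite adde_ge0// lee_fin sqr_ge0.
- exact: emeasurable_funD.
rewrite ge0_integralD//; last by move=> x _; rewrite lee_fin sqr_ge0.
rewrite ge0_integralD//; [|by move=> x _; rewrite lee_fin sqr_ge0|exact: measurable_sqr|
  by move=> x _; rewrite lee_fin unit_energy_ge0|exact/measurable_EFinP].
have [_ h1] := L2le_shift 1 ua; have [_ h2] := ua.
have h3 := integral_unit_energy f2b.
(* 6 a^2 + 3 b^2 is at most (3 a + 2 b)^2. *)
apply: (@le_trans _ _ (3%:E * ((a ^+ 2)%:E + ((a ^+ 2)%:E + (b ^+ 2)%:E)))%E).
  by apply: lee_wpmul2l => //; apply: leeD => //; apply: leeD.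
rewrite -!EFinD -EFinM lee_fin !expr2.
by have := mulr_ge0 a0 b0; have := mulr_ge0 a0 a0; have := mulr_ge0 b0 b0; nra.
Qed.

(** The energy on [0, x] increases with x and is bounded; once it is within e of its supremum, any
    later unit interval carries at most e. *)
Lemma nonincreasing_energy_cvg g a e : L2le g a -> 0 < e ->
  exists A, forall x, A <= x -> unit_energy g x <= e.
Proof.
move=> ga e0; have g2i := L2le_locint_sqr ga.
pose P x := \int[leb]_(y in `[0, x]) (g y ^+ 2).
have PD x y : 0 <= x -> x <= y -> P y = P x + \int[leb]_(z in `[x, y]) (g z ^+ 2).
  by move=> x0 xy; exact: Rintegral_itvD.
pose S := [set P x | x in [set x | 0 <= x]].
have hS : has_sup S.
  split; first by exists (P 0), 0 => /=.
  by exists (a ^+ 2) => _ [x _ <-]; exact: Rintegral_sqr_le ga.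
have [_ [A /= A0 <-] hA] := sup_adherent e0 hS.
exists A => x Ax; have x0 := le_trans A0 Ax.
have xx : x <= x + 1 by rewrite lerDl.
have h1 := PD _ _ A0 Ax; have h2 := PD _ _ x0 xx.
have h3 : 0 <= \int[leb]_(z in `[A, x]) (g z ^+ 2) by apply: Rintegral_ge0 => y _; exact: sqr_ge0.
have h4 : P (x + 1) <= sup S.
  by apply: sup_upper_bound => //; exists (x + 1) => //=; exact: le_trans xx.
move: h1 h2 h3 h4 hA; rewrite -/(unit_energy g x).
move: (P A) (P x) (P (x + 1)) (sup S) (unit_energy g x) (Rintegral _ _ _) => *; lra.
Qed.

Lemma L2normE f : L2norm f = ((\int[leb]_x (f x ^+ 2)%:E) `^ 2^-1)%E.
Proof.
rewrite /L2norm unlock; congr (_ `^ _)%E; apply: eq_integral => x _ /=.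
by rewrite powR_mulrn// real_normK// num_real.
Qed.

Lemma integral_sqr_ge0 f : (0 <= \int[leb]_x (f x ^+ 2)%:E)%E.
Proof. by apply: integral_ge0 => x _; rewrite lee_fin sqr_ge0. Qed.

Lemma sqr_poweR_half (a : R) : 0 <= a -> (((a ^+ 2)%:E `^ 2^-1) = a%:E)%E.
Proof.
by move=> a0; rewrite poweR_EFin -powR_mulrn// -powRrM mulfV// powRr1.
Qed.

Lemma L2norm_le f a : 0 <= a -> L2le f a -> (L2norm f <= a%:E)%E.
Proof.
move=> a0 [_ fa]; rewrite L2normE -sqr_poweR_half//.
apply: gt0_ler_poweR => //; rewrite ?in_itv/= ?leey ?andbT ?integral_sqr_ge0//.
by rewrite lee_fin sqr_ge0.
Qed.

Lemma L2le_norm f a : 0 <= a -> measurable_fun setT f -> (L2norm f <= a%:E)%E -> L2le f a.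
Proof.
move=> a0 mf; rewrite L2normE => h; split=> //.
have -> : (\int[leb]_x (f x ^+ 2)%:E = ((\int[leb]_x (f x ^+ 2)%:E) `^ 2^-1) `^ 2)%E.
  by rewrite -poweRrM mulVf// poweRe1//; exact: integral_sqr_ge0.
rewrite -(powR_mulrn 2 a0) -poweR_EFin.
by apply: gt0_ler_poweR => //; rewrite ?in_itv/= ?leey ?andbT ?poweR_ge0// lee_fin.
Qed.

Lemma L2P f : L2 f <-> exists2 a, 0 <= a & L2le f a.
Proof.
split=> [Lf|[a a0 fa]].
  have /integrableP[mf2 fi] := Lfun2_integrable_sqr Lf.
  have mf : measurable_fun setT f by have := sub_Lfun_mfun Lf; rewrite inE.
  pose J := fine (\int[leb]_x (f x ^+ 2)%:E).
  have J0 : 0 <= J by exact/fine_ge0/integral_sqr_ge0.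
  exists (J + 1); first lra; split=> //.
  rewrite -(@fineK _ (\int[leb]_x (f x ^+ 2)%:E)%E) ?lee_fin -/J.
    by rewrite expr2; nra.
  rewrite ge0_fin_numE ?integral_sqr_ge0//; apply: le_lt_trans fi.
  rewrite le_eqVlt; apply/orP; left; apply/eqP; apply: eq_integral => x _.
  by rewrite /= ger0_norm// sqr_ge0.
rewrite /L2; apply/andP; split; first by rewrite inE; case: fa.
rewrite inE/=; apply: le_lt_trans (L2norm_le a0 fa) _; exact: ltry.
Qed.

Lemma H2P f : H2 f <-> exists f1 f2 a, 0 <= a /\ H2le f f1 f2 a.
Proof.
split=> [[f1 [f2 [w1 w2 /L2P[a a0 fa] /L2P[b b0 f1b] /L2P[c c0 f2c]]]]|[f1 [f2 [a [a0 [w1 w2 fa f1a f2a]]]]]].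
  exists f1, f2, (a + b + c); split; first by rewrite !addr_ge0.
  split=> //; [apply: L2leW fa|apply: L2leW f1b|apply: L2leW f2c] => //.
  - by rewrite -addrA lerDl addr_ge0.
  - by rewrite addrAC lerDr addr_ge0.
  - by rewrite lerDr addr_ge0.
by exists f1, f2; split=> //; apply/L2P; exists a.
Qed.

Lemma wderivE s f f1 : smooth_step s -> weak_derivative f f1 ->
  weak_derivative f (wderiv f) /\ f1 = wderiv f %[ae leb].
Proof.
move=> hs ff1; have w : weak_derivative f (wderiv f).
  by apply: (@xgetPex _ (cst 0) [set g | weak_derivative f g]); exists f1.
by split=> //; exact: weak_derivative_unique hs ff1 w.
Qed.

Lemma weak_derivative_meas f f1 : weak_derivative f f1 -> measurable_fun setT f1.
Proof. by move=> [_ []]. Qed.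

Lemma H2le_wderiv s f f1 f2 a : smooth_step s -> H2le f f1 f2 a ->
  [/\ f1 = wderiv f %[ae leb], f2 = wderiv (wderiv f) %[ae leb] &
   H2le f (wderiv f) (wderiv (wderiv f)) a].
Proof.
move=> hs H; have [w1 w2 fa f1a f2a] := H.
have [w1' e1] := wderivE hs w1.
have m1 := weak_derivative_meas w1'; have m2 := weak_derivative_meas w2.
have w2' : weak_derivative (wderiv f) f2.
  by apply: weak_derivative_ae w2 => //; exact: leb_aeW.
have [w2'' e2] := wderivE hs w2'.
split=> //; apply: H2le_ae H => //.
- exact: L2le_meas fa.
- exact: weak_derivative_meas w2''.
- exact: leb_aeW.
Qed.

Lemma H2norm_le s f f1 f2 a : smooth_step s -> 0 <= a -> H2le f f1 f2 a ->
  (H2norm f <= (2 * a)%:E)%E.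
Proof.
move=> hs a0 /(H2le_wderiv hs)[_ _ [_ _ fa f1a f2a]].
have [mf Jf] := fa; have [mf1 Jf1] := f1a; have [mf2 Jf2] := f2a.
rewrite /H2norm /H2norm_on -(@sqr_poweR_half (2 * a)) ?mulr_ge0//.
have m3 : measurable_fun setT (fun x => (f x ^+ 2 + wderiv f x ^+ 2 + wderiv (wderiv f) x ^+ 2)%:E).
  apply/measurable_EFinP; apply: measurable_funD; last exact: measurable_funX.
  by apply: measurable_funD; exact: measurable_funX.
apply: gt0_ler_poweR => //; rewrite ?in_itv/= ?leey ?andbT.
- by apply: integral_ge0 => x _; rewrite lee_fin !addr_ge0// sqr_ge0.
- by rewrite lee_fin sqr_ge0.
under eq_integral do rewrite !EFinD.
have s0 g x : (0 <= (g x ^+ 2)%:E)%E by rewrite lee_fin sqr_ge0.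
rewrite ge0_integralD//; [|by move=> x _; rewrite adde_ge0|
  by apply: emeasurable_funD; exact: measurable_sqr|exact: measurable_sqr].
rewrite ge0_integralD//; [|exact: measurable_sqr|exact: measurable_sqr].
apply: (@le_trans _ _ ((a ^+ 2)%:E + (a ^+ 2)%:E + (a ^+ 2)%:E)%E).
  exact: (leeD (leeD Jf Jf1) Jf2).
by rewrite -!EFinD lee_fin exprMn; have := sqr_ge0 a; lra.
Qed.

Lemma has_deriv_H2le s h h1 h2 : smooth_step s -> has_deriv h h1 -> has_deriv h1 h2 ->
  continuous h2 -> H2 h -> exists2 a, 0 <= a & H2le h h1 h2 a.
Proof.
move=> hs hh1 hh2 h2c /H2P[g1 [g2 [a [a0 H]]]]; have [w1 w2 ha g1a g2a] := H.
have h1c := has_deriv_continuous hh2.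
have e1 := weak_derivative_unique hs w1 (has_deriv_weak hh1 h1c).
have mh1 := continuous_measurable h1c; have mh2 := continuous_measurable h2c.
have w2' : weak_derivative h1 g2.
  have mg2 := weak_derivative_meas w2.
  by apply: weak_derivative_ae w2 => //; exact: leb_aeW.
have e2 := weak_derivative_unique hs w2' (has_deriv_weak hh2 h2c).
exists a => //; apply: H2le_ae H => //; first exact: L2le_meas ha.
exact: leb_aeW.
Qed.

(** The unit energies of h, h1 and h2 tend to 0 and bound h and h1 pointwise. No rate is
    obtained. *)
Lemma H2_decay s h h1 h2 : smooth_step s -> has_deriv h h1 -> has_deriv h1 h2 ->
  continuous h2 -> H2 h -> forall e, 0 < e ->
  exists A, forall x, A <= x -> `|h x| <= e /\ `|h1 x| <= e.
Proof.
move=> hs hh1 hh2 h2c Hh e e0.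
have [a a0 [w1 w2 ha h1a h2a]] := has_deriv_H2le hs hh1 hh2 h2c Hh.
(* Two energies of size e^2/4, each with the factor 2 of [sup_le_unit_energy], add up to e^2. *)
have d0 : 0 < e ^+ 2 / 4 by rewrite divr_gt0// exprn_gt0.
have [A0 hA0] := nonincreasing_energy_cvg ha d0.
have [A1 hA1] := nonincreasing_energy_cvg h1a d0.
have [A2 hA2] := nonincreasing_energy_cvg h2a d0.
have h1c := has_deriv_continuous hh2.
exists (Num.max A0 (Num.max A1 A2)) => x; rewrite !ge_max => /andP[x0 /andP[x1 x2]].
have e0' := hA0 _ x0; have e1' := hA1 _ x1; have e2' := hA2 _ x2.
split; (apply: sqr_le_norm; first exact: ltW).
  have := @sup_le_unit_energy h h1 x (has_deriv_continuous hh1) (L2le_locint h1a) (L2le_locint_sqr h1a)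
    (fun a b => has_derivBE h1c hh1).
  lra.
have := @sup_le_unit_energy h1 h2 x h1c (L2le_locint h2a) (L2le_locint_sqr h2a)
    (fun a b => has_derivBE h2c hh2).
lra.
Qed.

End Sobolev.

(** * Gluing inverses of Schroedinger operators *)

Section Operators.
Context {R : realType}.
Implicit Types (f g h m s u v q w : R -> R) (C : R).
Notation leb := (@lebesgue_measure R).
Notation locint := (@locally_integrable R setT).

(* Both concern the operator w |-> - w'' + q w. *)
Definition solvable q C := forall f a, 0 <= a -> L2le f a ->
  exists w w1 w2, H2le w w1 w2 (C * a) /\ w2 = (fun x => q x * w x - f x) %[ae leb].

Definition coercive q C := forall w w1 w2 a b, 0 <= a -> H2le w w1 w2 b ->
  L2le (fun x => q x * w x - w2 x) a -> L2le w (C * a).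

Lemma solvable_shift q C c : solvable q C -> solvable (fun x => q (x - c)) C.
Proof.
move=> qC f a a0 fa; have fca := L2le_shift c fa.
have [w [w1 [w2 [H E]]]] := qC _ _ a0 fca.
exists (fun x => w (x - c)), (fun x => w1 (x - c)), (fun x => w2 (x - c)).
split; first exact: H2le_shift.
have [N [mN N0 PN]] := E.
(* The exceptional null set is translated along with the solution. *)
exists ((fun x : R => x - c) @^-1` N); split.
- rewrite -[X in measurable X]setTI.
  by apply: (measurable_funD (@measurable_id _ _ _) (@measurable_cst _ _ _ _ _ (- c))).
- by have := lebesgue_measure_shift (- c) mN; rewrite N0.
- by move=> x /= nx; apply: PN => /= h; apply: nx => _; rewrite h// subrK.
Qed.

Lemma coercive_shift q C c : coercive q C -> coercive (fun x => q (x - c)) C.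
Proof.
move=> qC w w1 w2 a b a0 H L.
have := L2le_shift (- c) (qC _ _ _ _ _ a0 (H2le_shift (- c) H) _).
rewrite (_ : (fun x => w (x + - c - - c)) = w); last by apply/funext => x; rewrite opprK subrK.
apply; have := L2le_shift c L.
rewrite (_ : (fun x => q (x + c - c) * w (x + c) - w2 (x + c)) =
  (fun x => q x * w (x - - c) - w2 (x - - c)))//.
by apply/funext => x; rewrite addrK opprK.
Qed.

(** The least bound is the L2 norm as a real number. A coercivity estimate needs it to absorb a
    small multiple of the norm on the left. *)
Lemma L2le_min w b : L2le w b -> exists N, [/\ 0 <= N, L2le w N &
  forall c, 0 <= c -> L2le w c -> N <= c].
Proof.
move=> [mw wb]; pose J := fine (\int[leb]_x (w x ^+ 2)%:E).
have Jf : (\int[leb]_x (w x ^+ 2)%:E)%E \is a fin_num.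
  by rewrite ge0_fin_numE ?integral_sqr_ge0//; apply: le_lt_trans wb _; exact: ltry.
have J0 : 0 <= J by exact/fine_ge0/integral_sqr_ge0.
exists (Num.sqrt J); split; first exact: sqrtr_ge0.
  by split=> //; rewrite -(fineK Jf) sqr_sqrtr.
move=> c c0 [_]; rewrite -(fineK Jf) lee_fin -/J => Jc.
by rewrite -(ger0_norm c0) -sqrtr_sqr ler_wsqrtr.
Qed.

Section Gluing.
(** [thA] couples the sharp cells A j with the smooth plateaus th j. In [small], eps is the mismatch
    of potentials, 3 d the size of the commutators, and 6 + 2 Kq the price of bounding an H2 norm by
    an L2 norm in [glue_coercive]; the constant 1/2 is what halves residuals and permits
    absorption. *)
Variables (s : R -> R) (r : seq nat) (q_ : nat -> R -> R) (th : nat -> R -> R)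
  (A : nat -> set R) (C Kq d eps : R).
Let n : R := (size r)%:R.
Hypotheses (hs : smooth_step s) (C0 : 0 < C) (Kq0 : 0 <= Kq) (d0 : 0 <= d) (d1 : d <= 1)
  (eps0 : 0 <= eps) (eps1 : eps <= 1)
  (small : n * C * (eps + 3 * d * (6 + 2 * Kq)) <= 1 / 2)
  (ths : forall j, smooth (th j)) (th1 : forall j x, `|th j x| <= 1)
  (th'd : forall j x, `|derive1 (th j) x| <= d)
  (th''d : forall j x, `|derive1 (derive1 (th j)) x| <= d)
  (mA : forall j, measurable (A j))
  (thA : forall x, \sum_(j <- r) th j x * \1_(A j) x = 1)
  (mq : forall j, measurable_fun setT (q_ j)) (qK : forall j x, `|q_ j x| <= Kq).

Let d_le4 : 1 + 3 * d <= 4. Proof. by move: d1 => h; lra. Qed.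

Lemma sum_const_iter (c : R) : \sum_(j <- r) c = n * c.
Proof. by rewrite big_const_seq count_predT iter_addr_0 mulr_natl. Qed.

Let mth j : measurable_fun setT (th j) := continuous_measurable (smooth_continuous (@ths j)).

Lemma th_neq0 x : exists2 j, j \in r & th j x != 0.
Proof.
apply: contrapT => nex; have := thA x; rewrite big_seq big1 => [/esym/eqP|j jr].
  by rewrite oner_eq0.
have [->|thj] := eqVneq (th j x) 0; first by rewrite mul0r.
by exfalso; apply: nex; exists j.
Qed.

(* Solve with each [q_ j] on its cell and glue: the error [E] only contains derivatives
   of the plateaus [th j], which are of size [d]. *)
Lemma parametrix f a : (forall j, solvable (q_ j) C) -> 0 <= a -> L2le f a ->
  exists (w w1 w2 : R -> R) (p : nat -> R -> R) (E : R -> R),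
  [/\ H2le w w1 w2 (n * (4 * C * a)), forall j, L2le (p j) (C * a),
      L2le E (n * (3 * d * (C * a))), w = (fun x => \sum_(j <- r) th j x * p j x) &
      w2 = (fun x => \sum_(j <- r) th j x * (q_ j x * p j x) - f x + E x) %[ae leb]].
Proof.
move=> qC a0 fa; have Ca0 : 0 <= C * a by rewrite mulr_ge0// ltW.
have : forall j, exists P : (R -> R) * (R -> R) * (R -> R),
   H2le P.1.1 P.1.2 P.2 (C * a) /\
   P.2 = (fun x => q_ j x * P.1.1 x - (f \_ (A j)) x) %[ae leb].
  move=> j; have [w [w1 [w2 [H E]]]] := qC j _ _ a0 (L2le_patch (mA j) fa).
  by exists (w, w1, w2).
move=> /choice[P hP].
pose p j := (P j).1.1; pose p1 j := (P j).1.2; pose p2 j := (P j).2.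
pose E_ j x := 2 * derive1 (th j) x * p1 j x + derive1 (derive1 (th j)) x * p j x.
have hM j := @H2leM _ (th j) (p j) (p1 j) (p2 j) (C * a) d (@ths j) Ca0 d0 (@th1 j) (@th'd j) (@th''d j) (hP j).1.
pose w x := \sum_(j <- r) th j x * p j x.
pose w1 x := \sum_(j <- r) (derive1 (th j) x * p j x + th j x * p1 j x).
pose w2 x := \sum_(j <- r) (th j x * p2 j x + E_ j x).
pose E x := \sum_(j <- r) E_ j x.
exists w, w1, w2, p, E; split=> //.
- rewrite -sum_const_iter; apply: H2le_sum => [_|j]; first by rewrite -mulrA mulr_ge0.
  have [H _] := hM j; apply: H2leW H; first by rewrite mulr_ge0// addr_ge0// mulr_ge0.
  have d4 := d_le4.
  by rewrite -(mulrA 4); exact: ler_wpM2r.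
- by move=> j; have [[]] := hP j.
- rewrite -sum_const_iter; apply: L2le_sum => [_|j]; first by rewrite mulr_ge0// mulr_ge0.
  by have [_] := hM j.
have : \forall x \ae leb, forall j, p2 j x = q_ j x * p j x - (f \_ (A j)) x.
  apply: ae_foralln => j; have [_] := hP j.
  by apply: leb_aeS => x; apply.
apply: leb_aeS => x hx _; rewrite /w2 /E big_split/=; congr (_ + _).
transitivity (\sum_(j <- r) (th j x * (q_ j x * p j x) - (th j x * \1_(A j) x) * f x)).
  apply: eq_bigr => j _; rewrite hx mulrBr; congr (_ - _).
  by rewrite -mulrA patchE indicE; case: ifP; rewrite ?mul1r ?mul0r.
by rewrite big_split/= sumrN -big_distrl/= thA mul1r.
Qed.

Let K := 4 * n * C.

Let n0 : 0 <= n. Proof. by rewrite ler0n. Qed.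

Let K0 : 0 <= K. Proof. by rewrite /K !mulr_ge0// ltW. Qed.

(** * Quasi-Newton iteration for u'' = b(x, u) *)

Section Solve.
(** [bm] compares difference quotients of b, for arguments bounded by rho, with q_j wherever th_j is
    nonzero. This covers the cubic nonlinearity, and also an affine b, whose quotient is the
    potential itself. [erho] keeps all iterates in the ball of radius rho. *)
Variables (b : R -> R -> R) (rho e : R).
Hypotheses (qC : forall j, solvable (q_ j) C) (e0 : 0 < e) (erho : 4 * K * e <= rho)
  (mb : forall w, measurable_fun setT w -> measurable_fun setT (fun x => b x (w x)))
  (bm : forall x y z, `|y| <= rho -> `|z| <= rho -> exists2 m, b x y - b x z = m * (y - z) &
     forall j, j \in r -> th j x != 0 -> `|m - q_ j x| <= eps)
  (b0 : L2le (fun x => b x 0) e).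

(* One quasi-Newton step with the parametrix halves the residual. *)
Lemma glue_step w w2 a : 0 <= a -> measurable_fun setT w ->
  (forall x, `|w x| + 2 * (K * a) <= rho) -> L2le (fun x => b x (w x) - w2 x) a ->
  exists u u1 u2, [/\ H2le u u1 u2 (K * a),
    forall x, `|u x| <= 2 * (K * a) /\ `|u1 x| <= 2 * (K * a) &
    L2le (fun x => b x (w x + u x) - (w2 x + u2 x)) (a / 2)].
Proof.
move=> a0 mw wrho Ra.
have mRa := L2le_meas Ra.
(* Solving with data minus the residual R makes v2 contain + R, which cancels the old residual. What
   is left is the sum of (m - q_j) th_j p_j, named [D] below, minus the commutator E. *)
have [v [v1 [v2 [p [E [H pC EC vE v2E]]]]]] := parametrix qC a0 (L2leN Ra).
have KE : n * (4 * C * a) = K * a by rewrite /K; ring.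
rewrite KE in H.
have Ka0 : 0 <= K * a by rewrite mulr_ge0.
have [u [u1 [vu v1u1 u1c uu1 [u1v2 Hu]]]] := H2le_rep hs H.
have usup := H2le_sup Ka0 u1c uu1 u1v2 Hu.
have mu : measurable_fun setT u by case: Hu => _ _ [].
have mv2 : measurable_fun setT v2 by case: Hu => _ _ _ _ [].
have mE := L2le_meas EC.
exists u, u1, v2; split=> //.
have mp j : measurable_fun setT (p j) := L2le_meas (pC j).
have mw2 : measurable_fun setT w2.
  rewrite (_ : w2 = fun x => b x (w x) - (b x (w x) - w2 x)); last by apply/funext => x; rewrite subKr.
  by apply: measurable_funB => //; exact: mb.
have mR' : measurable_fun setT (fun x => b x (w x + u x) - (w2 x + v2 x)).
  by apply: measurable_funB; [apply: mb; exact: measurable_funD|exact: measurable_funD].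
pose D x := b x (w x + u x) - (w2 x + v2 x) + E x.
have mD : measurable_fun setT D by exact: measurable_funD.
have h1 : L2le D (n * (eps * (C * a))).
  pose G x := \sum_(j <- r) eps * `|p j x|.
  have hG : L2le G (n * (eps * (C * a))).
    rewrite -sum_const_iter; apply: L2le_sum => [_|j]; first by rewrite !mulr_ge0// ltW.
    apply: L2leZ; apply: (@L2le_le _ _ (p j)) => //; first exact: measurableT_comp.
    by move=> x; rewrite normr_id.
  (* The bound |D| <= G holds almost everywhere only, whereas [L2le_le] asks for it everywhere; D is
     therefore truncated on a null set. *)
  pose D' x := if `|D x| <= G x then D x else 0.
  have DD' : D' = D %[ae leb].
    apply: leb_aeS2 vu v2E => x vux v2x _; rewrite /D'.
    suff -> : `|D x| <= G x by [].
    have wu : `|w x + u x| <= rho.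
      by apply: le_trans (ler_normD _ _) _; apply: le_trans (wrho x); rewrite lerD2l; case: (usup x).
    have ww : `|w x| <= rho by apply: le_trans (wrho x); rewrite lerDl mulr_ge0.
    have [m bE mq'] := bm x wu ww.
    have -> : D x = \sum_(j <- r) (m - q_ j x) * (th j x * p j x).
      transitivity (m * u x - \sum_(j <- r) th j x * (q_ j x * p j x)).
        rewrite /D v2x//.
        rewrite (_ : b x (w x + u x) = b x (w x) + m * (w x + u x - w x)); last by rewrite -bE subrKC.
        by ring.
      rewrite -vux// vE big_distrr/= -sumrB; apply: eq_bigr => j _; ring.
    apply: le_trans (ler_norm_sum _ _ _) _.
    rewrite big_seq [leRHS]big_seq; apply: ler_sum => j jr; rewrite normrM normrM.
    have [->|thj] := eqVneq (th j x) 0; first by rewrite normr0 mul0r mulr0 mulr_ge0.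
    apply: ler_pM => //; first exact: mq'.
    by rewrite -[leRHS]mul1r ler_wpM2r.
  apply: (@L2le_ae _ D') => //.
  have mG := L2le_meas hG.
  apply: (@L2le_le _ _ G) => //.
    rewrite (_ : D' = fun x => D x * (\1_[set x | `|D x| <= G x] x)); last first.
      apply/funext => x; rewrite /D' indicE; case: ifPn => h.
        by rewrite mem_set// mulr1.
      by rewrite memNset ?mulr0//; exact/negP.
    apply: measurable_funM => //; apply: measurable_indic.
    have := @measurable_fun_ler _ _ R setT (fun x => `|D x|) G.
    move=> /(_ (measurableT_comp (@normr_measurable R setT) mD) mG) h.
    rewrite -[X in measurable X]setTI.
    by have := h measurableT [set true] I.
  move=> x; rewrite /D'; case: ifPn => [h|_]; last by rewrite normr0.
  apply: le_trans h _; exact: ler_norm.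
have -> : (fun x => b x (w x + u x) - (w2 x + v2 x)) = (fun x => D x - E x).
  by apply/funext => x; rewrite /D addrK.
have c1 : 0 <= n * (eps * (C * a)) by rewrite !mulr_ge0// ltW.
have c2 : 0 <= n * (3 * d * (C * a)) by rewrite !mulr_ge0// ltW.
apply: (@L2leW _ _ (n * (eps * (C * a)) + n * (3 * d * (C * a)))).
- exact: addr_ge0.
- have nC0 : 0 <= n * C by rewrite mulr_ge0// ltW.
  have : n * C * (eps + 3 * d) <= 1 / 2.
    apply: le_trans small; rewrite ler_wpM2l// lerD2l ler_peMr ?mulr_ge0//; have h := Kq0; lra.
  move=> /(ler_wpM2r a0); congr (_ <= _); ring.
- exact: L2leB.
Qed.

Let a_ k : R := e / 2 ^+ k.

Let a_gt0 k : 0 < a_ k. Proof. by rewrite /a_ divr_gt0// exprn_gt0. Qed.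

Let a_S k : a_ k.+1 = a_ k / 2.
Proof. by rewrite /a_ exprS; field; rewrite expf_neq0. Qed.

Let a_cvg : a_ k @[k --> \oo] --> 0.
Proof.
have -> : a_ = (fun k => e * 2^-1 ^+ k) by apply/funext => k; rewrite /a_ exprVn.
rewrite -(mulr0 e); apply: cvgM; first exact: cvg_cst.
by apply: cvg_expr; rewrite ger0_norm ?invr_ge0// invf_lt1// ltr1n.
Qed.

Let T := ((R -> R) * (R -> R) * (R -> R))%type.

(** The sup bound telescopes the increments 2 K a_i, as a_0 + ... + a_(k-1) = 2 (e - a_k). It leaves
    room for one more step below 4 K e <= rho. *)
Let Inv k (S : T) := [/\ weak_derivative S.1.1 S.1.2, weak_derivative S.1.2 S.2,
  (forall x, `|S.1.1 x| <= 4 * K * (e - a_ k)),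
  L2le (fun x => b x (S.1.1 x) - S.2 x) (a_ k) & exists c, L2le S.1.1 c].

(** Second derivatives are not compared: their limit is read off the vanishing residual. *)
Let Rel k (S S' : T) := [/\ L2le (fun x => S'.1.1 x - S.1.1 x) (K * a_ k),
  L2le (fun x => S'.1.2 x - S.1.2 x) (K * a_ k) &
  forall x, `|S'.1.1 x - S.1.1 x| <= 2 * (K * a_ k) /\
    `|S'.1.2 x - S.1.2 x| <= 2 * (K * a_ k)].

Let Inv_step k S : Inv k S -> exists S', Inv k.+1 S' /\ Rel k S S'.
Proof.
move=> [w1 w2 sup R_ [c Sc]].
have ak := ltW (a_gt0 k); have Kak : 0 <= K * a_ k by rewrite mulr_ge0.
have mS := L2le_meas Sc.
have hrho x : `|S.1.1 x| + 2 * (K * a_ k) <= rho.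
  apply: le_trans erho; have := sup x; rewrite mulrBr; lra.
have [u [u1 [u2 [H us L]]]] := glue_step ak mS hrho R_.
have [uu1 u1u2 ua u1a u2a] := H.
exists ((fun x => S.1.1 x + u x), (fun x => S.1.2 x + u1 x), (fun x => S.2 x + u2 x)).
split; split=> /=.
- exact: weak_derivativeD.
- exact: weak_derivativeD.
- move=> x; apply: le_trans (ler_normD _ _) _; have := sup x; have := (us x).1.
  by rewrite a_S; lra.
- by rewrite a_S.
- exists (`|c| + K * a_ k); apply: L2leD => //.
  by apply: L2le_weaken Sc; rewrite real_normK// num_real.
- by under eq_fun do rewrite addrAC subrr add0r.
- by under eq_fun do rewrite addrAC subrr add0r.
- by move=> x; rewrite ![_ + _ - _]addrAC !subrr !add0r.
Qed.

Let Inv0 : Inv 0 ((fun=> 0), (fun=> 0), (fun=> 0)).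
Proof.
split=> /=; [exact: weak_derivative0|exact: weak_derivative0| | |by exists 0; exact: L2le0].
  by move=> x; rewrite normr0 /a_ expr0 divr1 subrr mulr0.
by under eq_fun do rewrite subr0; rewrite /a_ expr0 divr1.
Qed.

Lemma glue_sequence : exists S : nat -> T, S 0%N = ((fun=> 0), (fun=> 0), (fun=> 0)) /\
  forall k, Inv k (S k) /\ Rel k (S k) (S k.+1).
Proof.
have : forall p : nat * T, exists S', Inv p.1 p.2 -> Inv p.1.+1 S' /\ Rel p.1 p.2 S'.
  (* Choice needs a successor for every state; one violating the invariant is left in place. *)
  move=> [k S] /=; have [h|h] := pselect (Inv k S); last by exists S.
  by have [S' hS'] := Inv_step h; exists S'.
move=> /choice[next hn].
pose S_ := fix F k := if k is k'.+1 then next (k', F k') else ((fun=> 0), (fun=> 0), (fun=> 0)) : T.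
exists S_; split=> //.
have hI k : Inv k (S_ k) by elim: k => [|k ih]; [exact: Inv0|exact: (hn (k, S_ k) ih).1].
by move=> k; split=> //; exact: (hn (k, S_ k) (hI k)).2.
Qed.

Let geometric_cvg (g_ : nat -> R -> R) c :
  (forall k x, `|g_ k.+1 x - g_ k x| <= c * a_ k) ->
  exists g, forall x, g_ k x @[k --> \oo] --> g x.
Proof.
move=> hg; exists (fun x => lim (g_ k x @[k --> \oo])) => x.
pose z k := g_ k.+1 x - g_ k x.
have zc : cvgn (series z).
  apply: normed_cvg; apply: (@series_le_cvg _ _ (geometric (c * e) 2^-1)).
  - by move=> k /=.
  - by move=> k; have := le_trans (normr_ge0 _) (hg k x); rewrite /a_ /= exprVn mulrA.
  - by move=> k /=; apply: le_trans (hg k x) _; rewrite /a_ exprVn mulrA.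
  - by apply: is_cvg_geometric_series; rewrite ger0_norm ?invr_ge0// invf_lt1// ltr1n.
have E : (fun k => g_ k x) = (fun k => g_ 0%N x + series z k).
  apply/funext => k; elim: k => [|k ih]; first by rewrite /series/= big_geq// addr0.
  by rewrite seriesSr -/(series z k) addrA -ih /z addrC subrK.
by rewrite E; apply: is_cvgD => //; exact: is_cvg_cst.
Qed.

(** The telescoped L2 bounds, uniform in p, pass to the pointwise limit by Fatou. Convergence in L2
    is thus had without completeness of L2. *)
Let geometric_L2 (g_ : nat -> R -> R) g c : 0 <= c ->
  (forall k, L2le (fun x => g_ k.+1 x - g_ k x) (c * a_ k)) ->
  (forall x, g_ k x @[k --> \oo] --> g x) ->
  forall k, L2le (fun x => g_ k x - g x) (2 * c * a_ k).
Proof.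
move=> c0 hg gg k.
have hp p : L2le (fun x => g_ (k + p)%N x - g_ k x) (2 * c * (a_ k - a_ (k + p)%N)).
  elim: p => [|p ih].
    rewrite addn0 subrr mulr0; under eq_fun do rewrite subrr; exact: L2le0.
  have ca : 0 <= c * a_ (k + p)%N by rewrite mulr_ge0// ltW.
  have := L2leD (_ : 0 <= 2 * c * (a_ k - a_ (k + p)%N)) ca ih (hg (k + p)%N).
  under eq_fun do rewrite addrC addrA subrK.
  rewrite addnS a_S (_ : 2 * c * (a_ k - a_ (k + p)%N) + c * a_ (k + p)%N =
    2 * c * (a_ k - a_ (k + p)%N / 2)); last by field.
  apply; rewrite !mulr_ge0// subr_ge0.
  elim: p {ih ca} => [|p ih]; first by rewrite addn0.
  by rewrite addnS a_S; have := ltW (a_gt0 (k + p)%N); lra.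
have hp' p : L2le (fun x => g_ k x - g_ (k + p)%N x) (2 * c * a_ k).
  have := L2leN (hp p); under eq_fun do rewrite opprB.
  apply: L2le_weaken; rewrite lerXn2r// ?nnegrE.
  - rewrite !mulr_ge0// subr_ge0; elim: p => [|p ih]; first by rewrite addn0.
    by rewrite addnS a_S; have := ltW (a_gt0 (k + p)%N); lra.
  - by rewrite !mulr_ge0// ltW.
  - by rewrite ler_wpM2l ?mulr_ge0// lerBlDr lerDl ltW.
apply: (L2le_lim hp') => x; apply: cvgB; first exact: cvg_cst.
by have := gg x; rewrite -(cvg_shiftn k); under eq_fun do rewrite addnC.
Qed.

(** Values and first derivatives converge pointwise and in L2; second derivatives converge in L2 to
    b(x, p) because residuals vanish, so closedness of weak derivatives yields the equation. The C^1
    representative then replaces p. The constant adds the bound 2 K e of p and p1 to the bound of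
    b(x, p). *)
Lemma glue_solve : exists u u1, [/\ continuous u1, has_deriv u u1 &
  H2le u u1 (fun x => b x (u x)) ((2 * K + 1 + (Kq + 1) * (2 * K)) * e)].
Proof.
have [S [S0 hS]] := glue_sequence.
have hRel k : Rel k (S k) (S k.+1) := (hS k).2.
have hInv k : Inv k (S k) := (hS k).1.
have [p hp] : exists p : R -> R, forall x, (S k).1.1 x @[k --> \oo] --> p x.
  apply: (@geometric_cvg (fun k => (S k).1.1) (2 * K)) => k x.
  by have [_ _ /(_ x)[]] := hRel k; rewrite mulrA.
have [p1 hp1] : exists p : R -> R, forall x, (S k).1.2 x @[k --> \oo] --> p x.
  apply: (@geometric_cvg (fun k => (S k).1.2) (2 * K)) => k x.
  by have [_ _ /(_ x)[]] := hRel k; rewrite mulrA.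
have Lp : forall k, L2le (fun x => (S k).1.1 x - p x) (2 * K * a_ k).
  by apply: (@geometric_L2 (fun k => (S k).1.1)) => // k; have [] := hRel k.
have Lp1 : forall k, L2le (fun x => (S k).1.2 x - p1 x) (2 * K * a_ k).
  by apply: (@geometric_L2 (fun k => (S k).1.2)) => // k; have [] := hRel k.
have a0e : a_ 0 = e by rewrite /a_ expr0 divr1.
have pe : L2le p (2 * K * e).
  have := L2leN (Lp 0%N); rewrite S0 a0e /=.
  by under eq_fun do rewrite sub0r opprK.
have p1e : L2le p1 (2 * K * e).
  have := L2leN (Lp1 0%N); rewrite S0 a0e /=.
  by under eq_fun do rewrite sub0r opprK.
have Srho k x : `|(S k).1.1 x| <= rho.
  have [_ _ /(_ x) h _ _] := hInv k; apply: le_trans h _; apply: le_trans erho.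
  by apply: ler_wpM2l; [rewrite mulr_ge0|rewrite lerBlDr lerDl ltW].
have prho x : `|p x| <= rho.
  have hc : `|(S k).1.1 x| @[k --> \oo] --> `|p x| by apply: cvg_norm; exact: hp.
  by apply: (cvgr_to_le hc); exact: nearW.
have rho0 : 0 <= rho by apply: le_trans (prho 0).
have mp := L2le_meas pe.
have mbp := mb mp.
(* Some th_j is nonzero at x, so the quotient m satisfies |m| <= |q_j| + eps <= Kq + 1. *)
have bK x y z : `|y| <= rho -> `|z| <= rho -> `|b x y - b x z| <= (Kq + 1) * `|y - z|.
  move=> hy hz; have [m -> hm] := bm x hy hz.
  have [j jr thj] := th_neq0 x.
  rewrite normrM ler_wpM2r//; have := hm _ jr thj; have := qK j x.
  by have := ler_normD (m - q_ j x) (q_ j x); rewrite subrK; move: eps1 => h0 h1 h2 h3; lra.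
have KK : 0 <= 2 * K * e by rewrite !mulr_ge0// ltW.
have Kq1 : 0 <= Kq + 1 by rewrite addr_ge0.
have be : L2le (fun x => b x (p x)) (e + (Kq + 1) * (2 * K * e)).
  rewrite (_ : (fun x => b x (p x)) = (fun x => b x 0 + (b x (p x) - b x 0))); last first.
    by apply/funext => x; rewrite addrC subrK.
  apply: L2leD => //; [exact: ltW|by rewrite mulr_ge0|].
  apply: (@L2le_le _ _ (fun x => (Kq + 1) * p x)).
  - by apply: measurable_funB => //; exact: (L2le_meas b0).
  - move=> x; rewrite normrM (ger0_norm Kq1).
    by have := bK x (p x) 0 (prho x); rewrite subr0 normr0; apply.
  - exact: L2leZ.
(* The distance of the second derivative to its limit splits into a Lipschitz term and the k-th
   residual. *)
have LR k : L2le (fun x => (S k).2 x - b x (p x)) ((1 + (Kq + 1) * (2 * K)) * a_ k).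
  have [_ _ _ R_ [c Sc]] := hInv k; have mS := L2le_meas Sc.
  rewrite (_ : (fun x => (S k).2 x - b x (p x)) = (fun x => (b x ((S k).1.1 x) - b x (p x)) - (b x ((S k).1.1 x) - (S k).2 x))); last first.
    by apply/funext => x; ring.
  rewrite mulrDl mul1r addrC; apply: L2leB => //.
  - by rewrite !mulr_ge0// ltW.
  - exact: ltW.
  apply: (@L2le_le _ _ (fun x => (Kq + 1) * ((S k).1.1 x - p x))).
  - by apply: measurable_funB => //; exact: mb.
  - by move=> x; rewrite normrM (ger0_norm Kq1) bK.
  - by rewrite -mulrA; exact: L2leZ.
(* A common rate dominating that of the functions and that of the second derivatives, as
   [weak_derivative_lim] takes a single sequence. *)
have M0 : 0 < 1 + (Kq + 1) * (2 * K) + 2 * K.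
  by have h1 := mulr_ge0 Kq1 K0; have hK0 := K0; lra.
have Mcvg : (1 + (Kq + 1) * (2 * K) + 2 * K) * a_ k @[k --> \oo] --> 0.
  by rewrite -(mulr0 (1 + (Kq + 1) * (2 * K) + 2 * K)); apply: cvgM; [exact: cvg_cst|exact: a_cvg].
have pos k : 0 < (1 + (Kq + 1) * (2 * K) + 2 * K) * a_ k by rewrite mulr_gt0.
have KKq : 0 <= (Kq + 1) * 2 by rewrite mulr_ge0.
have le1 k : 2 * K * a_ k <= (1 + (Kq + 1) * (2 * K) + 2 * K) * a_ k.
  have h1 := mulr_ge0 KKq K0; have h2 := ltW (a_gt0 k); have h3 := mulr_ge0 h1 h2.
  by lra.
have le2 k : (1 + (Kq + 1) * (2 * K)) * a_ k <= (1 + (Kq + 1) * (2 * K) + 2 * K) * a_ k.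
  have h1 := mulr_ge0 K0 (ltW (a_gt0 k)); by lra.
have ka k : 0 <= 2 * K * a_ k by apply: mulr_ge0; [rewrite mulr_ge0|exact: ltW].
have kb k : 0 <= (1 + (Kq + 1) * (2 * K)) * a_ k.
  by have h1 := mulr_ge0 KKq K0; have h2 := ltW (a_gt0 k); have h3 := mulr_ge0 h1 h2; lra.
have pL := L2le_locint pe; have p1L := L2le_locint p1e; have bL := L2le_locint be.
have wd1 : weak_derivative p p1.
  apply: (@weak_derivative_lim _ (fun k => (S k).1.1) (fun k => (S k).1.2) _ _ _ _ pL p1L pos Mcvg) => k.
  - by have [] := hInv k.
  - exact: (L2leW (ka k) (le1 k)).
  - exact: (L2leW (ka k) (le1 k)).
have wd2 : weak_derivative p1 (fun x => b x (p x)).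
  apply: (@weak_derivative_lim _ (fun k => (S k).1.2) (fun k => (S k).2) _ _ _ _ p1L bL pos Mcvg) => k.
  - by have [] := hInv k.
  - exact: (L2leW (ka k) (le1 k)).
  - exact: (L2leW (kb k) (le2 k)).
have H : H2le p p1 (fun x => b x (p x)) ((2 * K + 1 + (Kq + 1) * (2 * K)) * e).
  have h1 : 0 <= (Kq + 1) * (2 * K * e) by exact: mulr_ge0.
  have e0' := ltW e0.
  split=> //.
  - by apply: L2leW pe => //; lra.
  - by apply: L2leW p1e => //; lra.
  - by apply: L2leW be; lra.
have [u [u1 [pu p1u1 u1c uu1 [_ Hu]]]] := H2le_rep hs H.
exists u, u1; split=> //.
have mu : measurable_fun setT u by case: Hu => _ _ [].
have mu1 := continuous_measurable u1c.
apply: H2le_ae Hu => //; [exact: mb|exact: leb_aeW|exact: leb_aeW|].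
by apply: leb_aeS pu => x h xT; rewrite h.
Qed.

End Solve.

(** Coercivity of q_j is applied to th_j u. Replacing q by q_j costs eps N and the commutator costs
    3 d M, where N is the L2 norm of u and M bounds its H2 norm. Summed over the cells this reads N
    <= N/2 + 7 n C a, whence the constant 14. *)
Lemma glue_coercive q : (forall j, coercive (q_ j) C) -> measurable_fun setT q ->
  (forall x j, j \in r -> th j x != 0 -> `|q x - q_ j x| <= eps) ->
  coercive q (14 * n * C).
Proof.
move=> qC mQ qq w w1 w2 a c a0 H Lg.
have [u [u1 [wu w1u1 u1c uu1 [u1w2 Hu]]]] := H2le_rep hs H.
have mu : measurable_fun setT u by case: Hu => _ _ [].
have mw2 : measurable_fun setT w2 by case: H => _ _ _ _ [].
suff : L2le u (14 * n * C * a).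
  apply: L2le_ae; first by case: H => _ _ [].
  by apply: leb_aeS wu => x h xT; rewrite h.
have Lg' : L2le (fun x => q x * u x - w2 x) a.
  apply: L2le_ae Lg; first by apply: measurable_funB => //; exact: measurable_funM.
  by apply: leb_aeS wu => x h xT; rewrite h.
have [ww1 ww2 uc u1c' w2c] := Hu.
(* The a priori bound c must not enter the result; the exact norm N does the absorbing. *)
have [N [N0 uN Nmin]] := L2le_min uc.
have qK1 x : `|q x| <= Kq + 1.
  have [j jr thj] := th_neq0 x; have := qq _ _ jr thj; have := qK j x.
  by have := ler_normD (q x - q_ j x) (q_ j x); rewrite subrK; move: eps1 => h0 h1 h2 h3; lra.
have Kq1 : 0 <= Kq + 1 by rewrite addr_ge0.
have KN : 0 <= (Kq + 1) * N by rewrite mulr_ge0.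
have w2N : L2le w2 ((Kq + 1) * N + a).
  rewrite (_ : w2 = (fun x => q x * u x - (q x * u x - w2 x))); last by apply/funext => x; rewrite subKr.
  by apply: L2leB => //; exact: L2leM.
have u1N := L2le_interpolation N0 (addr_ge0 KN a0) u1c uu1 u1w2 uN u1c' w2N.
(* Interpolation gives u1 the bound 3 N + 2 ((Kq + 1) N + a) = (5 + 2 Kq) N + 2 a; M dominates this
   as well as the bounds of u and w2. *)
pose M := (6 + 2 * Kq) * N + 2 * a.
have KqN : 0 <= Kq * N by rewrite mulr_ge0.
have M0 : 0 <= M by rewrite /M; lra.
have HM : H2le u u1 w2 M.
  split=> //.
  - by apply: L2leW uN => //; rewrite /M; lra.
  - by apply: L2leW u1N; rewrite ?/M; lra.
  - by apply: L2leW w2N; rewrite ?/M; lra.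
have dM0 : 0 <= 3 * d * M by rewrite !mulr_ge0.
have eN0 : 0 <= eps * N by exact: mulr_ge0.
pose B := eps * N + a + 3 * d * M.
have B0 : 0 <= B by rewrite !addr_ge0.
have thu j : j \in r -> L2le (fun x => th j x * u x) (C * B).
  move=> jr; have [Hj Ej] := H2leM (@ths j) M0 d0 (@th1 j) (@th'd j) (@th''d j) HM.
  apply: (qC j _ _ _ _ _ B0 Hj).
  set E := (fun x => 2 * derive1 (th j) x * u1 x + derive1 (derive1 (th j)) x * u x) in Ej *.
  rewrite (_ : (fun x => q_ j x * (th j x * u x) - _) = (fun x => (th j x * (q_ j x - q x)) * u x + th j x * (q x * u x - w2 x) - E x)); last first.
    by apply/funext => x; rewrite /E; ring.
  apply: L2leB => //; first exact: addr_ge0.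
  apply: L2leD => //.
    apply: L2leM => //; first by apply: measurable_funM => //; exact: measurable_funB.
    move=> x; have [->|thj] := eqVneq (th j x) 0; first by rewrite mul0r normr0.
    by rewrite normrM -[leRHS]mul1r distrC; apply: ler_pM => //; exact: qq.
  by rewrite -[a]mul1r; apply: L2leM.
have CB : 0 <= C * B by rewrite mulr_ge0// ltW.
have uE : L2le u (n * (C * B)).
  (* [L2le_sum] asks for bounds at all indices, whereas [thu] holds only for j in r. *)
  rewrite (_ : u = fun x => \sum_(j <- r) (if j \in r then (\1_(A j) x : R) * (th j x * u x) else 0)); last first.
    apply/funext => x; rewrite -[LHS]mul1r -(thA x) big_distrl/= big_seq [RHS]big_seq.
    by apply: eq_bigr => j ->; rewrite mulrA (mulrC (\1_ _ _)).
  rewrite -sum_const_iter; apply: (L2le_sum _ (fun _ => CB)) => j.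
  have [jr|jr] := boolP (j \in r); last exact: L2le0.
  rewrite -[C * B]mul1r; apply: L2leM => //; last exact: thu.
  by move=> x; rewrite indicE ger0_norm//; case: (x \in A j).
have h1 := Nmin _ (mulr_ge0 n0 CB) uE.
apply: L2leW uN => //.
have nCa : 0 <= n * C * a by rewrite !mulr_ge0// ltW.
have nCda : n * C * a * d <= n * C * a by rewrite ler_piMr.
have h2 := ler_wpM2r N0 small.
have E1 : n * (C * B) = n * C * (eps + 3 * d * (6 + 2 * Kq)) * N + n * C * a + 6 * (n * C * a * d).
  by rewrite /B /M; ring.
have E2 : 14 * n * C * a = 14 * (n * C * a) by ring.
rewrite E2; move: h1 h2 nCa nCda; rewrite E1.
move: (n * C * (eps + 3 * d * (6 + 2 * Kq)) * N) (n * C * a) (n * C * a * d) => X Y Z *; lra.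
Qed.

End Gluing.
End Operators.

(** * The linearized Gross-Pitaevskii operator *)

Section Linearization.
Context {R : realType}.
Implicit Types (f g h m s u v q w V psi : R -> R) (omega mu C : R).
Notation leb := (@lebesgue_measure R).
Notation locint := (@locally_integrable R setT).

Definition GP_potential omega V mu psi (x : R) := mu * V x + omega + 3 * psi x ^+ 2.

Lemma GP_linearizationE s omega V mu psi w w1 w2 b : smooth_step s -> H2le w w1 w2 b ->
  GP_linearization omega V mu psi w =
    (fun x => GP_potential omega V mu psi x * w x - w2 x) %[ae leb].
Proof.
move=> hs H; have [_ e2 _] := H2le_wderiv hs H.
apply: leb_aeS e2 => x h _; rewrite /GP_linearization -h// /GP_potential; ring.
Qed.

Lemma H2le_meas w w1 w2 b : H2le w w1 w2 b ->
  [/\ measurable_fun setT w, measurable_fun setT w1 & measurable_fun setT w2].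
Proof. by move=> [_ _ [? _] [? _] [? _]]. Qed.

Lemma GP_linearization_meas omega V mu psi w w1 w2 b s : smooth_step s ->
  measurable_fun setT V -> measurable_fun setT psi -> H2le w w1 w2 b ->
  measurable_fun setT (GP_linearization omega V mu psi w).
Proof.
move=> hs mV mpsi H; have [_ _ H'] := H2le_wderiv hs H.
have [mw _ mw2] := H2le_meas H'.
apply: measurable_funD; last first.
  by apply: measurable_funM => //; apply: measurable_funM => //; exact: measurable_funX.
apply: measurable_funD; last exact: measurable_funM.
apply: measurable_funD; first exact: measurable_funN.
by apply: measurable_funM => //; exact: measurable_funM.
Qed.

Lemma L2norm_leM w v C : 0 <= C -> L2 v ->
  (forall a, 0 <= a -> L2le v a -> exists2 c, c <= C * a & 0 <= c /\ L2le w c) ->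
  (L2norm w <= C%:E * L2norm v)%E.
Proof.
move=> C0 /L2P[a a0 va] H; have [N [N0 vN Nmin]] := L2le_min va.
have -> : L2norm v = N%:E.
  apply/le_anti; rewrite L2norm_le//=.
  have nv0 : (0 <= L2norm v)%E by rewrite L2normE poweR_ge0.
  have nvf : L2norm v \is a fin_num.
    rewrite ge0_fin_numE//; apply: le_lt_trans (L2norm_le a0 va) _; exact: ltry.
  rewrite -(fineK nvf) lee_fin; apply: Nmin; first exact: fine_ge0.
  by apply: L2le_norm; [exact: fine_ge0|case: va|rewrite fineK].
have [c cN [c0 wc]] := H _ N0 vN.
by apply: le_trans (L2norm_le c0 wc) _; rewrite -EFinM lee_fin.
Qed.

(** The bounded inverse controls w in L2 only. The equation then bounds w'' and interpolation bounds
    w', which gives the H2 estimate that [solvable] demands. *)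
Lemma invertible_solvable s omega V mu psi Kq : smooth_step s ->
  measurable_fun setT V -> measurable_fun setT psi -> 0 <= Kq ->
  (forall x, `|GP_potential omega V mu psi x| <= Kq) ->
  invertible_on_L2 H2 (GP_linearization omega V mu psi) ->
  exists2 C, 0 < C & solvable (GP_potential omega V mu psi) C /\
    coercive (GP_potential omega V mu psi) C.
Proof.
move=> hs mV mpsi Kq0 qK [surj _ [C0 hC0]].
set q := GP_potential omega V mu psi in qK *.
have mq : measurable_fun setT q.
  apply: measurable_funD; first by apply: measurable_funD => //; exact: measurable_funM.
  by apply: measurable_funM => //; exact: measurable_funX.
(* The constant C0 comes without a sign. *)
pose C1 := `|C0| + 1.
have C10 : 0 < C1 by rewrite ltr_wpDl.
have coer : coercive q C1.
  move=> w w1 w2 a b a0 H L.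
  have E := GP_linearizationE omega V mu psi hs H.
  have mA := GP_linearization_meas omega mu hs mV mpsi H.
  have LA : L2le (GP_linearization omega V mu psi w) a.
    by apply: L2le_ae L => //; apply: leb_aeS E => x h xT; rewrite h.
  have [mw _ _] := H2le_meas H.
  have Hw : H2 w.
    have [w1' w2' wb w1b w2b] := H; apply/H2P; exists w1, w2, `|b|; split=> //.
    by split=> //; [apply: L2le_weaken wb|apply: L2le_weaken w1b|apply: L2le_weaken w2b];
      rewrite real_normK// num_real.
  have C1a : 0 <= C1 * a by rewrite mulr_ge0// ltW.
  apply: L2le_norm => //; apply: le_trans (hC0 _ Hw) _.
  have nA := L2norm_le a0 LA.
  have nA0 : (0 <= L2norm (GP_linearization omega V mu psi w))%E by rewrite L2normE poweR_ge0.
  apply: (@le_trans _ _ (C1%:E * L2norm (GP_linearization omega V mu psi w))%E).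
    apply: lee_wpmul2r => //; rewrite lee_fin /C1.
    by have := ler_norm C0; lra.
  by rewrite EFinM; apply: lee_wpmul2l => //; rewrite lee_fin ltW.
(* Interpolation from C1 a and Kq C1 a + a gives (3 C1 + 2 Kq C1 + 2) a; this C also exceeds the
   other two bounds. *)
pose C := 5 * C1 + 2 * Kq * C1 + 2.
have KqC : 0 <= Kq * C1 by rewrite mulr_ge0// ltW.
have CC : C1 <= C by rewrite /C; lra.
have C_gt0 : 0 < C by exact: lt_le_trans CC.
exists C => //; split; last first.
  move=> w w1 w2 a b a0 H L; apply: L2leW (coer _ _ _ _ _ a0 H L).
    by rewrite mulr_ge0// ltW.
  exact: ler_wpM2r.
move=> f a a0 fa.
have [w Hw Aw] := surj f (ssrfun.svalP (exist _ _ ((L2P f).2 (ex_intro2 _ _ a a0 fa)))).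
have [w1 [w2 [b [b0 H]]]] := (H2P w).1 Hw.
have E := GP_linearizationE omega V mu psi hs H.
have [mw mw1 mw2] := H2le_meas H.
have mf : measurable_fun setT f by case: fa.
have fE : (fun x => q x * w x - w2 x) = f %[ae leb].
  by apply: leb_aeS2 E Aw => x h1 h2 xT; rewrite -h1// h2.
have Lq : L2le (fun x => q x * w x - w2 x) a.
  apply: L2le_ae fa; first by apply: measurable_funB => //; exact: measurable_funM.
  by apply: leb_aeS fE => x h xT; rewrite h.
have wa := coer _ _ _ _ _ a0 H Lq.
have C1a : 0 <= C1 * a by rewrite mulr_ge0// ltW.
have w2a : L2le w2 (Kq * (C1 * a) + a).
  rewrite (_ : w2 = (fun x => q x * w x - (q x * w x - w2 x))); last by apply/funext => x; rewrite subKr.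
  by apply: L2leB => //; [rewrite mulr_ge0|exact: L2leM].
have KC1a : 0 <= Kq * (C1 * a) by rewrite mulr_ge0.
have [u [u1 [wu w1u1 u1c uu1 [u1w2 Hu]]]] := H2le_rep hs H.
have [mu' mu1 _] := H2le_meas Hu.
have ua : L2le u (C1 * a) by exact: L2le_ae wu wa.
have u1b : L2le u1 b by case: Hu.
have u1a := L2le_interpolation C1a (addr_ge0 KC1a a0) u1c uu1 u1w2 ua u1b w2a.
have Ca : C * a = 5 * (C1 * a) + 2 * (Kq * (C1 * a)) + 2 * a by rewrite /C; ring.
exists u, u1, w2; split; last first.
  by apply: leb_aeS2 fE wu => x h1 h2 xT; rewrite -h1// -h2// subKr.
have [uu1' u1u2' _ _ _] := Hu; rewrite Ca; split=> //.
- by apply: L2leW ua => //; lra.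
- by apply: L2leW u1a; lra.
- by apply: L2leW w2a; lra.
Qed.

(** Injectivity and the bound of the inverse both come from coercivity, so [solv] may provide
    solutions without any estimate. *)
Lemma solvable_invertible s omega V mu psi C K : smooth_step s -> 0 <= C ->
  measurable_fun setT V -> measurable_fun setT psi ->
  (forall f e, 0 < e -> L2le f e -> exists u u1 u2 c, [/\ 0 <= c,
    H2le u u1 u2 c & u2 = (fun x => GP_potential omega V mu psi x * u x - f x) %[ae leb]]) ->
  coercive (GP_potential omega V mu psi) C ->
  (forall x, `|GP_potential omega V mu psi x| <= K) ->
  invertible_on_L2 H2 (GP_linearization omega V mu psi).
Proof.
move=> hs C0 mV mpsi solv coer qK.
have K0 : 0 <= K := le_trans (normr_ge0 _) (qK 0).
have key w a : H2 w -> 0 <= a -> L2le (GP_linearization omega V mu psi w) a -> L2le w (C * a).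
  move=> /H2P[w1 [w2 [b [b0 H]]]] a0 L; apply: (coer _ _ _ _ _ a0 H).
  have [mw mw1 mw2] := H2le_meas H.
  apply: L2le_ae L; last exact: GP_linearizationE hs H.
  apply: measurable_funB => //; apply: measurable_funM => //.
  apply: measurable_funD; first by apply: measurable_funD => //; exact: measurable_funM.
  by apply: measurable_funM => //; exact: measurable_funX.
split.
(* The iteration behind [solv] starts from a strictly positive residual bound. *)
- move=> f /L2P[a a0 fa]; have a1 : 0 < a + 1 by rewrite ltr_wpDl.
  have fa1 : L2le f (a + 1) by apply: L2leW fa => //; rewrite lerDl.
  have [u [u1 [u2 [c [c0 H E]]]]] := solv _ _ a1 fa1.
  exists u; first by apply/H2P; exists u1, u2, c.
  have E' := GP_linearizationE omega V mu psi hs H.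
  by apply: leb_aeS2 E E' => x h1 h2 xT; rewrite h2// h1// subKr.
- move=> w Hw A0.
  have [mw A0'] : measurable_fun setT w /\ L2le (GP_linearization omega V mu psi w) 0.
    have /H2P[w1 [w2 [b [b0 H]]]] := Hw; split; first by case: (H2le_meas H).
    apply: (@L2le_ae _ (fun=> 0)); [exact: (GP_linearization_meas omega mu hs mV mpsi H)| |exact: L2le0].
    by apply: leb_aeS A0 => x h xT; rewrite h.
  (* Coercivity with a = 0 makes the integral of w^2 vanish. *)
  have [_] := key _ _ Hw (lexx 0) A0'; rewrite mulr0 expr0n/= => J0.
  have J0' : (\int[leb]_x `|(w x ^+ 2)%:E| = 0)%E.
    apply/le_anti; rewrite integral_ge0// andbT.
    by under eq_integral do rewrite gee0_abs ?lee_fin ?sqr_ge0//.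
  have := (ae_eq_integral_abs leb measurableT (measurable_sqr mw)).1 J0'.
  by apply: leb_aeS => x /= h xT; have := h xT => /= -[] /eqP; rewrite sqrf_eq0 => /eqP.
exists C => w Hw; apply: L2norm_leM => //.
  have /H2P[w1 [w2 [b [b0 H]]]] := Hw; apply/L2P; exists (K * b + b); first by rewrite addr_ge0// mulr_ge0.
  have [_ _ wb _ w2b] := H; have [mw mw1 mw2] := H2le_meas H.
  apply: (@L2le_ae _ (fun x => GP_potential omega V mu psi x * w x - w2 x)).
  - exact: (GP_linearization_meas omega mu hs mV mpsi H).
  - by apply: leb_aeS (GP_linearizationE omega V mu psi hs H) => x h xT; rewrite h.
  apply: L2leB => //; first by rewrite mulr_ge0.
  apply: L2leM => //.
  apply: measurable_funD; first by apply: measurable_funD => //; exact: measurable_funM.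
  by apply: measurable_funM => //; exact: measurable_funX.
move=> a a0 La; exists (C * a) => //; split; first by rewrite mulr_ge0.
exact: key.
Qed.

Lemma periodic_bounded f (T : R) : 0 < T -> continuous f -> periodic f T ->
  exists2 K, 0 <= K & forall x, `|f x| <= K.
Proof.
move=> T0 fc fT.
have fTn (n : nat) x : f (x + n%:R * T) = f x.
  elim: n x => [|n ih] x; first by rewrite mul0r addr0.
  by rewrite -natr1 mulrDl mul1r addrA fT.
have fTz (z : int) x : f (x + z%:~R * T) = f x.
  case: z => n; first exact: fTn.
  by rewrite NegzE mulrNz mulNr -(fTn n.+1 (x + _)) subrK.
have [K hK] := continuous_bounded_itv 0 T fc.
have K0 : 0 <= K by apply: le_trans (normr_ge0 _) (hK 0 _); rewrite lexx ltW.
exists K => // x; pose z := Num.floor (x / T).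
rewrite -(fTz (- z) x); apply: hK; rewrite mulrNz mulNr.
have /andP[h1 /ltW h2] := floor_itv (x / T).
move: h1 h2; rewrite -/z intrD ler_pdivlMr// ler_pdivrMr// => h1 h2.
by apply/andP; split; lra.
Qed.

Lemma periodic_shift f (T : R) (m n : nat) x : periodic f T ->
  f (x - m%:R * n%:R * T) = f x.
Proof.
move=> fT; have fTn (k : nat) y : f (y + k%:R * T) = f y.
  elim: k y => [|k ih] y; first by rewrite mul0r addr0.
  by rewrite -natr1 mulrDl mul1r addrA fT.
by rewrite -(fTn (m * n)%N (x - _)) natrM subrK.
Qed.

(** The primitive of a continuous g is classically differentiable, and agrees with f up to a
    constant almost everywhere, hence everywhere. *)
Lemma weak_has_deriv s f g : smooth_step s -> weak_derivative f g ->
  continuous f -> continuous g -> has_deriv f g.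
Proof.
move=> hs fg fc gc; have [c E] := weak_derivative_rep hs fg.
have h : has_deriv (fun x => c + primitive g x) g.
  have := has_derivD (has_deriv_cst c) (primitive_has_deriv gc).
  by move=> h x; have := h x; rewrite add0r.
by rewrite (ae_eq_continuous fc (has_deriv_continuous h) E).
Qed.

(* A sequence that is good at every fixed tolerance for large n can be chosen once
   and for all, by letting the tolerance shrink with n. *)
Lemma diagonal_choice (U : choiceType) (u0 : U) (P : nat -> U -> R -> Prop) (e1 : R) : 0 < e1 ->
  (forall e, 0 < e -> e <= e1 -> exists N : nat, forall n, (N <= n)%N -> exists u : U, P n u e) ->
  exists (u : nat -> U) (N : nat),
    (forall n, (N <= n)%N -> exists2 e, 0 < e <= e1 & P n (u n) e) /\
    forall e, 0 < e -> exists N : nat, forall n, (N <= n)%N ->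
      exists2 e', 0 < e' <= e1 /\ e' <= e & P n (u n) e'.
Proof.
move=> e10 H; pose t (k : nat) := e1 / k.+1%:R.
have t0 k : 0 < t k by rewrite divr_gt0.
have t1 k : t k <= e1 by rewrite ler_pdivrMr// ler_peMr ?ler1n//; exact: ltW.
have tle k k' : (k <= k')%N -> t k' <= t k.
  by move=> kk; rewrite ler_pM2l// lef_pV2 ?posrE// ler_nat.
(* The cap k <= n guarantees a largest admissible k, that is, a finest tolerance available for n. *)
pose Q n k := `[< exists u : U, P n u (t k) >] && (k <= n)%N.
have good n k0 : Q n k0 -> exists (u : U) k, P n u (t k) /\ forall k', Q n k' -> (k' <= k)%N.
  move=> q0; have ub k : Q n k -> (k <= n)%N by case/andP.
  have [k /andP[/asboolP[u Pu] _] kmax] := ex_maxnP (ex_intro _ k0 q0) ub.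
  by exists u, k.
have : forall n, exists u : U, (exists k0, Q n k0) ->
    exists k, P n u (t k) /\ forall k', Q n k' -> (k' <= k)%N.
  move=> n; have [[k0 q0]|h] := pselect (exists k0, Q n k0); last by exists u0.
  by have [u [k hk]] := good _ _ q0; exists u => _; exists k.
move=> /choice[u hu].
have big k : exists N : nat, forall n, (N <= n)%N -> Q n k.
  have [N hN] := H _ (t0 k) (t1 k); exists (maxn N k) => n; rewrite geq_max => /andP[Nn kn].
  by rewrite /Q kn andbT; apply/asboolP; exact: hN.
exists u; have [N hN] := big 0%N; exists N; split.
  move=> n /hN q0; have [|k [Pk _]] := hu n; first by exists 0%N.
  by exists (t k) => //; rewrite t0 t1.
(* This k gives t k <= e. For large n the index selected is at least k, and t decreases. *)
move=> e e0; pose k := Num.Def.truncn (e1 / e).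
have tke : t k <= e.
  rewrite /t ler_pdivrMr// mulrC -ler_pdivrMr//; apply/ltW.
  by rewrite truncnS_gt.
have [N' hN'] := big k; exists N' => n /hN' qk.
have [|k' [Pk' km]] := hu n; first by exists k.
exists (t k') => //; rewrite t0 t1; split=> //.
by apply: le_trans tke; apply: tle; exact: km.
Qed.

End Linearization.

(** * Plateaus and cells *)

Section Partition.
Context {R : realType}.
Implicit Types (f g h m s u v q w : R -> R) (i j M : nat) (L x : R).
Notation leb := (@lebesgue_measure R).

Lemma smooth_step_derive2_bounded s : smooth_step s ->
  exists2 B, 0 <= B & forall x, `|derive1 (derive1 s) x| <= B.
Proof.
move=> hs; have [ss _ s0 s1] := hs.
have [B hB] := continuous_bounded_itv (-1) 1
  (smooth_continuous (smooth_derive1 (smooth_derive1 ss))).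
have B0 : 0 <= B by apply: le_trans (hB 0 _); rewrite ?normr_ge0//; lra.
exists B => // x; have [/hB//|x1] := boolP (-1 <= x <= 1).
rewrite (_ : derive1 (derive1 s) x = 0) ?normr0//.
apply: (@near_has_deriv_eq0 _ (derive1 s)) (smooth_has_deriv (smooth_derive1 ss)).
have [x0|x0] : x < -1 \/ 1 < x by move: x1; rewrite negb_and -!ltNge => /orP[]; auto.
- have : \forall y \near x, y < -1 by exact: lt_nbhsl.
  apply: filterS => y y1; have := @step_scale_vanishes _ s 1 0 y hs.
  by rewrite !mul1r sub0r subr0; apply; lra.
- have : \forall y \near x, 1 < y by exact: lt_nbhsr.
  apply: filterS => y y1; have := @step_scale_vanishes_r _ s 1 0 y hs.
  by rewrite subr0 mul1r; apply; lra.
Qed.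

(** Centre 5/8 and scale 8/L make the ramp rise exactly between (i - 3/4) L and (i - 1/2) L: it is 1
    on the i-th cell and overlaps only a quarter period of the neighbour. The first plateau has no
    left ramp, the last no right one. *)
Definition ramp_left s L i : R -> R :=
  if (i <= 1)%N then fun=> 1 else fun x => s (8 / L * (x - (i%:R - 5 / 8) * L)).
Definition ramp_right s L M i : R -> R :=
  if (M <= i)%N then fun=> 1 else fun x => 1 - s (8 / L * (x - (i%:R + 5 / 8) * L)).
Definition plateau s L M i x := ramp_left s L i x * ramp_right s L M i x.

(** Decreasing half-lines, from the whole line at i = 1 to the empty set past M, so that indicators
    of cells telescope. The first and the last cell are unbounded. *)
Definition right_part L M i : set R :=
  if (i <= 1)%N then setT else
  if (i <= M)%N then `](i%:R - 1 / 2) * L, +oo[%classic else set0.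
Definition cell L M i := right_part L M i `\` right_part L M i.+1.

Lemma measurable_cell L M i : measurable (cell L M i).
Proof.
have h k : measurable (right_part L M k).
  by rewrite /right_part; case: ifP => // _; case: ifP.
exact: measurableD.
Qed.

Lemma ramp_bounds s L c B B2 x : smooth_step s -> 8 <= L ->
  (forall x, `|derive1 s x| <= B) -> (forall x, `|derive1 (derive1 s) x| <= B2) ->
  has_deriv (fun x => s (8 / L * (x - c))) (fun x => 8 / L * derive1 s (8 / L * (x - c))) /\
  has_deriv (fun x => 8 / L * derive1 s (8 / L * (x - c)))
    (fun x => 8 / L * (8 / L * derive1 (derive1 s) (8 / L * (x - c)))) /\
  `|8 / L * derive1 s (8 / L * (x - c))| <= 8 / L * (B + B2) /\
  `|8 / L * (8 / L * derive1 (derive1 s) (8 / L * (x - c)))| <= 8 / L * (B + B2).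
Proof.
move=> [ss _ _ _] L8 hB hB2; have L0 : 0 < L by lra.
have k0 : 0 <= 8 / L by rewrite divr_ge0// ltW.
have k1 : 8 / L <= 1 by rewrite ler_pdivrMr// mul1r.
have B0 := le_trans (normr_ge0 _) (hB 0); have B20 := le_trans (normr_ge0 _) (hB2 0).
split; first exact: has_deriv_step_scale.
split; first by apply: has_derivZ; apply: has_deriv_step_scale; exact: smooth_derive1.
split.
  rewrite normrM (ger0_norm k0) ler_wpM2l//; apply: le_trans (hB _) _.
  by rewrite lerDl.
rewrite normrM (ger0_norm k0) ler_wpM2l// normrM (ger0_norm k0).
apply: le_trans (ler_piMl (normr_ge0 _) k1) _; apply: le_trans (hB2 _) _.
by rewrite lerDr.
Qed.

Lemma ramp_leftP s L i B B2 : smooth_step s -> 8 <= L ->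
  (forall x, `|derive1 s x| <= B) -> (forall x, `|derive1 (derive1 s) x| <= B2) ->
  [/\ smooth (ramp_left s L i), forall x, 0 <= ramp_left s L i x <= 1,
   forall x, `|derive1 (ramp_left s L i) x| <= 8 / L * (B + B2) &
   forall x, `|derive1 (derive1 (ramp_left s L i)) x| <= 8 / L * (B + B2)].
Proof.
move=> hs L8 hB hB2; have [ss s01 _ _] := hs; have L0 : 0 < L by lra.
have B0 := le_trans (normr_ge0 _) (hB 0); have B20 := le_trans (normr_ge0 _) (hB2 0).
have k0 : 0 <= 8 / L * (B + B2) by rewrite mulr_ge0// ?addr_ge0// divr_ge0// ltW.
rewrite /ramp_left; case: ifP => _.
  rewrite (has_derivE (has_deriv_cst 1)) (has_derivE (has_deriv_cst 0)).
  split=> [|x|x|x]; [exact: smooth_cst|by rewrite ler01 lexx|by rewrite normr0|by rewrite normr0].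
have [h1 [h2 _]] := ramp_bounds ((i%:R - 5 / 8) * L) 0 hs L8 hB hB2.
rewrite (has_derivE h1) (has_derivE h2); split=> [|x|x|x].
- exact: smooth_step_scale.
- exact: s01.
- by have [_ [_ []]] := ramp_bounds ((i%:R - 5 / 8) * L) x hs L8 hB hB2.
- by have [_ [_ []]] := ramp_bounds ((i%:R - 5 / 8) * L) x hs L8 hB hB2.
Qed.

Lemma ramp_rightP s L M i B B2 : smooth_step s -> 8 <= L ->
  (forall x, `|derive1 s x| <= B) -> (forall x, `|derive1 (derive1 s) x| <= B2) ->
  [/\ smooth (ramp_right s L M i), forall x, 0 <= ramp_right s L M i x <= 1,
   forall x, `|derive1 (ramp_right s L M i) x| <= 8 / L * (B + B2) &
   forall x, `|derive1 (derive1 (ramp_right s L M i)) x| <= 8 / L * (B + B2)].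
Proof.
move=> hs L8 hB hB2; have [ss s01 _ _] := hs; have L0 : 0 < L by lra.
have B0 := le_trans (normr_ge0 _) (hB 0); have B20 := le_trans (normr_ge0 _) (hB2 0).
have k0 : 0 <= 8 / L * (B + B2) by rewrite mulr_ge0// ?addr_ge0// divr_ge0// ltW.
rewrite /ramp_right; case: ifP => _.
  rewrite (has_derivE (has_deriv_cst 1)) (has_derivE (has_deriv_cst 0)).
  split=> [|x|x|x]; [exact: smooth_cst|by rewrite ler01 lexx|by rewrite normr0|by rewrite normr0].
have [h1 [h2 _]] := ramp_bounds ((i%:R + 5 / 8) * L) 0 hs L8 hB hB2.
rewrite (has_derivE (has_derivB (has_deriv_cst 1) h1)).
rewrite (has_derivE (has_derivB (has_deriv_cst 0) h2)); split=> [|x|x|x].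
- by apply: smoothB; [exact: smooth_cst|exact: smooth_step_scale].
- by have := s01 (8 / L * (x - (i%:R + 5 / 8) * L)); lra.
- by rewrite sub0r normrN; have [_ [_ []]] := ramp_bounds ((i%:R + 5 / 8) * L) x hs L8 hB hB2.
- by rewrite sub0r normrN; have [_ [_ []]] := ramp_bounds ((i%:R + 5 / 8) * L) x hs L8 hB hB2.
Qed.

Lemma plateauP s : smooth_step s -> exists2 B, 0 <= B & forall L M i, 8 <= L ->
  8 / L * B <= 1 ->
  [/\ smooth (plateau s L M i), forall x, `|plateau s L M i x| <= 1,
   forall x, `|derive1 (plateau s L M i) x| <= 8 / L * B &
   forall x, `|derive1 (derive1 (plateau s L M i)) x| <= 8 / L * B].
Proof.
move=> hs; have [B1 B10 hB] := smooth_step_derive1_bounded hs.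
have [B2 B20 hB2] := smooth_step_derive2_bounded hs.
(* The second derivative of a product is at most D + 2 D^2 + D with D the bound for one ramp, and 4
   D <= 1 gives D^2 <= D. *)
exists (4 * (B1 + B2)) => [|L M i L8 k1]; first by rewrite mulr_ge0// addr_ge0.
have [ls l1 l' l''] := ramp_leftP i hs L8 hB hB2.
have [rs r1 r' r''] := ramp_rightP M i hs L8 hB hB2.
set l := ramp_left s L i in ls l1 l' l''; set r := ramp_right s L M i in rs r1 r' r''.
have L0 : 0 < L by lra.
set D := 8 / L * (B1 + B2) in l' l'' r' r''.
have D0 : 0 <= D by rewrite mulr_ge0// ?addr_ge0// divr_ge0// ltW.
have DE : 8 / L * (4 * (B1 + B2)) = 4 * D by rewrite /D mulrCA.
rewrite DE in k1 *.
have ln x : `|l x| <= 1 by rewrite ler_norml; have := l1 x; lra.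
have rn x : `|r x| <= 1 by rewrite ler_norml; have := r1 x; lra.
have h1 := has_derivM (smooth_has_deriv ls) (smooth_has_deriv rs).
have h2 := has_derivD (has_derivM (smooth_has_deriv (smooth_derive1 ls)) (smooth_has_deriv rs))
  (has_derivM (smooth_has_deriv ls) (smooth_has_deriv (smooth_derive1 rs))).
have pM (a b c d : R) : `|a| <= c -> `|b| <= d -> `|a * b| <= c * d.
  by move=> ac bd; rewrite normrM ler_pM.
rewrite /plateau -/l -/r (has_derivE h1) (has_derivE h2); split=> [|x|x|x].
- exact: smoothM.
- by rewrite -[1]mul1r; exact: pM.
- apply: le_trans (ler_normD _ _) _.
  by have := pM _ _ _ _ (l' x) (rn x); have := pM _ _ _ _ (ln x) (r' x); lra.
- have DD : D * D <= D by rewrite ler_piMr//; lra.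
  have := pM _ _ _ _ (l'' x) (rn x); have := pM _ _ _ _ (ln x) (r'' x).
  have := pM _ _ _ _ (l' x) (r' x).
  move: (derive1 l x) (derive1 r x) (derive1 (derive1 l) x) (derive1 (derive1 r) x) => a b c d.
  move: (l x) (r x) => e g h3 h4 h5.
  apply: le_trans (ler_normD _ _) _.
  by have := ler_normD (c * g) (a * b); have := ler_normD (a * b) (e * d); lra.
Qed.

Lemma plateau_cell s L M i x : smooth_step s -> 0 < L -> (1 <= i <= M)%N ->
  cell L M i x -> plateau s L M i x = 1.
Proof.
move=> [_ _ s0 s1] L0 /andP[i1 iM] [xi nxi].
have k (t : R) : 8 / L * (t * L) = 8 * t by field; rewrite gt_eqF.
have k0 : 0 < 8 / L by rewrite divr_gt0.
rewrite /plateau (_ : ramp_left s L i x = 1) ?mul1r; last first.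
  move: xi; rewrite /right_part /ramp_left; case: ifP => // _; rewrite iM /= in_itv/= andbT.
  move=> h; apply: s1; have : 8 / L * ((i%:R - 1 / 2) * L) < 8 / L * x by rewrite ltr_pM2l.
  by rewrite mulrBr !k; lra.
rewrite /ramp_right; case: ifP => // /negbT; rewrite -ltnNge => iM'.
rewrite s0 ?subr0//; move: nxi; rewrite /right_part ltnNge i1 /= iM' /= in_itv/= andbT => /negP.
rewrite -leNgt -natr1 => h.
have : 8 / L * x <= 8 / L * ((i%:R + 1 - 1 / 2) * L) by rewrite ler_pM2l.
by rewrite mulrBr !k; lra.
Qed.

Lemma plateau_neq0 s L M i x : smooth_step s -> 0 < L -> plateau s L M i x != 0 ->
  ((1 < i)%N -> (i%:R - 3 / 4) * L < x) /\ ((i < M)%N -> x < (i%:R + 3 / 4) * L).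
Proof.
move=> [_ _ s0 s1] L0; rewrite /plateau mulf_eq0 negb_or => /andP[].
have k (t : R) : 8 / L * (t * L) = 8 * t by field; rewrite gt_eqF.
have k0 : 0 < 8 / L by rewrite divr_gt0.
move=> l0 r0; split=> hi; rewrite ltNge; apply/negP => h.
- move: l0; rewrite /ramp_left leqNgt hi /= s0 ?eqxx//.
  have : 8 / L * x <= 8 / L * ((i%:R - 3 / 4) * L) by rewrite ler_pM2l.
  by rewrite mulrBr !k; lra.
- move: r0; rewrite /ramp_right leqNgt hi /= s1 ?subrr ?eqxx//.
  have : 8 / L * ((i%:R + 3 / 4) * L) <= 8 / L * x by rewrite ler_pM2l.
  by rewrite mulrBr !k; lra.
Qed.

(** Each plateau is 1 on its cell, so the sum is that of the cell indicators, which telescopes. *)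
Lemma plateau_sum s L M x : smooth_step s -> 0 < L -> (0 < M)%N ->
  \sum_(i <- index_iota 1 M.+1) plateau s L M i x * \1_(cell L M i) x = 1.
Proof.
move=> hs L0 M0; rewrite -(opprK 1).
have sub i : right_part L M i.+1 `<=` right_part L M i.
  rewrite /right_part; have [//|i1] := boolP (i <= 1)%N.
  have -> : (i.+1 <= 1)%N = false by apply/negbTE; move: i1; rewrite -!ltnNge => /ltnW.
  case: ifP => [iM|_ //]; rewrite (ltnW iM) => y /=; rewrite !in_itv/= !andbT -natr1 => h.
  by apply: le_lt_trans h; rewrite ler_pM2r//; lra.
rewrite (_ : - 1 = \1_(right_part L M M.+1) x - \1_(right_part L M 1) x); last first.
  have -> : right_part L M M.+1 = set0 by rewrite /right_part ltnn leqNgt ltnS M0.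
  have -> : right_part L M 1 = setT by [].
  by rewrite !indicE in_set0 in_setT sub0r.
rewrite -(@telescope_sumr _ 1 M.+1 (fun i => \1_(right_part L M i) x))// -sumrN.
apply: eq_big_nat => i; rewrite ltnS => iM.
rewrite opprB; have [xc|nxc] := pselect (cell L M i x).
  rewrite plateau_cell// mul1r; case: (xc) => h1 h2.
  by rewrite !indicE (mem_set xc) (mem_set h1) (memNset h2) subr0.
rewrite [in LHS]indicE (memNset nxc) mulr0.
have [h2|h2] := pselect (right_part L M i.+1 x).
  by rewrite !indicE (mem_set h2) (mem_set (sub _ _ h2)) subrr.
have h1 : ~ right_part L M i x by move=> h; exact: nxc.
by rewrite !indicE (memNset h1) (memNset h2) subrr.
Qed.

(* [cutoff_window], uniformly in [1 <= j <= M] and including [M = 1]. *)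
Definition window L M j x :=
  ((1 < j)%N -> (j%:R - 1 / 2) * L - 1 < x) /\
  ((j < M)%N -> x < (j%:R + 1 / 2) * L + 1).

(** Where plateau i meets window j with j distinct from i, the indices are adjacent and x is at
    distance at least A from both centres, on the side facing the other front. Both functions are
    then near the shared end state. F, vm and vp are arbitrary so that derivatives are covered
    too. *)
Lemma chain_close L M A eps (F vm vp : nat -> R -> R) i j x :
  (1 <= i <= M)%N -> (1 <= j <= M)%N -> A + 1 <= L / 4 -> 0 <= A -> 0 <= eps ->
  (forall k, (1 <= k <= M)%N -> A <= x - k%:R * L -> `|F k x - vp k x| <= eps) ->
  (forall k, (1 <= k <= M)%N -> x - k%:R * L <= - A -> `|F k x - vm k x| <= eps) ->
  (forall k, (1 <= k < M)%N -> vp k x = vm k.+1 x) ->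
  ((1 < i)%N -> (i%:R - 3 / 4) * L < x) -> ((i < M)%N -> x < (i%:R + 3 / 4) * L) ->
  window L M j x -> `|F j x - F i x| <= 2 * eps.
Proof.
move=> iM jM AL A0 e0 hp hm match_ il ir [jl jr].
have L0 : 0 < L by lra.
have [i1 i2] := andP iM; have [j1 j2] := andP jM.
have tri (a b c : R) : `|a - c| <= eps -> `|b - c| <= eps -> `|a - b| <= 2 * eps.
  move=> h1 h2; have := ler_normB (a - c) (b - c).
  by rewrite (_ : a - c - (b - c) = a - b); [lra|ring].
have [ij|ij|->] := ltngtP i j; last by rewrite subrr normr0 mulr_ge0.
- have iM' : (i < M)%N by exact: leq_trans j2.
  have h1 := ir iM'; have h2 := jl (leq_ltn_trans i1 ij).
  have jE : j = i.+1.
    apply/eqP; rewrite eqn_leq ij andbT -ltnS -(ltr_nat R) -!natr1.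
    by rewrite -(ltr_pM2r L0); move: h1 h2; rewrite !mulrDl !mulNr; lra.
  rewrite jE in h2 jM *; move: h2; rewrite -natr1 => h2.
  apply: (tri _ _ (vp i x)); last by apply: hp => //; lra.
  by rewrite match_ ?i1//; apply: hm => //; rewrite -natr1; lra.
- have jM' : (j < M)%N by exact: leq_trans i2.
  have h1 := jr jM'; have h2 := il (leq_ltn_trans j1 ij).
  have iE : i = j.+1.
    apply/eqP; rewrite eqn_leq ij andbT -ltnS -(ltr_nat R) -!natr1.
    by rewrite -(ltr_pM2r L0); move: h1 h2; rewrite !mulrDl !mulNr; lra.
  rewrite iE in h2 iM *; move: h2; rewrite -natr1 => h2.
  apply: (tri _ _ (vp j x)); first by apply: hp => //; lra.
  by rewrite match_ ?j1//; apply: hm => //; rewrite -natr1; lra.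
Qed.

End Partition.

(** * Decay of fronts and the residual of the glued profile *)

Section Residual.
Context {R : realType}.
Implicit Types (f g h m s u v q w : R -> R) (i j M : nat).
Notation leb := (@lebesgue_measure R).

Lemma Loonorm_bound f K : continuous f -> (Loonorm f <= K%:E)%E -> forall x, `|f x| <= K.
Proof.
move=> fc; rewrite /Loonorm unlock /Lnorm /=; case: ifPn => [_|/negP h]; last first.
  (* The norm is the essential supremum only on a space of positive measure. *)
  exfalso; apply: h; apply: (@lt_le_trans _ _ (leb `[0, 1]%classic)).
    by rewrite lebesgue_measure_itv /= lte_fin ltr01 sube0 lte_fin ltr01.
  by apply: le_measure; rewrite ?inE.
move=> /ess_sup_inf.ess_supP h x; rewrite leNgt; apply/negP => Kx.
have fc' : continuous (fun x => `|f x|) by move=> y; apply: cvg_norm; exact: fc.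
have /nbhs_ballP[d /= d0 hd] : \forall y \near x, K < `|f y|.
  exact: (@cvgr_gt _ _ (nbhs x) _ _ _ (fc' x) _ Kx).
have xxd : x < x + d by lra.
have [y [/andP[xy yd] hy]] := leb_ae_itv h xxd.
have : K < `|f y| by apply: hd; rewrite /ball/= distrC ger0_norm; lra.
by move: hy => /=; rewrite lee_fin; lra.
Qed.

(** Puts the case M = 1 in the same form as the others and extends the cutoffs to all indices, so
    that smoothness and bounds hold without side conditions. Off the closed support a function
    vanishes on a neighbourhood, hence its derivatives do as well. *)
Lemma cutoff_familyP T M n0 (chi : nat -> nat -> R -> R) : (0 < M)%N ->
  cutoff_family T M n0 chi ->
  exists2 K, 0 <= K & forall n, (n0 <= n)%N -> exists X : nat -> R -> R,
  [/\ forall j x, (1 <= j <= M)%N -> X j x = chi j n x,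
      forall j, smooth (X j),
      forall j x, [/\ `|X j x| <= K, `|derive1 (X j) x| <= K & `|derive1 (derive1 (X j)) x| <= K],
      forall j x, (1 <= j <= M)%N -> ~ window (n%:R * T) M j x ->
        [/\ X j x = 0, derive1 (X j) x = 0 & derive1 (derive1 (X j)) x = 0] &
      forall x, \sum_(j <- index_iota 1 M.+1) X j x = 1].
Proof.
have d1c (c : R) : derive1 (fun=> c : R) = fun=> 0 := has_derivE (has_deriv_cst c).
move=> M0; rewrite /cutoff_family; have [->|M1] := eqVneq M 1%N.
  move=> h; exists 1 => // n nn; exists (fun _ _ => 1); split=> //.
  - by move=> j x j1; rewrite (_ : j = 1%N) ?h//; apply/eqP; rewrite eqn_leq andbC.
  - by move=> j; exact: smooth_cst.
  - by move=> j x; rewrite !d1c !normr0 normr1; split.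
  - move=> j x j1 []; rewrite (_ : j = 1%N)//.
    by apply/eqP; rewrite eqn_leq andbC.
  - by move=> x; rewrite big_nat1.
move=> [hX sX [K0 hK]]; exists `|K0| => // n nn.
pose X j := if (1 <= j <= M)%N then chi j n else fun=> 0.
exists X; split.
- by move=> j x jM; rewrite /X jM.
- by move=> j; rewrite /X; case: ifP => [/(hX n j nn)[]//|_]; exact: smooth_cst.
- move=> j x; rewrite /X; case: ifP => [jM|_]; last by rewrite !d1c normr0.
  have [sm _ _] := hX n j nn jM.
  have := hK n j nn jM; rewrite /W2oonorm.
  set a := Loonorm _; set b := Loonorm _; set c := Loonorm _ => abc.
  have a0 : (0 <= a)%E := Lnorm_ge0 _ _ _.
  have b0 : (0 <= b)%E := Lnorm_ge0 _ _ _.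
  have c0 : (0 <= c)%E := Lnorm_ge0 _ _ _.
  have KK : (K0%:E <= `|K0|%:E)%E by rewrite lee_fin ler_norm.
  have abc' := le_trans abc KK.
  split; apply: Loonorm_bound; rewrite -?/a -?/b -?/c.
  + exact: smooth_continuous.
  + by apply: le_trans abc'; rewrite -addeA leeDl// adde_ge0.
  + exact: smooth_continuous (smooth_derive1 sm).
  + by apply: le_trans abc'; rewrite addeAC leeDr// adde_ge0.
  + exact: smooth_continuous (smooth_derive1 (smooth_derive1 sm)).
  + by apply: le_trans abc'; rewrite leeDr// adde_ge0.
- move=> j x jM nw; rewrite /X jM; have [sm _ supp] := hX n j nn jM.
  have ns : ~ fsupport (chi j n) x.
    move=> /supp h; apply: nw; move: h jM; rewrite /cutoff_window /window.
    have [-> /=|j1] := eqVneq j 1%N.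
      by rewrite in_itv/= ltnn => h _; split=> // _; move: h; lra.
    have [-> /=|jM] := eqVneq j M.
      by rewrite in_itv/= ltnn andbT => h _; split=> // _; move: h; lra.
    by rewrite /= in_itv/= => /andP[h1 h2] _; split=> _; lra.
  have h0 := near_fsupport ns; have h1 := near_derive1_eq0 h0.
  split; first exact: fsupport_eq0.
    exact: (nbhs_singleton h1).
  exact: (nbhs_singleton (near_derive1_eq0 h1)).
- move=> x; rewrite -(sX n nn x); apply: eq_big_nat => j; rewrite ltnS => jM.
  by rewrite /X jM.
Qed.

Lemma GP_solution_has_deriv omega V mu f : GP_solution omega V mu f ->
  has_deriv f (derive1 f) /\
  has_deriv (derive1 f) (fun x => (mu * V x + omega) * f x + f x ^+ 3).
Proof.
move=> h; split; first by apply: derivable_has_deriv => x; have [] := h x.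
have : has_deriv (derive1 f) (derive1 (derive1 f)).
  by apply: derivable_has_deriv => x; have [] := h x.
rewrite (_ : derive1 (derive1 f) = (fun x => (mu * V x + omega) * f x + f x ^+ 3))//.
apply/funext => x; have [_ _] := h x; rewrite /derive1n /=.
by move: (derive1 (derive1 f) x) => t; lra.
Qed.

Lemma has_deriv_GP_solution omega V mu f f1 : has_deriv f f1 ->
  has_deriv f1 (fun x => (mu * V x + omega) * f x + f x ^+ 3) -> GP_solution omega V mu f.
Proof.
move=> h1 h2 x; rewrite /derive1n /= !(has_derivE h1) (has_derivE h2).
split; [exact: has_deriv_derivable h1 _|exact: has_deriv_derivable h2 _|ring].
Qed.

Lemma continuous_add f g : continuous f -> continuous g -> continuous (fun x : R => f x + g x).
Proof. by move=> fc gc x; apply: cvgD; [exact: fc|exact: gc]. Qed.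

Lemma continuous_sub f g : continuous f -> continuous g -> continuous (fun x : R => f x - g x).
Proof. by move=> fc gc x; apply: cvgB; [exact: fc|exact: gc]. Qed.

Lemma continuous_mul f g : continuous f -> continuous g -> continuous (fun x : R => f x * g x).
Proof. by move=> fc gc x; apply: cvgM; [exact: fc|exact: gc]. Qed.

Lemma continuous_pow f n : continuous f -> continuous (fun x : R => f x ^+ n).
Proof.
move=> fc; elim: n => [|n ih]; first by move=> x; exact: cvg_cst.
rewrite (_ : (fun x => f x ^+ n.+1) = (fun x => f x * f x ^+ n)).
  exact: continuous_mul.
by apply/funext => x; rewrite exprS.
Qed.

Lemma continuous_affine (V : R -> R) (a b : R) : continuous V -> continuous (fun x : R => a * V x + b).
Proof.
move=> Vc; apply: continuous_add; last by move=> x; exact: cvg_cst.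
by apply: continuous_mul => // x; exact: cvg_cst.
Qed.

Lemma continuous_cubic (W f : R -> R) : continuous W -> continuous f ->
  continuous (fun x : R => W x * f x + f x ^+ 3).
Proof. by move=> Wc fc; apply: continuous_add; [exact: continuous_mul|exact: continuous_pow]. Qed.

(** The H2 function s (f - v) decays together with its derivative. For x >= 2 the step is locally
    constant 1, so this is decay of f - v itself. *)
Lemma front_decay_right s omega V mu f v : smooth_step s -> continuous V ->
  GP_solution omega V mu f -> GP_solution omega V mu v ->
  H2 (fun x => s x * (f x - v x)) -> forall e, 0 < e -> exists2 A, 0 <= A &
  forall x, A <= x -> `|f x - v x| <= e /\ `|derive1 f x - derive1 v x| <= e.
Proof.
move=> hs Vc /GP_solution_has_deriv[f1 f2] /GP_solution_has_deriv[v1 v2] Hh e e0.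
have [ss _ _ s1] := hs.
have Wc := @continuous_affine V mu omega Vc.
have F2c := continuous_cubic Wc (has_deriv_continuous f1).
have V2c := continuous_cubic Wc (has_deriv_continuous v1).
set F2 := (fun x => _) in f2 F2c; set V2 := (fun x => _) in v2 V2c.
have d1 := has_derivB f1 v1; have d2 := has_derivB f2 v2.
have sh := smooth_has_deriv ss; have sh' := smooth_has_deriv (smooth_derive1 ss).
have h1 := has_derivM sh d1.
have h2 := has_derivD (has_derivM sh' d1) (has_derivM sh d2).
have sc := smooth_continuous ss; have s'c := smooth_continuous (smooth_derive1 ss).
have s''c := smooth_continuous (smooth_derive1 (smooth_derive1 ss)).
have h2c : continuous (fun x => (derive1 (derive1 s) x * (f x - v x) +
    derive1 s x * (derive1 f x - derive1 v x)) + (derive1 s x * (derive1 f x - derive1 v x) +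
    s x * (F2 x - V2 x))).
  have fc := has_deriv_continuous f1; have vc := has_deriv_continuous v1.
  have f'c := has_deriv_continuous f2; have v'c := has_deriv_continuous v2.
  have dc := continuous_sub fc vc; have d'c := continuous_sub f'c v'c.
  have d''c := continuous_sub F2c V2c.
  exact: (continuous_add (continuous_add (continuous_mul s''c dc) (continuous_mul s'c d'c))
    (continuous_add (continuous_mul s'c d'c) (continuous_mul sc d''c))).
have [A hA] := H2_decay hs h1 h2 h2c Hh e0.
exists (Num.max A 2) => [|x]; first by rewrite le_max ler0n orbT.
rewrite ge_max => /andP[/hA[] + + x2].
have -> : s x = 1 by apply: s1; lra.
have -> : derive1 s x = 0.
  have := @step_scale_vanishes_r _ s 1 0 x hs; rewrite subr0 mul1r; apply; lra.
by rewrite !mul1r mul0r add0r.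
Qed.

(** The left end follows by reflection: psi is odd, v_+ is even and v_- = - v_+, while derivatives
    have the opposite parity. The second kind of front is a change of sign. *)
Lemma front_decay psi vp vm f fm fp e A : has_deriv psi (derive1 psi) ->
  has_deriv vp (derive1 vp) -> (forall x, psi (- x) = - psi x) ->
  (forall x, vm x = - vp x) -> (forall x, vp (- x) = vp x) ->
  (forall x, A <= x -> `|psi x - vp x| <= e /\ `|derive1 psi x - derive1 vp x| <= e) ->
  primary_front psi vp vm f fm fp ->
  (forall x, A <= x -> `|f x - fp x| <= e /\ `|derive1 f x - derive1 fp x| <= e) /\
  (forall x, x <= - A -> `|f x - fm x| <= e /\ `|derive1 f x - derive1 fm x| <= e).
Proof.
move=> psi1 vp1 odd vmE even hA.
have psi'E x : derive1 psi x = derive1 psi (- x).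
  have h := has_deriv_affine (-1) 0 psi1.
  have e1 : (fun x => psi (-1 * x + 0)) = (fun x => - psi x).
    by apply/funext => y; rewrite mulN1r addr0 odd.
  rewrite e1 in h; have := has_deriv_unique h (has_derivN psi1).
  by move=> /(congr1 (fun g => g x)); rewrite !mulN1r addr0 => /oppr_inj.
have vp'E x : derive1 vp x = - derive1 vp (- x).
  have h := has_deriv_affine (-1) 0 vp1.
  have e1 : (fun x => vp (-1 * x + 0)) = vp.
    by apply/funext => y; rewrite mulN1r addr0 even.
  rewrite e1 in h; have := has_deriv_unique vp1 h.
  by move=> /(congr1 (fun g => g x)); rewrite !mulN1r addr0.
have vmE' : vm = (fun x => - vp x) by apply/funext.
have vm'E : derive1 vm = (fun x => - derive1 vp x).
  by rewrite vmE'; exact: has_derivE (has_derivN vp1).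
have hA' x : x <= - A -> `|psi x - vm x| <= e /\ `|derive1 psi x - derive1 vm x| <= e.
  move=> xA; have [|h1 h2] := hA (- x); first by lra.
  rewrite vmE vm'E psi'E vp'E; split.
    rewrite -[psi x]opprK -odd -even -normrN (_ : - (_ - _) = psi (- x) - vp (- x))//; ring.
  by rewrite opprK.
have npsi' : derive1 (fun x => - psi x) = (fun x => - derive1 psi x) := has_derivE (has_derivN psi1).
move=> [[-> -> ->]|[-> -> ->]]; first by split.
split=> x xA; rewrite npsi' ?vmE ?vm'E.
  have [h1 h2] := hA x xA; have nn (a b : R) : `|- a - - b| = `|a - b|.
    by rewrite -opprD normrN.
  by rewrite !nn.
have [h1 h2] := hA' x xA; rewrite vmE vm'E in h1 h2.
have nn (a b : R) : `|- a - b| = `|a - - b| by rewrite -normrN opprB opprK addrC opprK.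
by rewrite !nn.
Qed.

Lemma cube_dist K (y z : R) : `|y| <= K -> `|z| <= K ->
  `|y ^+ 3 - z ^+ 3| <= 3 * K ^+ 2 * `|y - z|.
Proof.
move=> yK zK; have -> : y ^+ 3 - z ^+ 3 = (y ^+ 2 + y * z + z ^+ 2) * (y - z) by ring.
rewrite normrM ler_wpM2r//.
have pM (a b : R) : `|a| <= K -> `|b| <= K -> `|a * b| <= K ^+ 2.
  by move=> aK bK; rewrite normrM expr2 ler_pM.
have := ler_normD (y ^+ 2 + y * z) (z ^+ 2); have := ler_normD (y ^+ 2) (y * z).
by have := pM _ _ yK yK; have := pM _ _ yK zK; have := pM _ _ zK zK; rewrite -!expr2; lra.
Qed.

Lemma weighted_sum_bound (r : seq nat) (p c : nat -> R) K eta : 0 <= eta ->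
  (forall j, j \in r -> `|p j| <= K) -> (forall j, j \in r -> p j = 0 \/ `|c j| <= eta) ->
  `|\sum_(j <- r) p j * c j| <= (size r)%:R * K * eta.
Proof.
move=> e0 pK cK; rewrite big_seq; apply: le_trans (ler_norm_sum _ _ _) _.
apply: (@le_trans _ _ (\sum_(j <- r | j \in r) K * eta)).
  apply: ler_sum => j jr; rewrite normrM; have K0 := le_trans (normr_ge0 _) (pK _ jr).
  have [->|h] := cK _ jr; first by rewrite normr0 mul0r mulr_ge0.
  by rewrite ler_pM// pK.
by rewrite -big_seq big_const_seq count_predT iter_addr_0 -mulrA mulr_natl.
Qed.

(* Subtracting the value and the slope of one of the fronts costs nothing because
   the weights sum to 1 and their derivatives to 0. *)
Lemma residual_bound (r : seq nat) (a b p p1 p2 : nat -> R) (w a0 b0 eta K Kx : R) :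
  0 <= eta -> 0 <= K -> 0 <= Kx ->
  \sum_(j <- r) p j = 1 -> \sum_(j <- r) p1 j = 0 -> \sum_(j <- r) p2 j = 0 ->
  (forall j, j \in r -> [/\ `|p j| <= Kx, `|p1 j| <= Kx & `|p2 j| <= Kx]) ->
  (forall j, `|a j| <= K) -> `|a0| <= K ->
  (forall j, j \in r -> [/\ p j = 0, p1 j = 0 & p2 j = 0] \/
     (`|a j - a0| <= eta /\ `|b j - b0| <= eta)) ->
  `|- (\sum_(j <- r) ((p2 j * a j + p1 j * b j) + (p1 j * b j + p j * (w * a j + a j ^+ 3))))
    + w * (\sum_(j <- r) p j * a j) + (\sum_(j <- r) p j * a j) ^+ 3|
  <= (size r)%:R * Kx * (6 * ((size r)%:R * Kx * K + K) ^+ 2 + 3) * eta.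
Proof.
move=> e0 K0 Kx0 sp sp1 sp2 pK aK a0K cl.
set m : R := (size r)%:R; have m0 : 0 <= m by [].
set P := \sum_(j <- r) p j * a j; set K2 := m * Kx * K + K.
have mKx : 0 <= m * Kx by rewrite mulr_ge0.
have mKxK : 0 <= m * Kx * K by rewrite mulr_ge0.
have PK : `|P| <= K2.
  apply: le_trans (_ : m * Kx * K <= _); last by rewrite lerDl.
  by apply: weighted_sum_bound => // j jr; [have [] := pK _ jr|right].
have a0K2 : `|a0| <= K2 by apply: le_trans a0K _; rewrite lerDr.
have aK2 j : `|a j| <= K2 by apply: le_trans (aK j) _; rewrite lerDr.
have E (c : nat -> R) c0 (t : nat -> R) : \sum_(j <- r) t j * (c j - c0) =
    \sum_(j <- r) t j * c j - (\sum_(j <- r) t j) * c0.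
  by rewrite mulr_suml -sumrB; apply: eq_bigr => j _; rewrite mulrBr.
have P0 : P - a0 = \sum_(j <- r) p j * (a j - a0) by rewrite E sp mul1r.
(* Every front solves the equation, so the linear terms cancel. What remains is the defect of the
   cube and the terms where a derivative falls on a weight; they give 3 K2^2 + 3 K2^2 + 2 + 1 in the
   bound. *)
have -> : - (\sum_(j <- r) ((p2 j * a j + p1 j * b j) + (p1 j * b j + p j * (w * a j + a j ^+ 3))))
    + w * P + P ^+ 3 = (P ^+ 3 - a0 ^+ 3) - \sum_(j <- r) p j * (a j ^+ 3 - a0 ^+ 3)
    - 2 * \sum_(j <- r) p1 j * (b j - b0) - \sum_(j <- r) p2 j * (a j - a0).
  rewrite (E (fun j => a j ^+ 3)) !E sp sp1 sp2 !mul0r !subr0 mul1r !big_split/=.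
  have -> : \sum_(j <- r) p j * (w * a j + a j ^+ 3) = w * P + \sum_(j <- r) p j * a j ^+ 3.
    by rewrite /P mulr_sumr -big_split/=; apply: eq_bigr => j _; ring.
  by ring.
have b1 : `|P ^+ 3 - a0 ^+ 3| <= 3 * K2 ^+ 2 * (m * Kx * eta).
  apply: le_trans (cube_dist PK a0K2) _; apply: ler_wpM2l; [by rewrite mulr_ge0// sqr_ge0|rewrite P0].
  apply: weighted_sum_bound => // j jr; first by have [] := pK _ jr.
  by have [[]|[]] := cl _ jr; [left|right].
have b2 : `|\sum_(j <- r) p j * (a j ^+ 3 - a0 ^+ 3)| <= m * Kx * (3 * K2 ^+ 2 * eta).
  apply: weighted_sum_bound => [|j jr|j jr]; first by rewrite mulr_ge0// mulr_ge0// sqr_ge0.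
    by have [] := pK _ jr.
  have [[]|[h _]] := cl _ jr; [by left|right].
  apply: le_trans (cube_dist (aK2 _) a0K2) _.
  by rewrite ler_wpM2l// mulr_ge0// sqr_ge0.
have b3 : `|\sum_(j <- r) p1 j * (b j - b0)| <= m * Kx * eta.
  apply: weighted_sum_bound => // j jr; first by have [] := pK _ jr.
  by have [[]|[]] := cl _ jr; [left|right].
have b4 : `|\sum_(j <- r) p2 j * (a j - a0)| <= m * Kx * eta.
  apply: weighted_sum_bound => // j jr; first by have [] := pK _ jr.
  by have [[]|[]] := cl _ jr; [left|right].
have -> : m * Kx * (6 * K2 ^+ 2 + 3) * eta =
  3 * K2 ^+ 2 * (m * Kx * eta) + m * Kx * (3 * K2 ^+ 2 * eta) + 3 * (m * Kx * eta) by ring.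
move: b1 b2 b3 b4; move: (P ^+ 3 - _) (\sum_(j <- r) _) (\sum_(j <- r) _) (\sum_(j <- r) _).
move=> t1 t4 t3 t2 b1 b4 b3 b2.
have := ler_normB (t1 - t2 - 2 * t3) t4; have := ler_normB (t1 - t2) (2 * t3).
by have := ler_normB t1 t2; rewrite normrM (ger0_norm (_ : 0 <= 2 :> R))//; lra.
Qed.

Definition band (L : R) (k : nat) : set R :=
  `[(k%:R + 1 / 2) * L - 1, (k%:R + 1 / 2) * L + 1]%classic.

(** Windows exceed cells by length 1 only, so a foreign window meets a cell just next to the
    midpoint between two neighbouring centres. *)
Lemma window_cell L M i j x : 0 < L -> (1 <= i <= M)%N -> (1 <= j <= M)%N ->
  cell L M i x -> window L M j x -> j != i -> exists2 k, (1 <= k < M)%N & band L k x.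
Proof.
move=> L0 /andP[i1 iM] /andP[j1 jM] [xi nxi] [jl jr].
rewrite neq_ltn => /orP[ji|ij].
- exists j; first by rewrite j1 (leq_trans ji).
  have h2 := jr (leq_trans ji iM).
  move: xi; rewrite /right_part leqNgt (leq_ltn_trans j1 ji) iM /= in_itv/= andbT => h1.
  have : (j.+1%:R - 1 / 2) * L <= (i%:R - 1 / 2) * L.
    by rewrite ler_pM2r// lerD2r ler_nat.
  by rewrite -natr1 /band/= in_itv/=; move: h1 h2; rewrite !mulrDl !mulNr; lra.
- exists i; first by rewrite i1 (leq_trans ij).
  have iM' := leq_trans ij jM; have h2 := jl (leq_ltn_trans i1 ij).
  move: nxi; rewrite /right_part ltnNge i1 /= iM' /= in_itv/= andbT => /negP; rewrite -leNgt => h1.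
  have : (i.+1%:R - 1 / 2) * L <= (j%:R - 1 / 2) * L.
    by rewrite ler_pM2r// lerD2r ler_nat.
  by move: h1; rewrite -natr1 /band/= in_itv/=; move: h2; rewrite !mulrDl !mulNr; lra.
Qed.

(** A band has length 2 whatever L is. A small sup bound on M bands is therefore a small L2 bound,
    uniformly in the spacing. *)
Lemma L2le_band L M c f : 0 <= c -> measurable_fun setT f ->
  (forall x, `|f x| <= c * \sum_(k <- index_iota 1 M) \1_(band L k) x) ->
  L2le f (c * (2 * M%:R)).
Proof.
move=> c0 mf fc.
have h k : L2le (\1_(band L k)) 2.
  have mb : measurable (band L k) by exact: measurable_itv.
  split; first exact: measurable_indic.
  rewrite (_ : (fun x => _) = (fun x => (\1_(band L k) x)%:E)); last first.
    by apply/funext => x; rewrite indicE; case: (_ \in _); rewrite ?expr1n ?expr0n.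
  apply: (@le_trans _ _ (leb (band L k))); first by rewrite integral_indic// setIT.
  rewrite /band lebesgue_measure_itv /= lte_fin; case: ifP => _; last by rewrite lee_fin sqr_ge0.
  by rewrite -EFinB lee_fin; lra.
apply: (@L2le_le _ f (fun x => c * \sum_(k <- index_iota 1 M) \1_(band L k) x)) => //.
  by move=> x; apply: le_trans (fc x) (ler_norm _).
apply: L2leZ; have := L2le_sum (index_iota 1 M) (fun=> ler0n R 2) h.
apply: L2leW; rewrite big_const_seq count_predT iter_addr_0 size_iota ?mulrn_wge0//.
by rewrite -[_ *+ (_ - _)]mulr_natr ler_wpM2l// ler_nat leq_subr.
Qed.

End Residual.

(** * Chains of fronts *)

Section Chain.
Context {R : realType}.
Notation leb := (@lebesgue_measure R).

Lemma continuous_sum (I : Type) (r : seq I) (f : I -> R -> R) :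
  (forall i, continuous (f i)) -> continuous (fun x : R => \sum_(i <- r) f i x).
Proof.
move=> fc; elim: r => [|i r ih].
  by rewrite (_ : (fun x => _) = fun=> 0); [move=> x; exact: cvg_cst|apply/funext => x; rewrite big_nil].
rewrite (_ : (fun x => _) = (fun x => f i x + \sum_(i <- r) f i x)); first exact: continuous_add.
by apply/funext => x; rewrite big_cons.
Qed.

Lemma H2le_continuous_sup (s u u1 u2 : R -> R) (a : R) : smooth_step s -> 0 <= a ->
  continuous u1 -> has_deriv u u1 -> H2le u u1 u2 a -> forall x, `|u x| <= 2 * a.
Proof.
move=> hs a0 u1c uu1 H; have [v [v1 [uv _ v1c vv1 [ftc Hv]]]] := H2le_rep hs H.
rewrite (ae_eq_continuous (has_deriv_continuous uu1) (has_deriv_continuous vv1) uv) => x.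
by have [] := H2le_sup a0 v1c vv1 ftc Hv x.
Qed.

(** [eta] measures how close neighbouring fronts are where they meet, [eps] the admissible mismatch
    of potentials, [rho] the sup norm allowed for the correction. [rho1] lets the iteration run,
    [rho2] is the Sobolev bound for its limit, and [rho3], [rho4] keep the potentials near the
    corrected profile eps-close to the q_j. *)
Variables (s : R -> R) (M : nat) (L B omega mu : R) (V : R -> R) (F F1 X : nat -> R -> R)
  (K Kx C Kq eps eta rho : R).
Let r := index_iota 1 M.+1.
Let m : R := (size r)%:R.
Let W x := mu * V x + omega.
Let F2 j x := W x * F j x + F j x ^+ 3.
Let q_ j x := W x + 3 * F j x ^+ 2.
Let d := 8 / L * B.
Let th := plateau s L M.
Let K1 := 4 * m * C.
Let c3 := 2 * K1 + 1 + (Kq + 1) * (2 * K1).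
Let E := m * Kx * (6 * (m * Kx * K + K) ^+ 2 + 3) * (2 * M%:R).
Let e := E * eta.
Let Phi x := \sum_(j <- r) X j x * F j x.
Let Phi1 x := \sum_(j <- r) (derive1 (X j) x * F j x + X j x * F1 j x).
Let Phi2 x := \sum_(j <- r) ((derive1 (derive1 (X j)) x * F j x + derive1 (X j) x * F1 j x) +
  (derive1 (X j) x * F1 j x + X j x * F2 j x)).

Hypotheses (hs : smooth_step s) (M0 : (0 < M)%N) (L8 : 8 <= L) (B0 : 0 <= B) (d1 : d <= 1)
  (Vc : continuous V) (F'F1 : forall j, has_deriv (F j) (F1 j))
  (F1'F2 : forall j, has_deriv (F1 j) (F2 j)) (Xs : forall j, smooth (X j))
  (XK : forall j x, [/\ `|X j x| <= Kx, `|derive1 (X j) x| <= Kx & `|derive1 (derive1 (X j)) x| <= Kx])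
  (Xw : forall j x, (1 <= j <= M)%N -> ~ window L M j x ->
        [/\ X j x = 0, derive1 (X j) x = 0 & derive1 (derive1 (X j)) x = 0])
  (Xsum : forall x, \sum_(j <- r) X j x = 1)
  (K0 : 0 <= K) (FK : forall j x, `|F j x| <= K) (Kx0 : 0 < Kx) (C0 : 0 < C) (Kq0 : 0 <= Kq)
  (qK : forall j x, `|q_ j x| <= Kq)
  (qsolv : forall j, solvable (q_ j) C) (qcoer : forall j, coercive (q_ j) C)
  (eps0 : 0 <= eps) (eps1 : eps <= 1) (small : m * C * (eps + 3 * d * (6 + 2 * Kq)) <= 1 / 2)
  (th1 : forall j x, `|th j x| <= 1) (th'd : forall j x, `|derive1 (th j) x| <= d)
  (th''d : forall j x, `|derive1 (derive1 (th j)) x| <= d) (ths : forall j, smooth (th j))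
  (eta0 : 0 < eta)
  (close : forall i j x, (1 <= i <= M)%N -> (1 <= j <= M)%N -> th i x != 0 -> window L M j x ->
    `|F j x - F i x| <= eta /\ `|F1 j x - F1 i x| <= eta)
  (rho1 : 4 * K1 * e <= rho) (rho2 : 2 * (c3 * e) <= rho)
  (rho3 : m * Kx * eta + rho <= 1) (rho4 : 3 * (2 * K + 1) * (m * Kx * eta + rho) <= eps).

Let mem_r j : j \in r -> (1 <= j <= M)%N.
Proof. by rewrite mem_index_iota ltnS. Qed.

Let L0 : 0 < L. Proof. by move: L8 => h; lra. Qed.
Let m0 : 0 < m. Proof. by rewrite ltr0n size_iota subn1. Qed.
Let d0 : 0 <= d. Proof. by rewrite mulr_ge0// divr_ge0// ltW. Qed.
Let mKx0 : 0 < m * Kx. Proof. by rewrite mulr_gt0. Qed.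
Let Wc : continuous W. Proof. exact: continuous_affine. Qed.
Let Fc j : continuous (F j) := has_deriv_continuous (F'F1 j).
Let F1c j : continuous (F1 j) := has_deriv_continuous (F1'F2 j).
Let F2c j : continuous (F2 j). Proof. exact: continuous_cubic. Qed.
Let qc j : continuous (q_ j).
Proof.
apply: continuous_add => //; apply: continuous_mul; first by move=> x; exact: cvg_cst.
exact: continuous_pow.
Qed.
Let mq j : measurable_fun setT (q_ j) := continuous_measurable (@qc j).
Let thsum x : \sum_(j <- r) th j x * \1_(cell L M j) x = 1.
Proof. exact: plateau_sum. Qed.

Let sum_X' x : \sum_(j <- r) derive1 (X j) x = 0.
Proof.
have := has_deriv_sum r (fun j => smooth_has_deriv (@Xs j)).
rewrite (_ : (fun x => \sum_(j <- r) X j x) = fun=> 1); last exact/funext.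
by move=> h; have := has_deriv_unique h (has_deriv_cst 1) => /(congr1 (fun g => g x)).
Qed.

Let sum_X'' x : \sum_(j <- r) derive1 (derive1 (X j)) x = 0.
Proof.
have := has_deriv_sum r (fun j => smooth_has_deriv (smooth_derive1 (@Xs j))).
rewrite (_ : (fun x => \sum_(j <- r) derive1 (X j) x) = fun=> 0); last exact/funext.
by move=> h; have := has_deriv_unique h (has_deriv_cst 0) => /(congr1 (fun g => g x)).
Qed.

Let Phi'Phi1 : has_deriv Phi Phi1.
Proof.
by apply: has_deriv_sum => j; apply: has_derivM; [exact: smooth_has_deriv|].
Qed.

Let Phi1'Phi2 : has_deriv Phi1 Phi2.
Proof.
apply: has_deriv_sum => j; have h := smooth_has_deriv (@Xs j).
have h' := smooth_has_deriv (smooth_derive1 (@Xs j)).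
by apply: has_derivD; apply: has_derivM.
Qed.

Let Phi2c : continuous Phi2.
Proof.
apply: continuous_sum => j; have xc := smooth_continuous (@Xs j).
have x'c := smooth_continuous (smooth_derive1 (@Xs j)).
have x''c := smooth_continuous (smooth_derive1 (smooth_derive1 (@Xs j))).
exact: (continuous_add (continuous_add (continuous_mul x''c (@Fc j)) (continuous_mul x'c (@F1c j)))
  (continuous_add (continuous_mul x'c (@F1c j)) (continuous_mul xc (@F2c j)))).
Qed.

Let PhiK x : `|Phi x| <= m * Kx * K.
Proof. by apply: weighted_sum_bound => // j _; [have [] := XK j x|right]. Qed.

Let Phi_close i x : (1 <= i <= M)%N -> th i x != 0 -> `|Phi x - F i x| <= m * Kx * eta.
Proof.
move=> iM thi; have -> : Phi x - F i x = \sum_(j <- r) X j x * (F j x - F i x).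
  under eq_bigr do rewrite mulrBr.
  by rewrite big_split/= sumrN -mulr_suml Xsum mul1r.
apply: weighted_sum_bound => [|j _|j /mem_r jM]; [exact: ltW|by have [] := XK j x|].
have [h|h] := pselect (window L M j x); last by left; have [] := Xw jM h.
by right; have [] := close iM jM thi h.
Qed.

(** a^2 + a b + b^2 is the difference quotient of the cube, and 3 a^2 when a = b. One estimate thus
    serves the iteration and the linearization at the solution. *)
Let sqr_close (a b c t : R) : t <= 1 -> `|c| <= K -> `|a - c| <= t -> `|b - c| <= t ->
  `|a ^+ 2 + a * b + b ^+ 2 - 3 * c ^+ 2| <= 3 * (2 * K + 1) * t.
Proof.
move=> t1 cK ac bc; have t0 := le_trans (normr_ge0 _) ac.
have aK : `|a| <= K + 1 by have := ler_normD (a - c) c; rewrite subrK; lra.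
have bK : `|b| <= K + 1 by have := ler_normD (b - c) c; rewrite subrK; lra.
have -> : a ^+ 2 + a * b + b ^+ 2 - 3 * c ^+ 2 =
  (a - c) * (a + b + c) + (b - c) * (b + c + c) by ring.
have h1 : `|(a - c) * (a + b + c)| <= t * (3 * K + 2).
  rewrite normrM ler_pM//; have := ler_normD (a + b) c; have := ler_normD a b; lra.
have h2 : `|(b - c) * (b + c + c)| <= t * (3 * K + 1).
  rewrite normrM ler_pM//; have := ler_normD (b + c) c; have := ler_normD b c; lra.
by have := ler_normD ((a - c) * (a + b + c)) ((b - c) * (b + c + c)); lra.
Qed.

Let residual x := W x * Phi x + Phi x ^+ 3 - Phi2 x.

Let residual_le x : `|residual x| <=
  m * Kx * (6 * (m * Kx * K + K) ^+ 2 + 3) * eta * \sum_(k <- index_iota 1 M) \1_(band L k) x.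
Proof.
have [i ir thi] : exists2 i, i \in r & th i x * \1_(cell L M i) x != 0.
  apply: contrapT => nex; have := thsum x; rewrite big_seq big1 => [/esym/eqP|i ir].
    by rewrite oner_eq0.
  by apply: contrapT => /eqP h; apply: nex; exists i.
have iM := mem_r ir.
have xi : cell L M i x.
  by apply: contrapT => h; move: thi; rewrite indicE memNset// mulr0 eqxx.
have thi0 : th i x != 0 by move: thi; rewrite mulf_eq0 negb_or => /andP[].
(* The tolerance is left free: it is eta on a band, and 0 where only the window of the own cell is
   met, so that the residual vanishes there. *)
have bnd t : 0 <= t -> (forall j, (1 <= j <= M)%N -> window L M j x ->
    `|F j x - F i x| <= t /\ `|F1 j x - F1 i x| <= t) ->
    `|residual x| <= m * Kx * (6 * (m * Kx * K + K) ^+ 2 + 3) * t.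
  move=> t0 cl; rewrite /residual addrC addrA.
  have := @residual_bound _ r (fun j => F j x) (fun j => F1 j x) (fun j => X j x)
    (fun j => derive1 (X j) x) (fun j => derive1 (derive1 (X j)) x) (W x) (F i x) (F1 i x)
    t K Kx t0 K0 (ltW Kx0) (Xsum x) (sum_X' x) (sum_X'' x) (fun j _ => XK j x)
    (fun j => FK j x) (FK i x).
  apply => j /mem_r jM; have [h|h] := pselect (window L M j x); last by left; exact: Xw.
  by right; exact: cl.
have [[j [jM wj ji]]|none] := pselect (exists j, [/\ (1 <= j <= M)%N, window L M j x & j != i] : Prop).
  have [k kM bk] := window_cell L0 iM jM xi wj ji.
  apply: le_trans (bnd eta (ltW eta0) _) _ => [j' j'M wj'|]; first exact: close.
  apply: ler_peMr.
    by rewrite mulr_ge0 ?(ltW eta0)// mulr_ge0 ?(ltW mKx0)// addr_ge0// mulr_ge0// sqr_ge0.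
  by rewrite (big_rem k) ?mem_index_iota//= indicE mem_set// lerDl sumr_ge0.
apply: le_trans (bnd 0 (lexx 0) _) _ => [j jM wj|].
  suff -> : j = i by rewrite !subrr normr0.
  by apply: contrapT => /eqP ji; apply: none; exists j.
rewrite mulr0 mulr_ge0//; last by rewrite sumr_ge0// => l _; rewrite indicE.
by rewrite mulr_ge0 ?(ltW eta0)// mulr_ge0 ?(ltW mKx0)// addr_ge0// mulr_ge0// sqr_ge0.
Qed.

Let Phic : continuous Phi := has_deriv_continuous Phi'Phi1.

Let residual_L2 : L2le residual e.
Proof.
have rc : continuous residual.
  exact: (continuous_sub (continuous_cubic Wc Phic) Phi2c).
rewrite (_ : e = m * Kx * (6 * (m * Kx * K + K) ^+ 2 + 3) * eta * (2 * M%:R)).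
  apply: (@L2le_band _ L); [|exact: continuous_measurable|exact: residual_le].
  by rewrite mulr_ge0 ?(ltW eta0)// mulr_ge0 ?(ltW mKx0)// addr_ge0// mulr_ge0// sqr_ge0.
by rewrite /e /E; ring.
Qed.

Let e_gt0 : 0 < e.
Proof.
have h : 0 < 6 * (m * Kx * K + K) ^+ 2 + 3 by rewrite ltr_wpDl// mulr_ge0// sqr_ge0.
have hM : 0 < 2 * M%:R :> R by rewrite mulr_gt0// ltr0n.
exact: mulr_gt0 (mulr_gt0 (mulr_gt0 mKx0 h) hM) eta0.
Qed.

Let glue_inv psit : continuous psit ->
  (forall x j, j \in r -> th j x != 0 -> `|GP_potential omega V mu psit x - q_ j x| <= eps) ->
  invertible_on_L2 H2 (GP_linearization omega V mu psit).
Proof.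
move=> pc pq; set q := GP_potential omega V mu psit in pq.
have qtc : continuous q.
  apply: continuous_add => //; apply: continuous_mul; first by move=> x; exact: cvg_cst.
  exact: continuous_pow.
have mqt := continuous_measurable qtc.
have coer : coercive q (14 * m * C).
  exact: (glue_coercive hs C0 Kq0 d0 d1 eps0 eps1 small ths th1 th'd th''d
    (measurable_cell L M) thsum mq qK qcoer mqt pq).
have qtK x : `|q x| <= Kq + 1.
  have [j jr thj] := th_neq0 thsum x; have h1 := pq x j jr thj; have h2 := qK j x.
  by have := ler_normD (q x - q_ j x) (q_ j x); rewrite subrK; move: eps1 => h3; lra.
have mV := continuous_measurable Vc; have mp := continuous_measurable pc.
apply: (solvable_invertible hs _ mV mp _ coer qtK).
  by rewrite mulr_ge0 ?(ltW C0)// mulr_ge0// ltW.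
move=> f a a0 fa; have mf := L2le_meas fa.
(* The linear problem is the iteration with b(x, y) = q(x) y - f(x). The quotient is q for all
   arguments, so rho can be the smallest radius allowed. *)
have [|||u [u1 [u1c uu1 H]]] := @glue_solve _ s r q_ th (cell L M) C Kq d eps
  hs C0 Kq0 d0 d1 eps0 eps1 small ths th1 th'd th''d (measurable_cell L M) thsum qK
  (fun x y => q x * y - f x) (4 * (4 * m * C) * a) a qsolv a0 (lexx _).
- by move=> w mw; apply: measurable_funB => //; exact: measurable_funM.
- move=> x y z _ _; exists (q x); first by ring.
  by move=> j jr thj; exact: pq.
- by under eq_fun do rewrite mulr0 sub0r; exact: L2leN.
exists u, u1, (fun x => q x * u x - f x), (c3 * a); split=> //; last exact: leb_aeW.
rewrite mulr_ge0 ?(ltW a0)// !addr_ge0// ?mulr_ge0// ?addr_ge0//; exact: ltW.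
Qed.

Lemma chain_solution : exists u u1 u2, H2le u u1 u2 (c3 * e) /\
  nondegenerate_solution omega V mu (fun x => u x + \sum_(j <- r) X j x * F j x).
Proof.
have rho0 : 0 <= rho.
  apply: le_trans rho1; rewrite mulr_ge0 ?(ltW e_gt0)// mulr_ge0// mulr_ge0 ?(ltW C0)//.
  by rewrite mulr_ge0// ltW.
have [|||u [u1 [u1c uu1 H]]] := @glue_solve _ s r q_ th (cell L M) C Kq d eps
  hs C0 Kq0 d0 d1 eps0 eps1 small ths th1 th'd th''d (measurable_cell L M) thsum qK
  (fun x y => W x * (Phi x + y) + (Phi x + y) ^+ 3 - Phi2 x) rho e qsolv e_gt0 rho1.
- move=> w mw; have mpw : measurable_fun setT (fun x => Phi x + w x).
    by apply: measurable_funD => //; exact: (continuous_measurable Phic).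
  apply: measurable_funB; last exact: (continuous_measurable Phi2c).
  apply: measurable_funD; last exact: measurable_funX.
  by apply: measurable_funM => //; exact: (continuous_measurable Wc).
(* The quotient of the cube between Phi + y and Phi + z. *)
- move=> x y z yr zr; exists (W x + ((Phi x + y) ^+ 2 + (Phi x + y) * (Phi x + z) + (Phi x + z) ^+ 2)).
    by ring.
  move=> j jr thj; have jM := mem_r jr; have pc := Phi_close jM thj.
  rewrite /q_ opprD addrACA subrr add0r; apply: le_trans rho4; apply: sqr_close => //.
    by have := ler_normD (Phi x - F j x) y; rewrite addrAC; move: pc yr; lra.
  by have := ler_normD (Phi x - F j x) z; rewrite addrAC; move: pc zr; lra.
- by under eq_fun do rewrite addr0; exact: residual_L2.
have c3e : 0 <= c3 * e.
  rewrite mulr_ge0 ?(ltW e_gt0)// !addr_ge0// ?mulr_ge0// ?addr_ge0//; exact: ltW.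
have uc := has_deriv_continuous uu1.
have urho x : `|u x| <= rho.
  by apply: le_trans (H2le_continuous_sup hs c3e u1c uu1 H x) rho2.
have pc : continuous (fun x => u x + Phi x) by exact: continuous_add.
exists u, u1, (fun x => W x * (Phi x + u x) + (Phi x + u x) ^+ 3 - Phi2 x); split=> //; split.
- have h1 := has_derivD uu1 Phi'Phi1.
  have u2c : continuous (fun x => W x * (Phi x + u x) + (Phi x + u x) ^+ 3 - Phi2 x).
    exact: (continuous_sub (continuous_cubic Wc (continuous_add Phic uc)) Phi2c).
  (* The right side of the equation is continuous, so the weak solution is classical. *)
  have h2 := has_derivD (weak_has_deriv hs (_ : weak_derivative u1 _) u1c u2c) Phi1'Phi2.
  apply: (has_deriv_GP_solution h1).
  rewrite (_ : (fun x => _ * _ + _) = (fun x => W x * (Phi x + u x) + (Phi x + u x) ^+ 3 - Phi2 x + Phi2 x)).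
    by apply: h2; case: H.
  by apply/funext => x; rewrite subrK [u x + _]addrC.
- exists (rho + m * Kx * K) => x; apply: le_trans (ler_normD _ _) _.
  by rewrite lerD// PhiK.
- apply: glue_inv => // x j jr thj; have jM := mem_r jr; have pcl := Phi_close jM thj.
  rewrite /GP_potential /q_ opprD addrACA subrr add0r.
  rewrite (_ : 3 * (u x + Phi x) ^+ 2 = (u x + Phi x) ^+ 2 + (u x + Phi x) * (u x + Phi x) + (u x + Phi x) ^+ 2); last by ring.
  apply: le_trans rho4; have h : `|u x + Phi x - F j x| <= m * Kx * eta + rho.
    by have := ler_normD (u x) (Phi x - F j x); rewrite addrA; have := urho x; lra.
  exact: sqr_close.
Qed.

End Chain.

(** * From the primary fronts to the chain: choice of constants *)

Section Fronts.
Context {R : realType}.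

Lemma GP_solutionN omega (V : R -> R) mu f : GP_solution omega V mu f ->
  GP_solution omega V mu (fun x => - f x).
Proof.
move=> /GP_solution_has_deriv[f1 f2].
apply: (has_deriv_GP_solution (has_derivN f1)).
rewrite (_ : (fun x => _ * _ + _) = (fun x => - ((mu * V x + omega) * f x + f x ^+ 3))).
  exact: has_derivN.
by apply/funext => x; ring.
Qed.

Lemma periodic_derive1 (f f1 : R -> R) (T : R) : has_deriv f f1 -> periodic f T -> periodic f1 T.
Proof.
move=> ff fT; have h := has_deriv_shift (- T) ff.
rewrite (_ : (fun x => f (x - - T)) = f) in h; last by apply/funext => x; rewrite opprK fT.
by move=> x; have := has_deriv_unique ff h => /(congr1 (fun g => g x)); rewrite opprK.
Qed.

Lemma large_period (T D : R) : 0 < T -> exists N : nat, forall n, (N <= n)%N -> D <= n%:R * T.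
Proof.
move=> T0; exists (Num.truncn (D / T)).+1 => n Nn.
rewrite -ler_pdivrMr//; apply: (le_trans (ltW (truncnS_gt _))).
by rewrite ler_nat.
Qed.

(** All constants, e1 and G included, are fixed before eta; only the decay radius A and then the
    threshold N depend on eta. *)
Lemma front_gluing (omega T mu : R) (V s p vp vm : R -> R) (M n0 : nat)
    (chi : nat -> nat -> R -> R) (psi_ v_m v_p : nat -> R -> R) :
  0 < T -> continuous V -> periodic V T -> smooth_step s -> (0 < M)%N ->
  cutoff_family T M n0 chi ->
  nondegenerate_solution omega V mu p -> (forall x, p (- x) = - p x) ->
  H2 (fun x => s x * (p x - vp x)) -> (forall x, vm x = - vp x) ->
  periodic vp T -> (forall x, vp (- x) = vp x) -> GP_solution omega V mu vp ->
  (forall j, (1 <= j <= M)%N -> primary_front p vp vm (psi_ j) (v_m j) (v_p j)) ->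
  (forall j, (1 <= j < M)%N -> v_p j = v_m j.+1) ->
  exists e1 G : R, [/\ 0 < e1, 0 <= G & forall eta, 0 < eta -> eta <= e1 ->
    exists N : nat, forall n, (N <= n)%N -> exists u : R -> R,
      (exists u1 u2, H2le u u1 u2 (G * eta)) /\
      nondegenerate_solution omega V mu (fun x => u x + \sum_(1 <= j < M.+1)
        chi j n x * psi_ j (x - j%:R * n%:R * T))].
Proof.
move=> T0 Vc VT hs M0 chiP [psol [Kp pK] inv] podd Hp vmE vpT veven vpsol frontP matchP.
have [KV KV0 VK] := periodic_bounded T0 Vc VT.
have [p1 p2] := GP_solution_has_deriv psol; have [vp1 vp2] := GP_solution_has_deriv vpsol.
have pc := has_deriv_continuous p1.
have Kp0 : 0 <= Kp := le_trans (normr_ge0 _) (pK 0).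
pose Kq := `|mu| * KV + `|omega| + 3 * Kp ^+ 2.
have Kq0 : 0 <= Kq by rewrite !addr_ge0// mulr_ge0// sqr_ge0.
have qK x : `|GP_potential omega V mu p x| <= Kq.
  apply: le_trans (ler_normD _ _) _; apply: lerD.
    by apply: le_trans (ler_normD _ _) _; rewrite lerD// normrM ler_wpM2l.
  rewrite normrM normrX ger0_norm// ler_wpM2l// lerXn2r// nnegrE//.
have [C C0 [solv coer]] := invertible_solvable hs (continuous_measurable Vc)
  (continuous_measurable pc) Kq0 qK inv.
have [Kx' Kx'0 hX] := cutoff_familyP M0 chiP.
pose Kx := Kx' + 1; have Kx0 : 0 < Kx by rewrite ltr_wpDl.
have [B B0 hB] := plateauP hs.
(* Defaulting to p makes every index a genuine front, as the hypotheses on a chain range over all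
   j. *)
pose ps j := if (1 <= j <= M)%N then psi_ j else p.
have psE j : ps j = p \/ ps j = (fun x => - p x).
  by rewrite /ps; case: ifP => [/frontP[] []|_]; auto.
have pssol j : GP_solution omega V mu (ps j).
  by have [->|->] := psE j => //; exact: GP_solutionN.
have psK j x : `|ps j x| <= Kp by have [->|->] := psE j; rewrite ?normrN.
(* The linearization sees only the square of a front, hence not its sign. *)
have pssqr j x : ps j x ^+ 2 = p x ^+ 2 by have [->|->] := psE j; rewrite ?sqrrN.
pose m : R := (size (index_iota 1 M.+1))%:R.
have m0 : 0 < m by rewrite ltr0n size_iota subn1.
pose K1 := 4 * m * C; pose c3 := 2 * K1 + 1 + (Kq + 1) * (2 * K1).
pose E := m * Kx * (6 * (m * Kx * Kp + Kp) ^+ 2 + 3) * (2 * M%:R).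
have mC0 : 0 < m * C by rewrite mulr_gt0.
have K10 : 0 <= K1 by rewrite mulr_ge0 ?(ltW C0)// mulr_ge0// ltW.
have mKx0 : 0 < m * Kx by rewrite mulr_gt0.
have c30 : 0 <= c3 by have h := mulr_ge0 (addr_ge0 Kq0 ler01) K10; rewrite /c3; lra.
have E0 : 0 <= E.
  by rewrite mulr_ge0// mulr_ge0 ?(ltW mKx0)// addr_ge0// mulr_ge0// sqr_ge0.
(* Takes 1/4 of the 1/2 available in [small]; the commutators get the other 1/4. *)
pose eps := Num.min 1 (1 / (4 * (m * C))).
have eps0 : 0 < eps by rewrite lt_min ltr01 divr_gt0// mulr_gt0.
have eps1 : eps <= 1 by rewrite ge_min lexx.
have epsm : m * C * eps <= 1 / 4.
  apply: (@le_trans _ _ (m * C * (1 / (4 * (m * C))))).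
    by rewrite ler_wpM2l ?(ltW mC0)// ge_min lexx orbT.
  by rewrite le_eqVlt; apply/orP; left; apply/eqP; field; rewrite !gt_eqF.
(* The radius will be rho = g eta, the sum of what [rho1] and [rho2] require. *)
pose g := 4 * K1 * E + 2 * (c3 * E).
have g0 : 0 <= g by have h1 := mulr_ge0 K10 E0; have h2 := mulr_ge0 c30 E0; rewrite /g; lra.
(* Chosen so that D eta <= eps is [rho4]; as D >= m Kx + g and eps <= 1, it also implies [rho3]. *)
pose D := 3 * (2 * Kp + 1) * (m * Kx + g).
have mg : 0 < m * Kx + g by rewrite ltr_wpDr.
have D0 : 0 < D by rewrite mulr_gt0// mulr_gt0// ltr_wpDl// mulr_ge0.
have mgD : m * Kx + g <= D.
  by rewrite /D ler_peMl ?(ltW mg)//; lra.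
exists (eps / D), (c3 * E); split; [by rewrite divr_gt0|by rewrite mulr_ge0|].
move=> eta eta0; rewrite ler_pdivlMr// mulrC => etaD.
have eta20 : 0 < eta / 2 by rewrite divr_gt0.
have [A A0 hA] := front_decay_right hs Vc psol vpsol Hp eta20.
(* For plateau slopes d with d y <= 1, the commutator share of [small] is d (y - 1) / 4 <= 1/4. *)
pose y := 12 * (m * C) * (6 + 2 * Kq) + 1.
have y1 : 1 <= y by rewrite lerDr mulr_ge0 ?addr_ge0 ?mulr_ge0// ltW.
(* One threshold for three demands: L >= 8, slopes with d y <= 1, and A + 1 <= L/4. *)
have [N hN] := large_period (8 + 8 * B * y + 4 * (A + 1)) T0.
exists (maxn N n0) => n; rewrite geq_max => /andP[/hN nL nn0].
have [X [XE Xs XK Xw Xsum]] := hX n nn0.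
set L := n%:R * T in nL Xw.
have By : 0 <= 8 * B * y by rewrite mulr_ge0 ?mulr_ge0// (le_trans ler01).
have [L8 L0 AL LBy] : [/\ 8 <= L, 0 < L, A + 1 <= L / 4 & 8 * B * y <= L].
  by move: By nL A0; clear; move: (8 * B * y) => z *; split; lra.
have dy : 8 / L * B * y <= 1.
  rewrite (_ : 8 / L * B * y = 8 * B * y / L); last by ring.
  by rewrite ler_pdivrMr// mul1r.
have d0 : 0 <= 8 / L * B by rewrite mulr_ge0// divr_ge0// ltW.
have d1 : 8 / L * B <= 1 by apply: le_trans dy; rewrite ler_peMr.
have shift j x : x - j%:R * L = x - j%:R * n%:R * T by rewrite mulrA.
pose F j x := ps j (x - j%:R * L); pose F1 j x := derive1 (ps j) (x - j%:R * L).
have F'F1 j : has_deriv (F j) (F1 j).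
  by apply: has_deriv_shift; have [] := GP_solution_has_deriv (pssol j).
have F1'F2 j : has_deriv (F1 j) (fun x => (mu * V x + omega) * F j x + F j x ^+ 3).
  have [_ /(has_deriv_shift (j%:R * L))] := GP_solution_has_deriv (pssol j).
  rewrite (_ : (fun x => (mu * V (x - j%:R * L) + omega) * ps j (x - j%:R * L) + ps j (x - j%:R * L) ^+ 3) =
    (fun x => (mu * V x + omega) * F j x + F j x ^+ 3))//.
  by apply/funext => x; rewrite /F shift (periodic_shift _ _ _ VT).
have qE j : (fun x => mu * V x + omega + 3 * F j x ^+ 2) =
    (fun x => GP_potential omega V mu p (x - j%:R * L)).
  by apply/funext => x; rewrite /GP_potential /F pssqr shift (periodic_shift _ _ _ VT).
have XK' j x : [/\ `|X j x| <= Kx, `|derive1 (X j) x| <= Kx & `|derive1 (derive1 (X j)) x| <= Kx].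
  have KK : Kx' <= Kx by rewrite lerDl.
  by have [h1 h2 h3] := XK j x; split; exact: le_trans KK.
have hPl j := hB L M j L8 d1.
have close i j x : (1 <= i <= M)%N -> (1 <= j <= M)%N -> plateau s L M i x != 0 ->
    window L M j x -> `|F j x - F i x| <= eta /\ `|F1 j x - F1 i x| <= eta.
  move=> iM jM thi wj; have [il ir] := plateau_neq0 hs L0 thi.
  have vper k : (1 <= k <= M)%N -> [/\ periodic (v_m k) T, periodic (v_p k) T,
      periodic (derive1 (v_m k)) T & periodic (derive1 (v_p k)) T].
    have vmE' : vm = (fun x => - vp x) by apply/funext.
    have vp'T := periodic_derive1 vp1 vpT.
    have vmT : periodic vm T by move=> z; rewrite !vmE vpT.
    have vm'T : periodic (derive1 vm) T.
      by rewrite vmE' (has_derivE (has_derivN vp1)) => z; rewrite vp'T.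
    by move=> /frontP[] [_ -> ->].
  have dec k (kM : (1 <= k <= M)%N) := front_decay p1 vp1 podd vmE veven hA (frontP k kM).
  (* Two neighbours are each within eta/2 of their common end state. *)
  have e2 : eta = 2 * (eta / 2) by field.
  rewrite e2; split.
    apply: (@chain_close _ L M A (eta / 2) F v_m v_p i j x iM jM AL A0 (ltW eta20)) => //.
    - move=> k kM xk; have [_ h _ _] := vper k kM.
      rewrite -(periodic_shift k n x h) -shift /F /ps kM.
      by have [/(_ _ xk)[]] := dec k kM.
    - move=> k kM xk; have [h _ _ _] := vper k kM.
      rewrite -(periodic_shift k n x h) -shift /F /ps kM.
      by have [_ /(_ _ xk)[]] := dec k kM.
    - by move=> k kM; rewrite matchP.
  apply: (@chain_close _ L M A (eta / 2) F1 (fun k => derive1 (v_m k)) (fun k => derive1 (v_p k))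
    i j x iM jM AL A0 (ltW eta20)) => //.
  - move=> k kM xk; have [_ _ _ h] := vper k kM.
    rewrite -(periodic_shift k n x h) -shift /F1 /ps kM.
    by have [/(_ _ xk)[]] := dec k kM.
  - move=> k kM xk; have [_ _ h _] := vper k kM.
    rewrite -(periodic_shift k n x h) -shift /F1 /ps kM.
    by have [_ /(_ _ xk)[]] := dec k kM.
  - by move=> k kM; rewrite matchP.
have small : m * C * (eps + 3 * (8 / L * B) * (6 + 2 * Kq)) <= 1 / 2.
  have h : m * C * (3 * (8 / L * B) * (6 + 2 * Kq)) <= 1 / 4.
    move: dy d0; move: (8 / L * B) => t ty t0.
    have h : 4 * (m * C * (3 * t * (6 + 2 * Kq))) = t * y - t by rewrite /y; ring.
    by move: h ty t0; clear; move: (m * C * _) (t * y) => u v *; lra.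
  rewrite mulrDr (_ : 1 / 2 = 1 / 4 + 1 / 4); last by field.
  exact: lerD.
have rho3 : m * Kx * eta + g * eta <= 1.
  rewrite -mulrDl; apply: le_trans eps1; apply: le_trans etaD.
  by rewrite ler_wpM2r// ltW.
have rho4 : 3 * (2 * Kp + 1) * (m * Kx * eta + g * eta) <= eps.
  by rewrite -mulrDl mulrA.
have gE : g * eta = 4 * K1 * (E * eta) + 2 * (c3 * (E * eta)) by rewrite /g; ring.
have Ee := mulr_ge0 E0 (ltW eta0).
have [] := @chain_solution _ s M L B omega mu V F F1 X Kp Kx C Kq eps eta (g * eta)
  hs M0 L8 B0 d1 Vc F'F1 F1'F2 Xs XK' Xw Xsum Kp0 (fun j x => psK j _) Kx0 C0 Kq0.
- by move=> j x; have := congr1 (fun h => h x) (qE j) => /= ->.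
- by move=> j; rewrite qE; exact: solvable_shift.
- by move=> j; rewrite qE; exact: coercive_shift.
- exact: ltW.
- exact: eps1.
- exact: small.
- by move=> j x; have [] := hPl j.
- by move=> j x; have [] := hPl j.
- by move=> j x; have [] := hPl j.
- by move=> j; have [] := hPl j.
- exact: eta0.
- exact: close.
- rewrite -/m -/K1 -/E gE lerDl; exact: mulr_ge0 (ler0n _ _) (mulr_ge0 c30 Ee).
- rewrite -/m -/K1 -/c3 -/E gE lerDr; exact: mulr_ge0 (mulr_ge0 (ler0n _ _) K10) Ee.
- exact: rho3.
- exact: rho4.
rewrite -/m -/K1 -/c3 -/E => u [u1 [u2 [H nd]]].
exists u; split; first by exists u1, u2; rewrite -mulrA.
rewrite (_ : (fun x => _) = (fun x => u x + \sum_(1 <= j < M.+1) X j x * F j x))//.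
apply/funext => x; congr (_ + _); apply: eq_big_nat => j; rewrite ltnS => jM.
by rewrite -XE// /F /ps jM shift.
Qed.

End Fronts.

Theorem corollary8p12 (R : realType) (omega T : R) (V : R -> R)
    (omega_lt0 : omega < 0) (T_gt0 : 0 < T)
    (V_derivable : forall x, derivable V x 1) (V'_continuous : continuous (derive1 V))
    (V_even : forall x, V (- x) = V x) (V_periodic : periodic V T)
    (V_generic : \int[@lebesgue_measure R]_x
       (derive1 V x * black_soliton omega x * derive1 (black_soliton omega) x) <> 0)
    (chip chim : R -> R) (chipm : cutoff_pair chip chim)
    (C mu0 : R) (C_gt0 : 0 < C) (mu0_gt0 : 0 < mu0) (psi vp vm : R -> R -> R)
    (psiP : primary_front_family omega T V chip chim C mu0 psi vp vm)
    (M : nat) (M_gt0 : (0 < M)%N)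
    (n0 : nat) (chi : nat -> nat -> R -> R) (chiP : cutoff_family T M n0 chi)
    (mu : R) (mu_range : 0 < mu < mu0)
    (psi_ v_m v_p : nat -> R -> R)
    (psi_P : forall j, (1 <= j <= M)%N ->
       primary_front (psi mu) (vp mu) (vm mu) (psi_ j) (v_m j) (v_p j))
    (matching : forall j, (1 <= j < M)%N -> v_p j = v_m j.+1) :
  exists (N : nat) (a psit : nat -> R -> R),
    (forall n, (N <= n)%N ->
       [/\ nondegenerate_solution omega V mu (psit n),
           H2 (a n) &
           forall x, psit n x =
             a n x + \sum_(1 <= j < M.+1)
                       chi j n x * psi_ j (x - j%:R * n%:R * T)]) /\
    (H2norm (a n) @[n --> \oo] --> 0%E).
Proof.
have hs := cutoff_pair_step chipm.
have Vc := has_deriv_continuous (derivable_has_deriv V_derivable).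
have [[nd odd _] [Hp _] vmE [[vpT _] veven vpsol _] _] := psiP mu mu_range.
have [e1 [G [e10 G0 key]]] := front_gluing T_gt0 Vc V_periodic hs M_gt0 chiP nd odd Hp vmE
  vpT veven vpsol psi_P matching.
have [a [N [aN acvg]]] := @diagonal_choice _ (R -> R : choiceType) (fun=> 0)
  (fun n u e => (exists u1 u2, H2le u u1 u2 (G * e)) /\
     nondegenerate_solution omega V mu (fun x => u x + \sum_(1 <= j < M.+1)
       chi j n x * psi_ j (x - j%:R * n%:R * T))) e1 e10 key.
exists N, a, (fun n x => a n x + \sum_(1 <= j < M.+1) chi j n x * psi_ j (x - j%:R * n%:R * T)).
split.
  move=> n /aN[e /andP[e0 _] [[u1 [u2 H]] ndn]]; split=> //.
  by apply/H2P; exists u1, u2, (G * e); rewrite mulr_ge0// ltW.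
have bnd e : 0 < e -> \forall n \near \oo, (0 <= H2norm (a n) <= e%:E)%E.
  move=> e0; have G1 : 0 < 2 * G + 1 by rewrite ltr_wpDl// mulr_ge0.
  (* The H2 norm is at most 2 G e', and e' (2 G + 1) <= e; the added 1 covers G = 0. *)
  have [|N' hN'] := acvg (e / (2 * G + 1)); first by rewrite divr_gt0.
  exists N' => // n /= /hN'[e' [/andP[e'0 _] e'e] [[u1 [u2 H]] _]].
  rewrite {1}/H2norm poweR_ge0 /=.
  have Ge' : 0 <= G * e' by rewrite mulr_ge0// ltW.
  apply: le_trans (H2norm_le hs Ge' H) _; rewrite lee_fin.
  move: e'e; rewrite ler_pdivlMr// mulrDr mulr1 mulrCA [e' * G]mulrC; lra.
apply/fine_cvgP; split.
  apply: filterS (bnd 1 ltr01) => n /andP[h1 h2].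
  by rewrite ge0_fin_numE//; apply: le_lt_trans h2 _; exact: ltry.
apply/cvgrPdist_le => e e0; apply: filterS (bnd e e0) => n /andP[h1 h2] /=.
rewrite sub0r normrN ger0_norm ?fine_ge0// -lee_fin fineK//.
by rewrite ge0_fin_numE//; apply: le_lt_trans h2 _; exact: ltry.
Qed.
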